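(* Let $G$ be a group, let $\mathcal{F}\subseteq\mathcal{G}$ be families of subgroups of $G$, and let $\sim$ be an equivalence relation on $\mathcal{G}\setminus\mathcal{F}$ such that: (1) if $H,K\in\mathcal{G}\setminus\mathcal{F}$ with $H\subseteq K$, then $H\sim K$; (2) if $H,K\in\mathcal{G}\setminus\mathcal{F}$ and $g\in G$, then $H\sim K \Leftrightarrow gHg^{-1}\sim gKg^{-1}$. Let $I$ be a complete system of representatives $[H]$ of the $G$-orbits in $[\mathcal{G}\setminus\mathcal{F}]$ under the $G$-action coming from conjugation. Choose arbitrary $N_G[H]$-CW-models for $E_{\mathcal{F}\cap N_G[H]}(N_G[H])$ and $E_{\mathcal{G}[H]}(N_G[H])$ for each $[H]\in I$, and an arbitrary $G$-CW-model for $E_{\mathcal{F}}(G)$. Define a $G$-CW-complex $X$ by a cellular $G$-pushout $$\begin{array}{ccc} \coprod_{[H]\in I} G\times_{N_G[H]}E_{\mathcal{F}\cap N_G[H]}(N_G[H]) & \xrightarrow{\ i\ } & E_{\mathcal{F}}(G)\\ \big\downarrow{\scriptstyle \coprod_{[H]\in I}\mathrm{id}_G\times_{N_G[H]}f_{[H]}} & & \big\downarrow\\ \coprod_{[H]\in I} G\times_{N_G[H]}E_{\mathcal{G}[H]}(N_G[H]) & \longrightarrow & X \end{array}$$ such that either $f_{[H]}$ is a cellular $N_G[H]$-map for every $[H]\in I$ and $i$ is an inclusion of $G$-CW-complexes, or $f_{[H]}$ is an inclusion of $N_G[H]$-CW-complexes for every $[H]\in I$ and $i$ is a cellular $G$-map.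 Then $X$ is a model for $E_{\mathcal{G}}(G)$.
   Context: Groups are discrete. A family of subgroups of $G$ is a set of subgroups of $G$ closed under conjugation and under taking subgroups. For a family $\mathcal{F}$, a model for the classifying space $E_{\mathcal{F}}(G)$ is a $G$-CW-complex $X$ such that the fixed point set $X^H$ is contractible for $H\in\mathcal{F}$ and empty for every subgroup $H\notin\mathcal{F}$. (Such a model always exists and is unique up to $G$-homotopy equivalence.) Notation: $[\mathcal{G}\setminus\mathcal{F}]$ is the set of equivalence classes of $\sim$ and $[H]$ is the class of $H\in\mathcal{G}\setminus\mathcal{F}$. Conjugation induces a $G$-action on $[\mathcal{G}\setminus\mathcal{F}]$ with isotropy group at $[H]$ the subgroup $N_G[H]:=\{g\in G\mid [g^{-1}Hg]=[H]\}$. The family $\mathcal{G}[H]$ of subgroups of $N_G[H]$ is $$\mathcal{G}[H]:=\{K\subseteq N_G[H]\mid K\in\mathcal{G}\setminus\mathcal{F},\ [K]=[H]\}\cup(\mathcal{F}\cap N_G[H]),$$ where $\mathcal{F}\cap N_G[H]$ is the family of all subgroups of $N_G[H]$ belonging to $\mathcal{F}$. *)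

(* Defs.v *)
From HB Require Import structures.
From mathcomp Require Import all_boot all_order all_algebra.
From mathcomp Require Import all_classical all_reals.
From mathcomp Require Import topology.
Import numFieldTopology.Exports.
Set Implicit Arguments.
Unset Strict Implicit.
Unset Printing Implicit Defensive.
Import Order.TTheory GRing.Theory Num.Theory.

Local Open Scope classical_set_scope.
Local Open Scope quotient_scope.
Local Open Scope group_scope.

Record subgroup (G : groupType) := Subgroup {
  sg_set :> set G;
  sg1 : sg_set 1;
  sgM : forall x y, sg_set x -> sg_set y -> sg_set (x * y);
  sgV : forall x, sg_set x -> sg_set x^-1
}.

HB.instance Definition _ (G : groupType) := gen_eqMixin (subgroup G).
HB.instance Definition _ (G : groupType) := gen_choiceMixin (subgroup G).

Lemma subgroupP (G : groupType) (H K : subgroup G) :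
  (H : set G) = K -> H = K.
Proof.
case: H K => [H H1 HM HV] [K K1 KM KV] /= E; subst K.
by congr Subgroup; exact: Prop_irrelevance.
Qed.

Definition subgroup_type (G : groupType) (N : subgroup G) : Type := set_type N.

Section SubgroupType.
Context (G : groupType) (N : subgroup G).

Lemma subgroup_closed :
  group_closed ((fun x => x \in (N : set G)) : {pred G}).
Proof.
split=> [|x y]; rewrite -!topredE /= ?inE => *; first exact: sg1.
by apply: sgM => //; exact: sgV.
Qed.

HB.instance Definition _ := SubChoice.copy (subgroup_type N) (set_type N).
HB.instance Definition _ :=
  SubChoice_isSubGroup.Build G (fun x => x \in (N : set G)) (subgroup_type N)
    subgroup_closed.
End SubgroupType.

Definition sg_val (G : groupType) (N : subgroup G) (n : subgroup_type N) : G :=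
  \val n.

Lemma sg_valP (G : groupType) (N : subgroup G) (n : subgroup_type N) :
  sg_set N (sg_val n).
Proof. exact: set_mem (valP n). Qed.

Lemma sg_val1 (G : groupType) (N : subgroup G) :
  sg_val (1 : subgroup_type N) = 1.
Proof. exact: val1. Qed.

Lemma sg_valM (G : groupType) (N : subgroup G) (m n : subgroup_type N) :
  sg_val (m * n) = sg_val m * sg_val n.
Proof. exact: valM. Qed.

Lemma sg_valV (G : groupType) (N : subgroup G) (n : subgroup_type N) :
  sg_val n^-1 = (sg_val n)^-1.
Proof.
apply/esym/mulg1_eq; rewrite -sg_valM mulgV; exact: sg_val1.
Qed.

Section ConjugateSubgroup.
Context (G : groupType) (g : G) (K : subgroup G).

Lemma conj_subgroup1 : [set g * k * g^-1 | k in K] 1.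
Proof. by exists 1; [exact: sg1|rewrite mulg1 mulgV]. Qed.

Lemma conj_subgroupM x y : [set g * k * g^-1 | k in K] x ->
  [set g * k * g^-1 | k in K] y -> [set g * k * g^-1 | k in K] (x * y).
Proof.
move=> [k Kk <-] [l Kl <-]; exists (k * l); first exact: sgM.
by rewrite !mulgA mulgVK.
Qed.

Lemma conj_subgroupV x : [set g * k * g^-1 | k in K] x ->
  [set g * k * g^-1 | k in K] x^-1.
Proof.
move=> [k Kk <-]; exists k^-1; first exact: sgV.
by rewrite !invgM invgK mulgA.
Qed.

Definition conj_subgroup : subgroup G :=
  Subgroup conj_subgroup1 conj_subgroupM conj_subgroupV.
End ConjugateSubgroup.

Lemma conj_subgroupE (G : groupType) (g : G) (K : subgroup G) x :
  sg_set (conj_subgroup g K) x <-> sg_set K (g^-1 * x * g).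
Proof.
split=> [[k Kk <-]|Kx]; first by rewrite !mulgA mulVg mul1g mulgVK.
by exists (g^-1 * x * g) => //; rewrite !mulgA mulgV mul1g mulgK.
Qed.

Lemma conj_subgroup_id (G : groupType) (K : subgroup G) : conj_subgroup 1 K = K.
Proof.
apply: subgroupP; apply/seteqP; split=> x; rewrite conj_subgroupE;
  by rewrite invg1 mul1g mulg1.
Qed.

Lemma conj_subgroup_comp (G : groupType) (g h : G) (K : subgroup G) :
  conj_subgroup g (conj_subgroup h K) = conj_subgroup (g * h) K.
Proof.
apply: subgroupP; apply/seteqP; split=> x; rewrite !conj_subgroupE;
  by rewrite invgM !mulgA.
Qed.

(* A subgroup of N, viewed as a subgroup of G. *)
Section AmbientSubgroup.
Context (G : groupType) (N : subgroup G) (K : subgroup (subgroup_type N)).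

Lemma ambient1 : [set sg_val k | k in K] 1.
Proof. by exists 1; [exact: sg1|exact: sg_val1]. Qed.

Lemma ambientM x y : [set sg_val k | k in K] x -> [set sg_val k | k in K] y ->
  [set sg_val k | k in K] (x * y).
Proof.
by move=> [k Kk <-] [l Kl <-]; exists (k * l); [exact: sgM|exact: sg_valM].
Qed.

Lemma ambientV x :
  [set sg_val k | k in K] x -> [set sg_val k | k in K] x^-1.
Proof. by move=> [k Kk <-]; exists k^-1; [exact: sgV|exact: sg_valV]. Qed.

Definition ambient : subgroup G := Subgroup ambient1 ambientM ambientV.
End AmbientSubgroup.

Lemma ambient_conj (G : groupType) (N : subgroup G) (n : subgroup_type N)
    (K : subgroup (subgroup_type N)) :
  ambient (conj_subgroup n K) = conj_subgroup (sg_val n) (ambient K).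
Proof.
apply: subgroupP; apply/seteqP; split=> x /=.
- move=> [_ [k Kk <-] <-]; exists (sg_val k); first by exists k.
  by rewrite !sg_valM sg_valV.
- move=> [_ [k Kk <-] <-]; exists (n * k * n^-1); first by exists k.
  by rewrite !sg_valM sg_valV.
Qed.

Record subgroup_family (G : groupType) := Family {
  fam_set :> set (subgroup G);
  fam_conj : forall g H, fam_set H -> fam_set (conj_subgroup g H);
  fam_sub : forall H K : subgroup G, K `<=` H -> fam_set H -> fam_set K
}.

(* F cap N, as a family of subgroups of the group N. *)
Section RestrictFamily.
Context (G : groupType) (F : subgroup_family G) (N : subgroup G).

Lemma fam_restrict_conj n (H : subgroup (subgroup_type N)) :
  fam_set F (ambient H) -> fam_set F (ambient (conj_subgroup n H)).
Proof. by rewrite ambient_conj; exact: fam_conj. Qed.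

Lemma fam_restrict_sub (H K : subgroup (subgroup_type N)) :
  K `<=` H -> fam_set F (ambient H) -> fam_set F (ambient K).
Proof. by move=> KH; apply: fam_sub; exact: image_subset. Qed.

Definition fam_restrict : subgroup_family (subgroup_type N) :=
  @Family _ [set K | fam_set F (ambient K)] fam_restrict_conj fam_restrict_sub.
End RestrictFamily.

Definition fam_diff (G : groupType) (F Gf : subgroup_family G) : Type :=
  set_type [set H : subgroup G | fam_set Gf H /\ ~ fam_set F H].

HB.instance Definition _ (G : groupType) (F Gf : subgroup_family G) :=
  Choice.copy (fam_diff F Gf) (set_type [set H : subgroup G | fam_set Gf H /\ ~ fam_set F H]).

Section FamilyDifference.
Context (G : groupType) (F Gf : subgroup_family G).
Local Notation D := (fam_diff F Gf).

Definition fd_val (H : D) : subgroup G := \val H.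

Lemma fd_valP (H : D) : fam_set Gf (fd_val H) /\ ~ fam_set F (fd_val H).
Proof. exact: (set_mem (valP H)). Qed.

Lemma fd_val_inj : injective fd_val.
Proof. exact: val_inj. Qed.

Definition fd_mk (H : subgroup G) (GH : fam_set Gf H) (FH : ~ fam_set F H) : D :=
  exist _ H (mem_set (conj GH FH)).

Lemma fd_conj_notin g (H : D) : ~ fam_set F (conj_subgroup g (fd_val H)).
Proof.
have [_ FH] := fd_valP H.
move=> /(@fam_conj _ F g^-1); rewrite conj_subgroup_comp mulVg.
by rewrite conj_subgroup_id.
Qed.

Definition fd_conj (g : G) (H : D) : D :=
  fd_mk (fam_conj g (fd_valP H).1) (@fd_conj_notin g H).

Record admissible (sim : D -> D -> Prop) : Prop := Admissible {
  adm_refl : forall H, sim H H;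
  adm_sym : forall H K, sim H K -> sim K H;
  adm_trans : forall H K L, sim H K -> sim K L -> sim H L;
  adm_sub : forall H K : D, fd_val H `<=` fd_val K -> sim H K;
  adm_conj : forall (g : G) (H K : D),
    sim H K <-> sim (fd_conj g H) (fd_conj g K)
}.

Definition rep_val (I : set D) (H : set_type I) : D := \val H.

Context (sim : D -> D -> Prop).

Definition sim_class (H : D) : set D := [set K | sim H K].

(* {[H] | H in I} is a complete system of representatives of the G-orbits in the
   set of classes, where I contains one chosen member H of each of its
   elements. *)
Definition orbit_representatives (I : set D) : Prop :=
  forall K : D, exists! H : D,
    I H /\ exists g : G, sim_class (fd_conj g H) = sim_class K.

Hypothesis adm : admissible sim.

Lemma sim_classE (H K : D) : sim_class H = sim_class K <-> sim H K.
Proof.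
split=> [E|HK].
  have : sim_class K K by exact: (adm_refl adm).
  by rewrite -E.
apply/seteqP; split=> L /= HL; apply: (adm_trans adm) HL => //.
exact: (adm_sym adm).
Qed.

Lemma fd_conj1 (H : D) : fd_conj 1 H = H.
Proof. by apply: fd_val_inj; exact: conj_subgroup_id. Qed.

Lemma fd_conjM (g h : G) (H : D) : fd_conj g (fd_conj h H) = fd_conj (g * h) H.
Proof. by apply: fd_val_inj; exact: conj_subgroup_comp. Qed.

(* N_G[H] = {g | [g^-1 H g] = [H]} *)
Section NormalizerOfClass.
Context (H : D).
Let N : set G := [set g | sim_class (fd_conj g^-1 H) = sim_class H].

Lemma class_normalizer1 : N 1.
Proof. by rewrite /N /= invg1 fd_conj1. Qed.

Lemma class_normalizerM x y : N x -> N y -> N (x * y).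
Proof.
rewrite /N /= !sim_classE => Nx Ny; rewrite invgM -fd_conjM.
by apply: (adm_trans adm) Ny; exact: (iffLR (adm_conj adm _ _ _)).
Qed.

Lemma class_normalizerV x : N x -> N x^-1.
Proof.
rewrite /N /= !sim_classE => /(adm_conj adm x).
by rewrite fd_conjM mulgV fd_conj1 invgK; exact: (adm_sym adm).
Qed.

Definition class_normalizer : subgroup G :=
  @Subgroup G [set g | sim_class (fd_conj g^-1 H) = sim_class H]
    class_normalizer1 class_normalizerM class_normalizerV.
End NormalizerOfClass.

(* The family G[H] of subgroups of N_G[H]; a subgroup K of N_G[H] lies in it
   when, as a subgroup of G, it is in Gf but not in F and [K] = [H], or it is
   in F. *)
Section ClassFamily.
Context (H : D).
Local Notation N := (class_normalizer H).
Let M : set (subgroup (subgroup_type N)) := [set K |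
  exists2 K' : D, fd_val K' = ambient K & sim_class K' = sim_class H]
  `|` fam_set (fam_restrict F N).

Lemma class_family_conj n K : M K -> M (conj_subgroup n K).
Proof.
move=> [[K' K'E /sim_classE K'H]|FK]; last by right; exact: fam_conj.
left; exists (fd_conj (sg_val n) K').
  by rewrite ambient_conj -K'E.
have nH : sim (fd_conj (sg_val n) H) H.
  by have /= /sim_classE := sgV (sg_valP n); rewrite invgK.
by apply/sim_classE; apply: (adm_trans adm) nH; exact: (iffLR (adm_conj adm _ _ _)).
Qed.

Lemma class_family_sub (K L : subgroup (subgroup_type N)) :
  L `<=` K -> M K -> M L.
Proof.
move=> LK [[K' K'E /sim_classE K'H]|FK]; last by right; exact: fam_sub FK.
have LK' : ambient L `<=` fd_val K' by rewrite K'E; exact: image_subset.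
have [FL|FL] := pselect (fam_set F (ambient L)); first by right.
have GL : fam_set Gf (ambient L) by apply: fam_sub LK' (fd_valP K').1.
left; exists (fd_mk GL FL) => //; apply/sim_classE.
by apply: (adm_trans adm) K'H; exact: (adm_sub adm).
Qed.

Definition class_family : subgroup_family (subgroup_type N) :=
  @Family _ ([set K |
    exists2 K' : D, fd_val K' = ambient K & sim_class K' = sim_class H]
    `|` fam_set (fam_restrict F N)) class_family_conj class_family_sub.
End ClassFamily.
End FamilyDifference.

(* G is discrete, so joint continuity of the action G x X -> X amounts to
   continuity of the action of each element. *)
Record gspace (G : groupType) := GSpace {
  gs_space :> topologicalType;
  gact : G -> gs_space -> gs_space;
  gact1 : forall x, gact 1 x = x;
  gactM : forall g h x, gact (g * h) x = gact g (gact h x);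
  gact_continuous : forall g, continuous (gact g)
}.

Definition gmap (G : groupType) (X Y : gspace G) (f : X -> Y) : Prop :=
  continuous f /\ forall g x, f (gact g x) = gact g (f x).

(* The square
       A --a--> B
       |        |
       b        c
       v        v
       C --d--> P
   is a pushout in the category of G-spaces. *)
Definition gpushout (G : groupType) (A B C P : gspace G)
    (a : A -> B) (b : A -> C) (c : B -> P) (d : C -> P) : Prop :=
  [/\ [/\ gmap a, gmap b, gmap c & gmap d], c \o a = d \o b &
    forall (Z : gspace G) (u : B -> Z) (v : C -> Z), gmap u -> gmap v ->
      u \o a = v \o b ->
      exists! h : P -> Z, [/\ gmap h, h \o c = u & h \o d = v]].

Definition ginvariant (G : groupType) (X : gspace G) (A : set X) : Prop :=
  forall g x, A x -> A (gact g x).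

Definition fixed_points (G : groupType) (X : gspace G) (H : subgroup G) :
  set X := [set x | forall h, sg_set H h -> gact h x = x].

Arguments fixed_points {G} X H.

Definition set_type_incl (T : Type) (A B : set T) (AB : A `<=` B)
  (x : set_type A) : set_type B :=
  exist _ (\val x) (mem_set (AB _ (set_mem (valP x)))).

Lemma set_type_continuous (T U : topologicalType) (A : set U) (f : T -> A) :
  continuous (fun x => \val (f x) : U) -> continuous f.
Proof.
by move=> cf; apply: (@continuous_comp_initial A T U set_val f).
Qed.

Lemma set_val_continuous (T : topologicalType) (A : set T) :
  continuous (fun x : set_type A => \val x : T).
Proof. exact: (@initial_continuous A T set_val). Qed.

Section GSubspace.
Context (G : groupType) (X : gspace G) (A : set X) (hA : ginvariant A).

Definition gsub_act (g : G) (x : set_type A) : set_type A :=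
  exist _ (gact g (\val x)) (mem_set (hA g (set_mem (valP x)))).

Lemma gsub_act1 x : gsub_act 1 x = x.
Proof. by apply: val_inj; exact: gact1. Qed.

Lemma gsub_actM g h x : gsub_act (g * h) x = gsub_act g (gsub_act h x).
Proof. by apply: val_inj; exact: gactM. Qed.

Lemma gsub_act_continuous g : continuous (gsub_act g).
Proof.
apply: set_type_continuous => x /=.
apply: (@continuous_comp _ _ _ (fun x : set_type A => \val x : X) (gact g)).
  exact: set_val_continuous.
exact: gact_continuous.
Qed.

Definition gsub : gspace G := GSpace gsub_act1 gsub_actM gsub_act_continuous.
End GSubspace.

Section GCoproduct.
Context (G : groupType) (I : choiceType) (X : I -> gspace G).
Local Notation T := {i : I & X i}.

Definition gcoprod_act (g : G) (u : T) : T :=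
  existT (fun i => X i : Type) (projT1 u) (gact g (projT2 u)).

Lemma gcoprod_act1 u : gcoprod_act 1 u = u.
Proof. by case: u => i x; rewrite /gcoprod_act /= gact1. Qed.

Lemma gcoprod_actM g h u :
  gcoprod_act (g * h) u = gcoprod_act g (gcoprod_act h u).
Proof. by case: u => i x; rewrite /gcoprod_act /= gactM. Qed.

Lemma gcoprod_act_continuous g : continuous (gcoprod_act g).
Proof.
move=> [i x] U /= nU.
have /= := @continuous_comp _ _ _ (@gact G (X i) g)
  (existT (fun i => X i : Type) i) x (@gact_continuous _ _ g x)
  (@existT_continuous I X i (gact g x)).
exact.
Qed.

Definition gcoprod : gspace G :=
  GSpace gcoprod_act1 gcoprod_actM gcoprod_act_continuous.
End GCoproduct.

Definition gcoprod_map (G : groupType) (I : choiceType) (X Y : I -> gspace G)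
  (f : forall i, X i -> Y i) (u : gcoprod X) : gcoprod Y :=
  existT (fun i => Y i : Type) (projT1 u) (f (projT1 u) (projT2 u)).

Lemma discrete_fst_continuous (S : choiceType) (T : topologicalType) (f : S -> S) :
  continuous (fun u : (discrete_topology S * T)%type =>
    ((f u.1, u.2) : (discrete_topology S * T)%type)).
Proof.
move=> [s t] U [[A B] /= [nA nB] AB].
exists ([set s], B) => /=; first by split=> //; exact: discrete_set1.
by move=> [s' t'] /= [-> Bt']; apply: AB; split=> //=; exact: nbhs_singleton nA.
Qed.

(* The discrete G-set G/K of left cosets. *)
Section Cosets.
Context (G : groupType) (K : subgroup G).

Definition coset_eq : rel G := fun g h => `[< sg_set K (g^-1 * h) >].

Lemma coset_eq_refl : reflexive coset_eq.
Proof. by move=> g; apply/asboolP; rewrite mulVg; exact: sg1. Qed.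

Lemma coset_eq_sym : symmetric coset_eq.
Proof.
have S g h : coset_eq g h -> coset_eq h g.
  by move=> /asboolP /sgV; rewrite invgM invgK => ?; exact/asboolP.
by move=> g h; apply/idP/idP; exact: S.
Qed.

Lemma coset_eq_trans : transitive coset_eq.
Proof.
move=> h g k /asboolP gh /asboolP hk; apply/asboolP.
by have := sgM gh hk; rewrite !mulgA mulgK.
Qed.

Definition coset_equiv := EquivRel coset_eq coset_eq_refl coset_eq_sym coset_eq_trans.

Definition cosets : choiceType := {eq_quot coset_equiv}.

Definition coset_act (g : G) (c : cosets) : cosets :=
  \pi_({eq_quot coset_equiv}) (g * repr (c : {eq_quot coset_equiv})).

Lemma coset_act_pi g h :
  coset_act g (\pi_({eq_quot coset_equiv}) h) =
  \pi_({eq_quot coset_equiv}) (g * h).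
Proof.
have /eqmodP/asboolP rh := reprK (\pi_({eq_quot coset_equiv}) h).
by apply/eqmodP/asboolP; rewrite invgM -mulgA mulKg.
Qed.
End Cosets.

(* G/K x T for a space T with trivial action. *)
Section OrbitTimes.
Context (G : groupType) (K : subgroup G) (T : topologicalType).
Local Notation U := (discrete_topology (cosets K) * T)%type.

Definition orbit_act (g : G) (u : U) : U := (coset_act g u.1, u.2).

Lemma orbit_act1 u : orbit_act 1 u = u.
Proof.
case: u => c t; congr (_, _); rewrite /=.
by rewrite -[c in LHS]reprK coset_act_pi mul1g reprK.
Qed.

Lemma orbit_actM g h u : orbit_act (g * h) u = orbit_act g (orbit_act h u).
Proof.
case: u => c t; congr (_, _); rewrite /=.
rewrite -[c]reprK; set k := repr _.
by rewrite [coset_act h _]coset_act_pi !coset_act_pi mulgA.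
Qed.

Lemma orbit_act_continuous g : continuous (orbit_act g).
Proof.
exact: (@discrete_fst_continuous (cosets K) T (coset_act g)).
Qed.

Definition orbit_times : gspace G :=
  GSpace orbit_act1 orbit_actM orbit_act_continuous.
End OrbitTimes.

(* The induced G-space G x_N X of an N-space X: the quotient of G x X by
   (g n, x) ~ (g, n x). *)
Section Induction.
Context (G : groupType) (N : subgroup G) (X : gspace (subgroup_type N)).
Local Notation T := (discrete_topology G * X)%type.

Definition gind_eq : rel T := fun u v =>
  `[< exists n : subgroup_type N, u.1 = v.1 * sg_val n :> G /\ v.2 = gact n u.2 >].

Lemma gind_eq_refl : reflexive gind_eq.
Proof.
by move=> u; apply/asboolP; exists 1; rewrite sg_val1 mulg1 gact1.
Qed.

Lemma gind_eq_sym : symmetric gind_eq.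
Proof.
have S u v : gind_eq u v -> gind_eq v u.
  move=> /asboolP[n [E F]]; apply/asboolP; exists n^-1.
  by rewrite sg_valV E F mulgK -gactM mulVg gact1.
by move=> u v; apply/idP/idP; exact: S.
Qed.

Lemma gind_eq_trans : transitive gind_eq.
Proof.
move=> v u w /asboolP[n [E F]] /asboolP[m [E' F']]; apply/asboolP.
by exists (m * n); rewrite sg_valM mulgA -E' E F' F gactM.
Qed.

Definition gind_equiv := EquivRel gind_eq gind_eq_refl gind_eq_sym gind_eq_trans.

Definition gind_space : topologicalType :=
  quotient_topology {eq_quot gind_equiv}.

Definition gind_pi (g : G) (x : X) : gind_space :=
  \pi_({eq_quot gind_equiv}) ((g, x) : T).

Definition gind_repr (u : gind_space) : G * X :=
  repr (u : {eq_quot gind_equiv}).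

Lemma gind_piE g x h y : gind_pi g x = gind_pi h y <->
  exists n : subgroup_type N, g = h * sg_val n /\ y = gact n x.
Proof.
split=> [/eqmodP/asboolP//|E]; apply/eqmodP; exact/asboolP.
Qed.

Lemma gind_reprK u : gind_pi (gind_repr u).1 (gind_repr u).2 = u.
Proof. by rewrite /gind_pi -surjective_pairing; exact: reprK. Qed.

Definition gind_act (g : G) (u : gind_space) : gind_space :=
  gind_pi (g * (gind_repr u).1) (gind_repr u).2.

Lemma gind_act_pi g h x : gind_act g (gind_pi h x) = gind_pi (g * h) x.
Proof.
have /gind_piE[n [E F]] := gind_reprK (gind_pi h x).
by apply/gind_piE; exists n; rewrite E -mulgA.
Qed.

Lemma gind_act1 u : gind_act 1 u = u.
Proof. by rewrite -(gind_reprK u) gind_act_pi mul1g. Qed.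

Lemma gind_actM g h u : gind_act (g * h) u = gind_act g (gind_act h u).
Proof. by rewrite -(gind_reprK u) !gind_act_pi mulgA. Qed.

Lemma gind_act_continuous g : continuous (gind_act g).
Proof.
apply/quotient_continuous.
have -> : gind_act g \o \pi_(quotient_topology {eq_quot gind_equiv}) =
    (\pi_(quotient_topology {eq_quot gind_equiv}) : T -> _) \o
    (fun u : T => (g * (u.1 : G), u.2) : T).
  by apply/funext => -[h x]; exact: gind_act_pi.
move=> [h x].
apply: (@continuous_comp _ _ _ (fun u : T => (g * (u.1 : G), u.2) : T)
  (\pi_(quotient_topology {eq_quot gind_equiv}))); last exact: pi_continuous.
exact: (@discrete_fst_continuous G X (fun h => g * h)).
Qed.

Definition gind : gspace G := GSpace gind_act1 gind_actM gind_act_continuous.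
End Induction.

(* id_G x_N f, which sends (g, x) to (g, f x); this is well defined, i.e.
   independent of the representatives chosen by repr, when f is an N-map. *)
Definition gind_map (G : groupType) (N : subgroup G)
  (X Y : gspace (subgroup_type N)) (f : X -> Y) (u : gind X) : gind Y :=
  gind_pi (gind_repr u).1 (f (gind_repr u).2).

Lemma gind_map_pi (G : groupType) (N : subgroup G)
    (X Y : gspace (subgroup_type N)) (f : X -> Y) g x :
  gmap f -> gind_map f (gind_pi g x) = gind_pi g (f x).
Proof.
move=> [_ fE]; have /gind_piE[n [E F]] := gind_reprK (gind_pi g x).
by apply/gind_piE; exists n; split=> //; rewrite {1}F fE.
Qed.

(* A G-space with an increasing sequence of invariant subspaces (skeleta). *)
Record filtered_gspace (G : groupType) := FilteredGSpace {
  fg_space :> gspace G;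
  skel : nat -> set fg_space;
  skel_inv : forall n, ginvariant (skel n);
  skelS : forall n, skel n `<=` skel n.+1
}.

Arguments skel {G} X n : rename.

(* The (n-1)-skeleton; the (-1)-skeleton is empty. *)
Definition skel_pred (G : groupType) (X : filtered_gspace G) (n : nat) : set X :=
  if n is m.+1 then skel X m else set0.
Arguments skel_pred {G} X n.

Lemma skel_pred_inv (G : groupType) (X : filtered_gspace G) n :
  ginvariant (skel_pred X n).
Proof. by case: n => [|n] //=; exact: skel_inv. Qed.

Lemma skel_pred_sub (G : groupType) (X : filtered_gspace G) n :
  skel_pred X n `<=` skel X n.
Proof. by case: n => [|n] //=; exact: skelS. Qed.

Definition skeleton (G : groupType) (X : filtered_gspace G) n : gspace G :=
  gsub (@skel_inv G X n).
Definition skeleton_pred (G : groupType) (X : filtered_gspace G) n : gspace G :=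
  gsub (@skel_pred_inv G X n).
Definition skeleton_incl (G : groupType) (X : filtered_gspace G) n :
  skeleton_pred X n -> skeleton X n := set_type_incl (@skel_pred_sub G X n).
Arguments skeleton_incl {G} X n _.

Section GCW.
Context (R : realType).
Local Open Scope ring_scope.

(* 'rV_n carries the product topology; the Euclidean norm is spelled out because
   the norm of 'rV_n is the sup norm.  The set sphere n is S^(n-1), which is
   empty for n = 0. *)
Definition disk n : set 'rV[R]_n :=
  [set x | \sum_(j < n) x ord0 j ^+ 2 <= 1].
Definition open_disk n : set 'rV[R]_n :=
  [set x | \sum_(j < n) x ord0 j ^+ 2 < 1].
Definition sphere n : set 'rV[R]_n :=
  [set x | \sum_(j < n) x ord0 j ^+ 2 = 1].
Arguments disk n : clear implicits.
Arguments open_disk n : clear implicits.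
Arguments sphere n : clear implicits.

Lemma sphere_disk n : sphere n `<=` disk n.
Proof. by move=> x; rewrite /sphere /disk /mkset => ->. Qed.

Local Open Scope group_scope.

Section Cells.
Context (G : groupType) (X : filtered_gspace G) (n : nat).
Context (I : choiceType) (K : I -> subgroup G).

Definition disk_cells : gspace G := gcoprod (fun i => orbit_times (K i) (disk n)).
Definition sphere_cells : gspace G :=
  gcoprod (fun i => orbit_times (K i) (sphere n)).

Definition sphere_cells_incl : sphere_cells -> disk_cells :=
  @gcoprod_map G I (fun i => orbit_times (K i) (sphere n))
    (fun i => orbit_times (K i) (disk n))
    (fun i u => (u.1, set_type_incl (@sphere_disk n) u.2)).

(* The n-skeleton is obtained from the (n-1)-skeleton by attaching the
   equivariant n-cells G/K i x D^n, with attaching map q and characteristic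
   map Q. *)
Definition cell_attachment (q : sphere_cells -> skeleton_pred X n)
    (Q : disk_cells -> skeleton X n) : Prop :=
  gpushout q sphere_cells_incl (skeleton_incl X n) Q.

Definition open_cell_of (Q : disk_cells -> skeleton X n) (i : I) :
  set X :=
  [set y | exists u : disk_cells,
    [/\ projT1 u = i, open_disk n (\val (projT2 u).2) & \val (Q u) = y]].
End Cells.

(* The second clause is the colimit topology with respect to the skeleta. *)
Definition gcw (G : groupType) (X : filtered_gspace G) : Prop :=
  [/\ forall x : X, exists n, skel X n x,
      forall A : set X,
        (forall n, closed ((fun x : skel X n => \val x) @^-1` A)) -> closed A &
      forall n, exists (I : choiceType) (K : I -> subgroup G) q Q,
        @cell_attachment G X n I K q Q].

(* A whole equivariant open cell, i.e. the image of G/K x int(D^n). *)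
Definition open_cell (G : groupType) (X : filtered_gspace G) (C : set X) : Prop :=
  exists n (I : choiceType) (K : I -> subgroup G) q Q,
    @cell_attachment G X n I K q Q /\ exists i, C = open_cell_of Q i.

Definition gsubcomplex (G : groupType) (X : filtered_gspace G) (A : set X) :=
  closed A /\ forall x, A x -> exists C, [/\ open_cell C, C x & C `<=` A].

Definition cellular_gmap (G : groupType) (X Y : filtered_gspace G) (f : X -> Y) :
  Prop := gmap f /\ forall n, skel X n `<=` f @^-1` skel Y n.

(* f is an isomorphism of X onto a subcomplex of Y with the subspace topology
   and the induced skeleta. *)
Definition gcw_inclusion (G : groupType) (X Y : filtered_gspace G) (f : X -> Y) :
  Prop :=
  [/\ gmap f, injective f, forall A, closed A -> closed (f @` A),
      forall n, f @^-1` skel Y n = skel X n & gsubcomplex (range f)].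

Local Open Scope ring_scope.

Definition contractible (T : topologicalType) : Prop :=
  exists (x0 : T) (h : T * R -> T),
    [/\ {within [set: T] `*` `[0, 1]%classic, continuous h},
        forall x, h (x, 0) = x & forall x, h (x, 1) = x0].

Definition classifying_model (G : groupType) (F : subgroup_family G)
    (X : filtered_gspace G) : Prop :=
  gcw X /\ forall H : subgroup G,
    (fam_set F H -> contractible (set_type (fixed_points X H))) /\
    (~ fam_set F H -> fixed_points X H = set0).
End GCW.

Section FilteredInduction.
Context (G : groupType) (N : subgroup G).
Context (X : filtered_gspace (subgroup_type N)).

Definition gind_skel n : set (gind X) :=
  [set u | exists g x, skel X n x /\ u = gind_pi g x].

Lemma gind_skel_inv n : ginvariant (gind_skel n).
Proof.
move=> g _ [h [x [Xx ->]]]; exists (g * h), x; split=> //.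
exact: gind_act_pi.
Qed.

Lemma gind_skelS n : gind_skel n `<=` gind_skel n.+1.
Proof. by move=> _ [h [x [Xx ->]]]; exists h, x; split=> //; exact: skelS. Qed.

Definition filtered_gind : filtered_gspace G :=
  FilteredGSpace gind_skel_inv gind_skelS.
End FilteredInduction.

Section FilteredCoproduct.
Context (G : groupType) (I : choiceType) (X : I -> filtered_gspace G).

Definition gcoprod_skel n : set (gcoprod X) :=
  [set u | skel (X (projT1 u)) n (projT2 u)].

Lemma gcoprod_skel_inv n : ginvariant (gcoprod_skel n).
Proof. by move=> g [i x] /=; exact: skel_inv. Qed.

Lemma gcoprod_skelS n : gcoprod_skel n `<=` gcoprod_skel n.+1.
Proof. by move=> [i x] /=; exact: skelS. Qed.

Definition filtered_gcoprod : filtered_gspace G :=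
  FilteredGSpace gcoprod_skel_inv gcoprod_skelS.
End FilteredCoproduct.

Section FilteredPushout.
Context (G : groupType) (A : gspace G) (B C : filtered_gspace G) (P : gspace G).
Context (a : A -> B) (b : A -> C) (c : B -> P) (d : C -> P).
Hypothesis po : gpushout a b c d.

Definition gpushout_skel n : set P := c @` skel B n `|` d @` skel C n.

Lemma gpushout_skel_inv n : ginvariant (gpushout_skel n).
Proof.
have [[_ _ [_ cE] [_ dE]] _ _] := po.
move=> g _ [[x Xx <-]|[x Xx <-]]; [left|right];
  by exists (gact g x); rewrite ?cE ?dE //; exact: skel_inv.
Qed.

Lemma gpushout_skelS n : gpushout_skel n `<=` gpushout_skel n.+1.
Proof. 
by move=> _ [[x Xx <-]|[x Xx <-]]; [left|right]; exists x => //; exact: skelS. Qed.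

(* The n-skeleton of a cellular pushout is the image of those of B and C. *)
Definition filtered_gpushout : filtered_gspace G :=
  FilteredGSpace gpushout_skel_inv gpushout_skelS.
End FilteredPushout.

Section CoproductOfInduced.
Context (G : groupType) (I : choiceType) (N : I -> subgroup G).

Definition filtered_gcoprod_ind
  (X : forall i, filtered_gspace (subgroup_type (N i))) : filtered_gspace G :=
  filtered_gcoprod (fun i => filtered_gind (X i)).

Definition gcoprod_ind_map
  (X Y : forall i, filtered_gspace (subgroup_type (N i)))
  (f : forall i, X i -> Y i) :
  filtered_gcoprod_ind X -> filtered_gcoprod_ind Y :=
  @gcoprod_map G I (fun i => gind (X i)) (fun i => gind (Y i))
    (fun i => gind_map (f i)).
End CoproductOfInduced.

(* Main.v *)
Require Import Defs.
From HB Require Import structures.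
From mathcomp Require Import all_boot all_order all_algebra.
From mathcomp Require Import all_classical all_reals.
From mathcomp Require Import topology normedtype realfun.
From mathcomp Require Import lra.
Import numFieldTopology.Exports numFieldNormedType.Exports.
Set Implicit Arguments.
Unset Strict Implicit.
Unset Printing Implicit Defensive.
Import Order.TTheory GRing.Theory Num.Theory.
Local Open Scope classical_set_scope.
Local Open Scope ring_scope.

(** Write C for the coproduct of the induced spaces [G x_N E_(G[H])(N)], A for
    the coproduct of the [G x_N E_F(N)] and P for the pushout of [C <- A -> EF].
    Two things have to be shown: P is a G-CW-complex, and its fixed point sets
    have the right homotopy types.

    Both rest on replacing universal properties by point-set descriptions. One
    of the legs of the pushout, A -> C or A -> EF, is a closed embedding, and
    testing the universal property on indiscrete spaces and on P with its final
    topology shows that P, as a set, is the target of the other leg together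
    with the complement of the embedded A, and that its topology is the final
    one ([gpushout_gluing]). Applied to
    cell attachments, this turns a G-CW-complex into a list of equivariant
    cells with explicit topological conditions ([gcells], [gcw_gcells],
    [gcells_gcw]). In this form the cells of P are those of the target of the other
    leg and those outside the embedded A ([gcells_gluing]); that a subcomplex contains
    each open cell of a given structure or misses it follows from the
    connectedness of open disks ([gsubcomplex_saturated]).

    Taking K-fixed points commutes with such gluings ([gluing_fixed]), and
    the fixed points of an induced space split into summands
    [g E^(N \cap g^-1 K g)] indexed by cosets ([fixed_ind_at]).
    - If K is not in the large family, both C^K and EF^K are empty.
    - If K is in the large family but not in F, then EF^K is empty and C^K has
      exactly one summand, since the class of K is conjugate to exactly one
      chosen [H], by an element that is unique modulo N_G[H]. The summand is
      contractible and equals P^K.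
    - If K is in F, then EF^K and all summands of A^K and C^K are contractible,
      and A^K -> C^K is a bijection on summands. So A^K -> C^K is a homotopy
      equivalence, and gluing along a cofibration shows that P^K is
      contractible ([glue_to_contractible], [glue_along_contractible]).

    The last step uses the homotopy extension property of the fixed points of
    a relative complex ([fixed_has_extension]). It is proved cell by cell with
    an explicit filling of the cylinder over a disk ([cylinder_fill]). Products
    of quotient spaces with the interval are avoided throughout: a homotopy is
    a map into a path space with the compact-open topology, and its continuity
    can be tested on cells. *)

(** * Homotopies *)

Definition insub_set (T : Type) (B : set T) (x : T) (Bx : B x) : set_type B :=
  exist (fun y => y \in B) x (mem_set Bx).

Section Continuity.

Lemma closed_cover2_continuous (T Z : topologicalType) (A B : set T)
    (f g h : T -> Z) :
  closed A -> closed B -> (forall x, A x \/ B x) ->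
  continuous f -> continuous g ->
  (forall x, A x -> h x = f x) -> (forall x, B x -> h x = g x) ->
  continuous h.
Proof.
move=> cA cB AB /continuous_closedP cf /continuous_closedP cg hf hg.
apply/continuous_closedP => S cS.
have -> : h @^-1` S = (A `&` f @^-1` S) `|` (B `&` g @^-1` S).
  apply/seteqP; split=> x /=.
    by move=> Sx; case: (AB x) => [Ax|Bx]; [left|right]; split=> //=;
      rewrite /preimage /= -?(hf _ Ax) -?(hg _ Bx).
  by move=> [[Ax]|[Bx]]; rewrite /preimage /= ?(hf _ Ax) ?(hg _ Bx).
by apply: closedU; apply: closedI => //; [exact: cf|exact: cg].
Qed.

Lemma continuous_closed (S T : topologicalType) (f : S -> T) (A : set T) :
  continuous f -> closed A -> closed (f @^-1` A).
Proof. by move=> /continuous_closedP cf /cf. Qed.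

Lemma comp_continuous (S T U : topologicalType) (f : S -> T) (g : T -> U) :
  continuous f -> continuous g -> continuous (g \o f).
Proof. by move=> cf cg x; apply: continuous_comp; [exact: cf|exact: cg]. Qed.

Lemma continuous_post (S T U : topologicalType) (g : T -> U) (f : S -> T) :
  continuous g -> continuous f -> continuous (fun x => g (f x)).
Proof. by move=> cg cf; exact: comp_continuous cf cg. Qed.

Lemma pair_continuous (S T U : topologicalType) (f : S -> T) (g : S -> U) :
  continuous f -> continuous g -> continuous (fun x => (f x, g x)).
Proof. by move=> cf cg x; apply: cvg_pair; [exact: cf|exact: cg]. Qed.

Lemma fst_continuous (S T : topologicalType) :
  continuous (fst : S * T -> S).
Proof. by move=> x; exact: cvg_fst. Qed.

Lemma snd_continuous (S T : topologicalType) :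
  continuous (snd : S * T -> T).
Proof. by move=> x; exact: cvg_snd. Qed.

Lemma id_continuous (T : topologicalType) : continuous (@id T).
Proof. by move=> x; exact: cvg_id. Qed.
End Continuity.
Arguments fst_continuous {S T}.
Arguments snd_continuous {S T}.
Arguments id_continuous {T}.

Section Homotopy.
Context {R : realType}.
Local Notation Rtop := (R : topologicalType).

Lemma continuous_add (T : topologicalType) (f g : T -> R) :
  continuous f -> continuous g -> continuous (fun x => f x + g x).
Proof. by move=> cf cg x; apply: cvgD; [exact: cf|exact: cg]. Qed.

Lemma continuous_mul (T : topologicalType) (f g : T -> R) :
  continuous f -> continuous g -> continuous (fun x => f x * g x).
Proof. by move=> cf cg x; apply: cvgM; [exact: cf|exact: cg]. Qed.

Lemma continuous_opp (T : topologicalType) (f : T -> R) :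
  continuous f -> continuous (fun x => - f x).
Proof. by move=> cf x; apply: cvgN; exact: cf. Qed.

Lemma continuous_cst (T U : topologicalType) (c : U) :
  continuous (fun _ : T => c).
Proof. by move=> x; exact: cvg_cst. Qed.

Lemma continuous_maxr (T : topologicalType) (f g : T -> R) :
  continuous f -> continuous g -> continuous (fun x => Num.max (f x) (g x)).
Proof. by move=> cf cg x; apply: continuous_max; [exact: cf|exact: cg]. Qed.

Lemma continuous_minr (T : topologicalType) (f g : T -> R) :
  continuous f -> continuous g -> continuous (fun x => Num.min (f x) (g x)).
Proof. by move=> cf cg x; apply: continuous_min; [exact: cf|exact: cg]. Qed.

Definition paths (Z : topologicalType) := {compact-open, Rtop -> Z}.

Lemma curry_paths (T Z : topologicalType) (h : T * R -> Z) :
  continuous h -> continuous ((fun x t => h (x, t)) : T -> paths Z).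
Proof. by move=> ch; exact: (continuous_curry_fun ch). Qed.

Lemma curry_path (T Z : topologicalType) (h : T * R -> Z) x :
  continuous h -> continuous (fun t => h (x, t)).
Proof. by move=> /continuous_curry[_]; exact. Qed.

Lemma uncurry_paths (T Z : topologicalType) (h : T -> paths Z) :
  continuous h -> (forall x, continuous (h x : R -> Z)) ->
  continuous (fun p : T * R => h p.1 p.2).
Proof.
move=> ch chx.
have := @continuous_uncurry T Rtop Z h (@locally_compactR R)
  (@norm_hausdorff _ _) ch chx.
by rewrite (_ : uncurry h = fun p => h p.1 p.2) //; apply/funext => -[].
Qed.

Definition clamp (t : R) : R := Num.max 0 (Num.min t 1).

Lemma clamp_itv t : 0 <= clamp t <= 1.
Proof. by rewrite /clamp le_max lexx /= ge_max ge_min lexx orbT ler01. Qed.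

Lemma clamp0 : clamp 0 = 0.
Proof. by rewrite /clamp min_l // maxxx. Qed.

Lemma clamp1 : clamp 1 = 1.
Proof. by rewrite /clamp minxx max_r. Qed.

Lemma clamp_continuous : continuous clamp.
Proof.
apply: continuous_maxr; first exact: continuous_cst.
by apply: continuous_minr; [exact: id_continuous|exact: continuous_cst].
Qed.

(** Homotopies are parametrized by the whole line; only the times 0 and 1 and
    the points of [A] are constrained. *)
Definition homotopic_rel (T Z : topologicalType) (A : set T) (f g : T -> Z) :=
  exists h : T * R -> Z, [/\ continuous h, forall x, h (x, 0) = f x,
    forall x, h (x, 1) = g x & forall x t, A x -> h (x, t) = f x].

Lemma homotopic_rel_sym (T Z : topologicalType) (A : set T) (f g : T -> Z) :
  homotopic_rel A f g -> homotopic_rel A g f.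
Proof.
move=> [h [ch h0 h1 hA]]; exists (fun p => h (p.1, 1 - p.2)); split => /=.
- apply: (@comp_continuous _ _ _ (fun p : T * R => (p.1, 1 - p.2))) ch.
  apply: pair_continuous; first exact: fst_continuous.
  apply: continuous_add; first exact: continuous_cst.
  by apply: continuous_opp; exact: snd_continuous.
- by move=> x; rewrite subr0.
- by move=> x; rewrite subrr.
- by move=> x t Ax; rewrite hA // -(h1 x) hA.
Qed.

Lemma concat_continuous (T Z : topologicalType) (h k : T * R -> Z) :
  continuous h -> continuous k -> (forall x, h (x, 1) = k (x, 0)) ->
  continuous (fun p : T * R => if p.2 <= 2^-1 then h (p.1, 2 * p.2)
                       else k (p.1, 2 * p.2 - 1)).
Proof.
move=> ch ck hk.
pose dbl c := fun p : T * R => (p.1, 2 * p.2 + c).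
have cdbl c : continuous (dbl c).
  apply: pair_continuous; first exact: fst_continuous.
  apply: continuous_add; last exact: continuous_cst.
  apply: continuous_mul; first exact: continuous_cst.
  exact: snd_continuous.
apply: (@closed_cover2_continuous _ _ [set p : T * R | (p.2 : R) <= 2^-1]
  [set p : T * R | (p.2 : R) >= 2^-1] (h \o dbl 0) (k \o dbl (-1))).
- exact: (continuous_closed (@snd_continuous T Rtop) (@closed_le R _)).
- exact: (continuous_closed (@snd_continuous T Rtop) (@closed_ge R _)).
- by move=> p; have [/ltW|] := ltP 2^-1 p.2; [right|left].
- exact: comp_continuous.
- exact: comp_continuous.
- by move=> p /= ->; rewrite /dbl addr0.
- move=> [x t] /= t2; case: ifP => // t2'.
  have -> : t = 2^-1 by apply/eqP; rewrite eq_le t2'.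
  by rewrite /dbl /= mulfV ?pnatr_eq0 // subrr hk.
Qed.

Lemma homotopic_rel_trans (T Z : topologicalType) (A : set T) (f g k : T -> Z) :
  homotopic_rel A f g -> homotopic_rel A g k -> homotopic_rel A f k.
Proof.
move=> [h [ch h0 h1 hA]] [l [cl l0 l1 lA]].
exists (fun p : T * R => if p.2 <= 2^-1 then h (p.1, 2 * p.2)
                 else l (p.1, 2 * p.2 - 1)); split => /=.
- by apply: concat_continuous => // x; rewrite h1 l0.
- by move=> x; rewrite invr_ge0 ler0n mulr0.
- move=> x; rewrite ifF; last by apply/negP; rewrite -subr_le0; lra.
  by rewrite mulr1 (_ : 2 - 1 = 1 :> R) //; lra.
- move=> x t Ax; case: ifP => _; first exact: hA.
  by rewrite lA // -h1 hA.
Qed.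

Lemma homotopic_rel_eq (T Z : topologicalType) (A : set T) (f f' g g' : T -> Z) :
  homotopic_rel A f g -> f =1 f' -> g =1 g' -> homotopic_rel A f' g'.
Proof. by move=> fg /funext <- /funext <-. Qed.

(** In [contractible] only times in [0, 1] matter; clamping the time yields a
    homotopy that is continuous everywhere. *)
Lemma contractibleP (T : topologicalType) :
  contractible R T <-> exists x0 : T, homotopic_rel set0 id (fun=> x0).
Proof.
split=> [[x0 [h [ch h0 h1]]]|[x0 [h [ch h0 h1 _]]]]; exists x0.
  exists (fun p => h (p.1, clamp p.2)); split => //=.
  - pose c := fun p : T * R => (p.1, clamp p.2).
    have cc : continuous c.
      apply: pair_continuous; first exact: fst_continuous.
      by apply: comp_continuous; [exact: snd_continuous|exact: clamp_continuous].
    have Ac q : ([set: T] `*` `[0, 1]) (c q).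
      by split=> //=; rewrite in_itv /=; exact: (clamp_itv q.2).
    move=> p B nB.
    have /subspace_continuousP/(_ (c p) (Ac p) B nB) := ch.
    move=> /(cc p) H; apply: (@filterS _ (nbhs p) _ _ _ _ H) => q /= Bq.
    exact: (Bq (Ac q)).
  - by move=> x; rewrite clamp0 h0.
  - by move=> x; rewrite clamp1 h1.
exists h; split=> //; exact: continuous_subspaceT.
Qed.
End Homotopy.
Arguments homotopic_rel R {T Z} A f g.
Arguments paths R Z : clear implicits.

(** * Gluing contractible spaces *)

Section Gluing.
Context {R : realType}.

(** Joint surjectivity of [c] and [d] gives the uniqueness half of the
    universal property. *)
Record pushout (A B C P : topologicalType)
    (a : A -> B) (b : A -> C) (c : B -> P) (d : C -> P) : Prop := Pushout {
  po_contl : continuous c;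
  po_contr : continuous d;
  po_comm : forall x, c (a x) = d (b x);
  po_surj : forall p, (exists y, c y = p) \/ (exists z, d z = p);
  po_univ : forall (Z : topologicalType) (u : B -> Z) (v : C -> Z),
    continuous u -> continuous v -> (forall x, u (a x) = v (b x)) ->
    exists w : P -> Z,
      [/\ continuous w, forall y, w (c y) = u y & forall z, w (d z) = v z]
}.

(** A homotopy is a map into the path space, so the universal property applies to
    it directly. *)
Lemma pushout_homotopy (A B C P Z : topologicalType)
    (a : A -> B) (b : A -> C) (c : B -> P) (d : C -> P)
    (u : B * R -> Z) (v : C * R -> Z) :
  pushout a b c d -> continuous u -> continuous v ->
  (forall x t, u (a x, t) = v (b x, t)) ->
  exists h : P * R -> Z, [/\ continuous h,
    forall y t, h (c y, t) = u (y, t) & forall z t, h (d z, t) = v (z, t)].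
Proof.
move=> po cu cv uv.
have [||//|w [cw wc wd]] := po_univ po (Z := paths R Z)
    (u := fun y t => u (y, t)) (v := fun z t => v (z, t)).
- exact: curry_paths.
- exact: curry_paths.
- by move=> x; apply/funext => t; exact: uv.
exists (fun p => w p.1 p.2); split=> /= [|y t|z t]; rewrite ?wc ?wd //.
apply: uncurry_paths => // p.
by have [[y <-]|[z <-]] := po_surj po p; rewrite ?wc ?wd; exact: curry_path.
Qed.

(** The homotopy extension property. The given homotopy is only followed
    during the unit interval of time, hence the clamping. *)
Definition has_extension (A C : topologicalType) (b : A -> C) :=
  forall (Z : topologicalType) (f : C -> Z) (h : A * R -> Z),
    continuous f -> continuous h -> (forall x, h (x, 0) = f (b x)) ->
    exists H : C * R -> Z, [/\ continuous H, forall z, H (z, 0) = f z &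
      forall x t, H (b x, t) = h (x, clamp t)].

(** Each fibre of [p] is contracted inside itself; naming no end points allows
    empty fibres and an empty [T]. *)
Definition fibrewise_contractible (T : topologicalType) (S : Type) (p : T -> S) :=
  exists h : T * R -> T, [/\ continuous h, forall x, h (x, 0) = x,
    forall x y, p x = p y -> h (x, 1) = h (y, 1) &
    forall x t, p (h (x, t)) = p x].

(** Preimages of complements being closed as well, all preimages are open. *)
Definition locally_constant (T : topologicalType) (S : Type) (p : T -> S) :=
  forall U : set S, closed (p @^-1` U).

Lemma factor_continuous (T Z : topologicalType) (S : Type) (p : T -> S)
    (f : T -> Z) :
  locally_constant p -> (forall x y, p x = p y -> f x = f y) -> continuous f.
Proof.
move=> lp fp; apply/continuous_closedP => U _.
suff -> : f @^-1` U = p @^-1` (p @` (f @^-1` U)) by exact: lp.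
apply/seteqP; split=> x /= => [Ux|[y Uy yx]]; first by exists x.
by rewrite /preimage /= -(fp _ _ yx).
Qed.

Lemma clamp_time_continuous (T Z : topologicalType) (h : T * R -> Z) :
  continuous h -> continuous (fun p : T * R => h (p.1, clamp p.2)).
Proof.
move=> ch; apply: (@comp_continuous _ _ _ (fun p : T * R => (p.1, clamp p.2))) ch.
apply: pair_continuous; first exact: fst_continuous.
apply: comp_continuous; [exact: snd_continuous|exact: clamp_continuous].
Qed.

Lemma at_time_continuous (T Z : topologicalType) (h : T * R -> Z) (t : R) :
  continuous h -> continuous (fun x : T => h (x, t)).
Proof.
move=> ch; apply: (@comp_continuous _ _ _ (fun x : T => (x, t))) ch.
by apply: pair_continuous; [exact: id_continuous|exact: continuous_cst].
Qed.

Lemma fst_comp_continuous (T Z : topologicalType) (f : T -> Z) :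
  continuous f -> continuous (fun p : T * R => f p.1).
Proof. by move=> cf; apply: comp_continuous cf; exact: fst_continuous. Qed.

Lemma first_comp_continuous (T U Z : topologicalType) (f : T -> U)
    (h : U * R -> Z) :
  continuous f -> continuous h -> continuous (fun p : T * R => h (f p.1, p.2)).
Proof.
move=> cf ch; apply: (@comp_continuous _ _ _ (fun p : T * R => (f p.1, p.2))) ch.
by apply: pair_continuous; [exact: fst_comp_continuous|exact: snd_continuous].
Qed.

Section Glue.
Context (A B C P : topologicalType).
Context (a : A -> B) (b : A -> C) (c : B -> P) (d : C -> P).
Hypothesis po : pushout a b c d.
Hypothesis ext : has_extension b.

(** A deformation of [B] is carried along on the part of [P] that comes from
    [C] by extending it from [A]. *)
Lemma pushout_spread (beta : B * R -> B) :
  continuous a -> continuous beta -> (forall y, beta (y, 0) = y) ->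
  exists (E : C -> P) (e : P -> P), [/\ continuous E, homotopic_rel R set0 id e,
    forall y, e (c y) = c (beta (y, 1)), forall z, e (d z) = E z &
    forall x, E (b x) = c (beta (a x, 1))].
Proof.
move=> ca cb b0; have cc := po_contl po; have cd := po_contr po.
have [|x|E [cE E0 Eb]] := ext (h := fun p => c (beta (a p.1, p.2))) cd.
- exact: (continuous_post cc (first_comp_continuous ca cb)).
- by rewrite b0 (po_comm po).
have [|||h [ch hc hd]] := pushout_homotopy
    (u := fun p => c (beta (p.1, clamp p.2))) (v := E) po.
- exact: (continuous_post cc (clamp_time_continuous cb)).
- exact: cE.
- by move=> x t; rewrite Eb.
exists (fun z => E (z, 1)), (fun p => h (p, 1)); split.
- exact: (@at_time_continuous _ _ _ _ cE).
- exists h; split=> // p.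
  by have [[y <-]|[z <-]] := po_surj po p; rewrite ?hc ?hd ?E0 // clamp0 b0.
- by move=> y; rewrite hc clamp1.
- by move=> z; rewrite hd.
- by move=> x; rewrite Eb clamp1.
Qed.

Context (S : Type) (pA : A -> S).

(** Case of a contractible [C]: after spreading the contraction of the fibres
    of [B] over [P] and pushing [C] along the contraction of the fibres of [A],
    the identity of [P] becomes a map that factors through [C]. *)
Lemma glue_to_contractible (pB : B -> S) c0 :
  continuous a -> continuous b -> homotopic_rel R set0 (@id C) (fun=> c0) ->
  fibrewise_contractible pA -> fibrewise_contractible pB ->
  locally_constant pB -> (forall x, pB (a x) = pA x) ->
  (forall y, exists x, pA x = pB y) ->
  exists p0, homotopic_rel R set0 (@id P) (fun=> p0).
Proof.
move=> ca cb [gam [cg g0 g1 _]] [al [cal al0 al1 pal]] [be [cbe be0 be1 pbe]].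
move=> lB paB /choice[g pg].
have [E [e [cE he ec ed Eb]]] := pushout_spread ca cbe be0.
have [||x|H [cH H0 Hb]] := ext (f := id) (h := fun p => b (al p)).
- exact: id_continuous.
- exact: (@comp_continuous _ _ _ al b).
- by rewrite al0.
have [|||h [ch hc hd]] := pushout_homotopy
    (u := fun p => c (be (p.1, 1))) (v := fun p => E (H p)) po.
- apply: (@fst_comp_continuous _ _ (fun y => c (be (y, 1)))).
  apply: (continuous_post (po_contl po)).
  exact: (@at_time_continuous _ _ _ _ cbe).
- exact: (@comp_continuous _ _ _ H E).
- move=> x t; rewrite Hb Eb; congr c; apply: be1.
  by rewrite !paB pal.
have [|||th [cth thc thd]] := po_univ po
    (u := fun y => b (al (g y, 1))) (v := fun z => H (z, 1)).
- apply: (factor_continuous lB) => y y' yy'; congr b; apply: al1.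
  by rewrite !pg.
- exact: (@at_time_continuous _ _ _ _ cH).
- by move=> x; rewrite Hb clamp1; congr b; apply: al1; rewrite pg paB.
exists (E c0); apply: homotopic_rel_trans he _.
apply: (@homotopic_rel_trans _ _ _ _ _ (fun p => h (p, 1))).
  exists h; split=> // p.
  by have [[y <-]|[z <-]] := po_surj po p; rewrite ?hc ?hd ?ec ?ed ?H0.
exists (fun q => E (gam (th q.1, q.2))); split=> //= [|p|p].
- exact: (continuous_post cE (first_comp_continuous cth cg)).
- rewrite g0; have [[y <-]|[z <-]] := po_surj po p; rewrite ?thc ?thd ?hc ?hd //.
  by rewrite Eb; congr c; apply: be1; rewrite paB pal pg.
- by rewrite g1.
Qed.

(** The fibres of [C] contract, but the points of [range b] move along the way.
    Running the contraction forwards and then the path of the base point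
    backwards moves each point of [range b] along a loop of the form w followed
    by its reverse. Shrinking w to a point contracts these loops; extending this
    homotopy of loops over [C] and going round the other three sides of the
    square of parameters gives a homotopy that fixes [range b]. *)
Lemma relative_contraction (pC : C -> S) (al : A * R -> A) (u : C -> C)
    (g : C -> A) :
  continuous b -> continuous al -> continuous u ->
  fibrewise_contractible pC -> locally_constant pC ->
  (forall x, pC (b x) = pA x) ->
  (forall x y, pA x = pA y -> al (x, 1) = al (y, 1)) ->
  (forall x t, pA (al (x, t)) = pA x) ->
  (forall x, u (b x) = b (al (x, 1))) ->
  (forall z, pA (g z) = pC z) ->
  homotopic_rel R (range b) u (fun z => b (al (g (u z), 1))).
Proof.
move=> cb cal cu [gam [cg g0 g1 pg]] lC pbC al1 pal ub pgA.
pose q z := b (al (g z, 1)).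
have cq : continuous q.
  by apply: (factor_continuous lC) => z z' zz'; congr b; apply: al1; rewrite !pgA.
have qub x : q (u (b x)) = u (b x).
  by rewrite /q ub; congr b; apply: al1; rewrite pgA pbC pal.
pose rev := fun p : C * R => gam (q (u p.1), 1 - p.2).
pose fwd := fun p : C * R => gam (u p.1, p.2).
have cquu : continuous (fun z => q (u z)) by exact: (@comp_continuous _ _ _ u q).
have crev : continuous rev.
  apply: (@comp_continuous _ _ _ (fun p : C * R => (q (u p.1), 1 - p.2))) cg.
  apply: pair_continuous; first exact: (fst_comp_continuous cquu).
  apply: continuous_add; first exact: continuous_cst.
  by apply: continuous_opp; exact: snd_continuous.
have cfwd : continuous fwd by exact: (first_comp_continuous cu cg).
have fr z : fwd (z, 1) = rev (z, 0).
  by rewrite /fwd /rev /= subr0; apply: g1; rewrite /q pbC pal pgA.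
have ceta := concat_continuous cfwd crev fr.
set eta := fun p : C * R => if _ then _ else _ in ceta.
(* The loop visits the path w at the times [tau t]. *)
pose tau (t : R) := Num.min (2 * t) (2 - 2 * t).
have etab x t : eta (b x, t) = gam (u (b x), tau t).
  rewrite /eta /fwd /rev /tau /= qub.
  case: (leP t) => t2.
    by rewrite min_l //; lra.
  by rewrite min_r; [congr (gam (_, _)); lra|lra].
have ctau : continuous tau.
  have c2 : continuous (fun t : R => 2 * t).
    by apply: continuous_mul; [exact: continuous_cst|exact: id_continuous].
  apply: continuous_minr => //; apply: continuous_add; first exact: continuous_cst.
  exact: continuous_opp.
pose n := fun p : (A * R) * R => gam (u (b p.1.1), (1 - p.1.2) * tau p.2).
have cn : continuous n.
  apply: (@comp_continuous _ _ _
    (fun p : (A * R) * R => (u (b p.1.1), (1 - p.1.2) * tau p.2))) cg.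
  apply: pair_continuous.
    apply: (@fst_comp_continuous _ _ (fun p : A * R => u (b p.1))).
    apply: (@fst_comp_continuous _ _ (fun x => u (b x))).
    exact: (@comp_continuous _ _ _ b u).
  apply: continuous_mul.
    apply: (@fst_comp_continuous _ _ (fun p : A * R => 1 - p.2)).
    apply: continuous_add; first exact: continuous_cst.
    by apply: continuous_opp; exact: snd_continuous.
  by apply: (@comp_continuous _ _ _ snd tau) => //; exact: snd_continuous.
(* The target is the space of continuous paths, so that the extension is a
   continuous two-parameter family. *)
pose cpaths := [set f : paths R C | continuous (f : R -> C)].
pose Z := set_type cpaths.
pose etaZ (z : C) : Z :=
  @insub_set _ cpaths _ (@curry_path R _ _ eta z ceta).
pose nZ (x : A * R) : Z :=
  @insub_set _ cpaths _ (@curry_path R _ _ n x cn).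
have [|||K [cK K0 Kb]] := ext (Z := Z) (f := etaZ) (h := nZ).
- by apply: set_type_continuous; exact: curry_paths.
- by apply: set_type_continuous; exact: curry_paths.
- move=> x; apply: val_inj => /=; apply/funext => t.
  by rewrite /n /= subr0 mul1r etab.
pose L := fun p : (C * R) * R => (\val (K p.1) : R -> C) p.2.
have cL : continuous L.
  apply: (@uncurry_paths R _ _ (fun p : C * R => \val (K p) : paths R C)).
    apply: comp_continuous cK _; exact: set_val_continuous.
  by move=> p; exact: (set_mem (valP (K p))).
have Lb x s t : L (b x, s, t) = gam (u (b x), (1 - clamp s) * tau t).
  by rewrite /L /= Kb.
have L0 z t : L (z, 0, t) = eta (z, t) by rewrite /L /= K0.
have cs t : continuous (fun p : C * R => L (p, t)) by exact: (@at_time_continuous _ _ _ _ cL).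
have tau0 : tau 0 = 0 by rewrite /tau mulr0 subr0 min_l //; lra.
have tau1 : tau 1 = 0 by rewrite /tau mulr1 subrr min_r //; lra.
have side t : tau t = 0 ->
    homotopic_rel R (range b) (fun z => eta (z, t)) (fun z => L (z, 1, t)).
  move=> taut; exists (fun p => L (p, t)); split=> //=.
  move=> _ s [x _ <-]; rewrite Lb taut mulr0.
  by rewrite etab taut.
have top : homotopic_rel R (range b) (fun z => L (z, 1, 0)) (fun z => L (z, 1, 1)).
  exists (fun p => L (p.1, 1, p.2)); split=> //=.
    have c1 : continuous (fun p : C * R => ((p.1, 1), p.2) : (C * R) * R).
      apply: pair_continuous; last exact: snd_continuous.
      by apply: pair_continuous; [exact: fst_continuous|exact: continuous_cst].
    exact: (continuous_post cL c1).
  by move=> _ t [x _ <-]; rewrite !Lb clamp1 subrr !mul0r.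
have H := homotopic_rel_trans (homotopic_rel_trans (side 0 tau0) top)
  (homotopic_rel_sym (side 1 tau1)).
apply: homotopic_rel_eq H _ _ => z; rewrite /eta /=.
  by rewrite ifT ?invr_ge0 ?ler0n // /fwd /= mulr0 g0.
rewrite ifF; last by apply/negP; lra.
by rewrite /rev /= (_ : 1 - (2 * 1 - 1) = 0 :> R) ?g0 //; lra.
Qed.

(** Case of a contractible [B]: once [B] is collapsed to a point, each fibre of
    [C] contracts relative to the image of [A]. *)
Lemma glue_along_contractible (pC : C -> S) b0 :
  continuous a -> continuous b -> homotopic_rel R set0 (@id B) (fun=> b0) ->
  fibrewise_contractible pA -> fibrewise_contractible pC ->
  locally_constant pC -> (forall x, pC (b x) = pA x) ->
  (forall z, exists x, pA x = pC z) ->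
  exists p0, homotopic_rel R set0 (@id P) (fun=> p0).
Proof.
move=> ca cb [be [cbe be0 be1 _]] [al [cal al0 al1 pal]] fC.
move=> lC pbC /choice[g pg].
have [E [e [cE he ec ed Eb]]] := pushout_spread ca cbe be0.
have [||x|H [cH H0 Hb]] := ext (f := id) (h := fun p => b (al p)).
- exact: id_continuous.
- exact: (@comp_continuous _ _ _ al b).
- by rewrite al0.
have cu : continuous (fun z => H (z, 1)) by exact: (@at_time_continuous _ _ _ _ cH).
have ub x : H (b x, 1) = b (al (x, 1)) by rewrite Hb clamp1.
have [L [cL L0 L1 Lb]] := relative_contraction cb cal cu fC lC pbC al1 pal ub pg.
pose p0 := c b0.
have EbE x : E (b x) = p0 by rewrite Eb be1.
have [|||h [ch hc hd]] := pushout_homotopy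
    (u := fun=> p0) (v := fun p : C * R => E (H p)) po.
- exact: continuous_cst.
- exact: (@comp_continuous _ _ _ H E).
- by move=> x t; rewrite Hb EbE.
have [|||k [ck kc kd]] := pushout_homotopy
    (u := fun=> p0) (v := fun p : C * R => E (L p)) po.
- exact: continuous_cst.
- exact: (@comp_continuous _ _ _ L E).
- by move=> x t; rewrite Lb ?ub ?EbE //; exists x.
exists p0; apply: homotopic_rel_trans he _.
apply: (@homotopic_rel_trans _ _ _ _ _ (fun p => h (p, 1))).
  exists h; split=> // p.
  by have [[y <-]|[z <-]] := po_surj po p; rewrite ?hc ?hd ?ec ?ed ?H0 ?be1.
exists k; split=> // p;
  have [[y <-]|[z <-]] := po_surj po p; rewrite ?kc ?kd ?hc ?hd ?L0 ?L1 //.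
Qed.
End Glue.
End Gluing.

(** * Homotopy extension along cells *)

Section Subtype.
Context (T : topologicalType) (B : set T).

Lemma closed_val_image (S : set (set_type B)) :
  closed B -> closed S -> closed ((fun x : set_type B => \val x : T) @` S).
Proof.
move=> cB cS.
have [U oU US] : open (~` S) by exact: closed_openC.
suff -> : (fun x : set_type B => \val x : T) @` S = B `&` ~` U.
  by apply: closedI => //; exact: open_closedC.
apply/seteqP; split=> [_ [x Sx <-]|x [Bx Ux]] /=.
  split; first exact: (set_mem (valP x)).
  by move=> Ux; have : (~` S) x by rewrite -US.
exists (insub_set Bx) => //; apply: contrapT => nS.
have : (~` S) (insub_set Bx) by [].
by rewrite -US.
Qed.

Lemma closed_val_preimage (S : set T) :
  closed S -> closed ((fun x : set_type B => \val x : T) @^-1` S).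
Proof. by apply: continuous_closed; exact: set_val_continuous. Qed.

Lemma closed_set_typeP (S : set (set_type B)) : closed B ->
  closed S <-> closed ((fun x : set_type B => \val x : T) @` S).
Proof.
move=> cB; split=> [|cS]; first exact: closed_val_image.
suff -> : S = (fun x : set_type B => \val x : T) @^-1`
  ((fun x : set_type B => \val x : T) @` S) by exact: closed_val_preimage.
by apply/seteqP; split=> [x Sx|x [y Sy /val_inj <-]] //; exists x.
Qed.

Lemma closed_cover_sub_continuous (Z : topologicalType) (A : set T)
    (f : T -> Z) (g : set_type B -> Z) (h : T -> Z) :
  closed A -> closed B -> (forall x, A x \/ B x) ->
  continuous f -> continuous g ->
  (forall x, A x -> h x = f x) -> (forall x : set_type B, h (\val x) = g x) ->
  continuous h.
Proof.
move=> cA cB AB /continuous_closedP cf /continuous_closedP cg hf hg.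
apply/continuous_closedP => S cS.
have -> : h @^-1` S = (A `&` f @^-1` S)
    `|` ((fun x : set_type B => \val x : T) @` (g @^-1` S)).
  apply/seteqP; split=> x /=.
    move=> Sx; case: (AB x) => [Ax|Bx]; [left|right].
      by split=> //=; rewrite /preimage /= -(hf _ Ax).
    by exists (insub_set Bx) => //; rewrite /preimage /= -hg.
  move=> [[Ax]|[y + <-]]; rewrite /preimage /= ?(hf _ Ax) //.
  by rewrite -hg.
apply: closedU; first by apply: closedI => //; exact: cf.
by apply: closed_val_image => //; exact: cg.
Qed.
End Subtype.

Section Disk.
Context {R : realType}.

Section Norm.
Context {n : nat}.
Local Notation D := (set_type (@disk R n)).
Implicit Types v : 'rV[R]_n.

Definition enorm v : R := Num.sqrt (\sum_(j < n) v ord0 j ^+ 2).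

Lemma sumsq_ge0 v : 0 <= \sum_(j < n) v ord0 j ^+ 2.
Proof. by apply: sumr_ge0 => j _; exact: sqr_ge0. Qed.

Lemma enorm_ge0 v : 0 <= enorm v.
Proof. exact: sqrtr_ge0. Qed.

Lemma sqr_enorm v : enorm v ^+ 2 = \sum_(j < n) v ord0 j ^+ 2.
Proof. by rewrite sqr_sqrtr // sumsq_ge0. Qed.

Lemma enormZ a v : 0 <= a -> enorm (a *: v) = a * enorm v.
Proof.
move=> a0; rewrite /enorm; under eq_bigr do rewrite mxE exprMn.
by rewrite -mulr_sumr sqrtrM ?sqr_ge0 // sqrtr_sqr ger0_norm.
Qed.

Lemma enorm_continuous : continuous enorm.
Proof.
apply: (@comp_continuous _ _ _ (fun v => \sum_(j < n) v ord0 j ^+ 2) (@Num.sqrt R)).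
  apply: (@continuous_big R _ +%R 0 xpredT) => [|j _]; last first.
    have cj : continuous (fun v : 'rV[R]_n => v ord0 j) by exact: coord_continuous.
    exact: (continuous_mul cj cj).
  by apply: continuous_add; [exact: fst_continuous|exact: snd_continuous].
exact: sqrt_continuous.
Qed.

Lemma diskE v : disk v <-> enorm v <= 1.
Proof. by rewrite /disk /= -sqr_enorm expr_le1 // enorm_ge0. Qed.

Lemma open_diskE v : open_disk v <-> enorm v < 1.
Proof. by rewrite /open_disk /= -sqr_enorm expr_lt1 // enorm_ge0. Qed.

Lemma sphereE v : sphere v <-> enorm v = 1.
Proof.
rewrite /sphere /= -sqr_enorm; split=> [/eqP|->]; last by rewrite expr1n.
by rewrite sqrp_eq1 ?enorm_ge0 // => /eqP.
Qed.

Lemma disk_cases (y : D) : open_disk (\val y) \/ sphere (\val y).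
Proof.
have /diskE := set_mem (valP y).
rewrite le_eqVlt => /orP[/eqP/sphereE|/open_diskE]; by [right|left].
Qed.

Lemma open_disk_sphere v : open_disk v -> ~ sphere v.
Proof. by move=> /open_diskE v1 /sphereE e; rewrite e ltxx in v1. Qed.

Lemma to_disk_subproof v : disk ((Num.max 1 (enorm v))^-1 *: v).
Proof.
have m0 : 0 < Num.max 1 (enorm v) by rewrite lt_max ltr01.
apply/diskE; rewrite enormZ ?invr_ge0; last exact: ltW.
rewrite ler_pdivrMl // mulr1.
by rewrite le_max lexx orbT.
Qed.

(** The radial retraction, which makes maps on the disk total. *)
Definition to_disk v : D := insub_set (to_disk_subproof v).

Lemma to_diskE v : disk v -> \val (to_disk v) = v.
Proof. by move=> /diskE v1; rewrite /= max_l // invr1 scale1r. Qed.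

Lemma to_diskK (y : D) : to_disk (\val y) = y.
Proof. by apply: val_inj; rewrite to_diskE //; exact: (set_mem (valP y)). Qed.

Lemma continuous_scale (T : topologicalType) (f : T -> R) (g : T -> 'rV[R]_n) :
  continuous f -> continuous g -> continuous (fun x => f x *: g x).
Proof. by move=> cf cg x; apply: cvgZ; [exact: cf|exact: cg]. Qed.

Lemma continuous_inv (T : topologicalType) (f : T -> R) :
  continuous f -> (forall x, f x != 0) -> continuous (fun x => (f x)^-1).
Proof. by move=> cf f0 x; apply: cvgV => //; exact: cf. Qed.

Lemma to_disk_continuous : continuous to_disk.
Proof.
apply: set_type_continuous => /=; apply: continuous_scale; last exact: id_continuous.
apply: continuous_inv => [|v]; last by rewrite gt_eqF // lt_max ltr01.
by apply: continuous_maxr; [exact: continuous_cst|exact: enorm_continuous].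
Qed.
End Norm.

Section Cylinder.
Context {n : nat} (Z : topologicalType).
Local Notation D := (set_type (@disk R n)).
Local Notation S := (set_type (@sphere R n)).
Local Notation incl := (set_type_incl (@sphere_disk R n) : S -> D).
Context (p : D -> Z) (q : D -> paths R Z).

Definition later (t : R) : R := 1 + Num.max t 0.

Lemma later_continuous : continuous later.
Proof.
apply: continuous_add; first exact: continuous_cst.
by apply: continuous_maxr; [exact: id_continuous|exact: continuous_cst].
Qed.

(** Extension of a map [p] on the bottom of the cylinder and a homotopy [q] on
    its side: at time [t] the point [y] is pushed outwards by the factor
    [1 + t], and what leaves the disk continues upwards along the side. *)
Definition cylinder_fill (y : D) (t : R) : Z :=
  if later t * enorm (\val y) <= 1 then p (to_disk (later t *: \val y))
  else q (to_disk ((enorm (\val y))^-1 *: \val y)) (later t * enorm (\val y) - 1).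

Hypothesis cp : continuous p.
Hypothesis cq : continuous (fun s : S => q (incl s)).
Hypothesis cqs : forall s : S, continuous (q (incl s) : R -> Z).
Hypothesis q0 : forall s : S, q (incl s) 0 = p (incl s).

Lemma cylinder_fill_continuous :
  continuous (fun z : D * R => cylinder_fill z.1 z.2).
Proof.
pose r (z : D * R) : R := later z.2 * enorm (\val z.1).
have cval : continuous (fun z : D * R => \val z.1 : 'rV[R]_n).
  exact: (fst_comp_continuous (@set_val_continuous _ (@disk R n))).
have cl : continuous (fun z : D * R => later z.2).
  exact: (continuous_post later_continuous snd_continuous).
have ce : continuous (fun z : D * R => enorm (\val z.1)).
  exact: (continuous_post enorm_continuous cval).
have cr : continuous r by exact: continuous_mul.
pose B : set (D * R) := r @^-1` [set x | 1 <= x].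
have eB (z : set_type B) : 0 < enorm (\val (\val z).1).
  have : 1 <= r (\val z) by exact: (set_mem (valP z)).
  rewrite lt_neqAle enorm_ge0 andbT /r => r1; apply/eqP => e0.
  by rewrite -e0 mulr0 ler10 in r1.
have nuP (z : set_type B) :
    sphere ((enorm (\val (\val z).1))^-1 *: \val (\val z).1).
  by apply/sphereE; rewrite enormZ ?invr_ge0 ?enorm_ge0 // mulVf // gt_eqF.
pose nu (z : set_type B) : S := insub_set (nuP z).
have cB (U : topologicalType) (f : D * R -> U) :
    continuous f -> continuous (fun z : set_type B => f (\val z)).
  by move=> cf; exact: (continuous_post cf (@set_val_continuous _ B)).
have cnu : continuous nu.
  apply: set_type_continuous => /=; apply: continuous_scale; last exact: (cB _ _ cval).
  apply: continuous_inv => [|z]; first exact: (cB _ _ ce).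
  by rewrite gt_eqF //; exact: eB.
have cQ := uncurry_paths cq cqs.
apply: (@closed_cover_sub_continuous _ B _ (r @^-1` [set x | x <= 1])
  (fun z => p (to_disk (later z.2 *: \val z.1)))
  (fun z => q (incl (nu z)) (r (\val z) - 1))).
- exact: (continuous_closed cr (@closed_le R 1)).
- exact: (continuous_closed cr (@closed_ge R 1)).
- by move=> z; have [/ltW|] := ltP 1 (r z); [right|left].
- apply: (continuous_post cp); apply: (continuous_post to_disk_continuous).
  exact: (continuous_scale cl cval).
- have cpair : continuous (fun z : set_type B => (nu z, r (\val z) - 1) : S * R).
    apply: pair_continuous => //; apply: continuous_add; first exact: (cB _ _ cr).
    exact: continuous_cst.
  exact: (continuous_post cQ cpair).
- by move=> z /= r1; rewrite /cylinder_fill ifT.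
- move=> z; rewrite /cylinder_fill.
  have inu : to_disk ((enorm (\val (\val z).1))^-1 *: \val (\val z).1) = incl (nu z).
    by rewrite -[RHS]to_diskK.
  case: ifP => [r1|_]; last by rewrite inu.
  have r1' : r (\val z) = 1.
    by apply/eqP; rewrite eq_le r1; exact: (set_mem (valP z)).
  rewrite r1' subrr q0 -inu; congr (p (to_disk (_ *: _))).
  by rewrite -[RHS]mul1r -r1' /r mulfK // gt_eqF.
Qed.

Lemma cylinder_fill0 y : cylinder_fill y 0 = p y.
Proof.
rewrite /cylinder_fill /later maxxx addr0 mul1r scale1r to_diskK ifT //.
by apply/diskE; exact: (set_mem (valP y)).
Qed.

Lemma cylinder_fill_sphere y t :
  sphere (\val y) -> cylinder_fill y t = q y (Num.max t 0).
Proof.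
move=> ys; have y1 : enorm (\val y) = 1 by apply/sphereE.
have -> : y = incl (insub_set ys) by apply: val_inj.
set s : S := insub_set ys.
have s1 : enorm (\val (incl s)) = 1 by [].
rewrite /cylinder_fill s1 mulr1 invr1 scale1r to_diskK.
rewrite /later [1 + _]addrC addrK; case: ifP => //.
rewrite -lerBrDr subrr => t0.
have -> : Num.max t 0 = 0 by apply/eqP; rewrite eq_le t0 le_max lexx orbT.
by rewrite add0r scale1r to_diskK q0.
Qed.
End Cylinder.
End Disk.

(** * Homotopy extension for relative cell complexes *)

Section CellComplex.
Context {R : realType}.
Local Notation D n := (set_type (@disk R n)).

(** A cell complex relative to [Y 0]: [Y n.+1] arises from [Y n] by attaching
    n-cells. The cells are given as a set of characteristic maps, so that a cell
    of a fixed point set that is reached through several group elements counts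
    once. *)
Record cell_complex (T : topologicalType) (Y : nat -> set T)
    (Psi : forall n, set (D n -> T)) : Prop := CellComplex {
  cc_continuous : forall n psi, Psi n psi -> continuous psi;
  cc_sphere : forall n psi y, Psi n psi -> sphere (\val y) -> Y n (psi y);
  cc_open : forall n psi y, Psi n psi -> open_disk (\val y) -> ~ Y n (psi y);
  cc_inj : forall n psi psi' y y', Psi n psi -> Psi n psi' ->
    open_disk (\val y) -> open_disk (\val y') -> psi y = psi' y' ->
    psi = psi' /\ y = y';
  cc_step : forall n x, Y n.+1 x <-> Y n x \/
    exists psi y, [/\ Psi n psi, open_disk (\val y) & psi y = x];
  cc_closed : forall n, closed (Y n);
  cc_weak : forall n (S : set T), S `<=` Y n.+1 -> closed (S `&` Y n) ->
    (forall psi, Psi n psi -> closed (psi @^-1` S)) -> closed S;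
  cc_exhaust : forall x, exists n, Y n x;
  cc_colimit : forall S : set T, (forall n, closed (S `&` Y n)) -> closed S
}.

Section Extension.
Context (T Z : topologicalType) (Y : nat -> set T).
Context (Psi : forall n, set (D n -> T)).
Arguments Psi n _ : clear implicits.
Hypothesis cc : cell_complex Y Psi.
Context (f : T -> Z).
Hypothesis cf : continuous f.

Lemma cell_complex_mono m n x : (m <= n)%N -> Y m x -> Y n x.
Proof.
move=> /subnK <-; elim: (n - m)%N => // k IH Ymx.
by rewrite addSn; apply/(cc_step cc); left; exact: IH.
Qed.

(** Continuity on [Y n] is phrased with closed sets so that homotopies can be
    total functions on [T]. *)
Definition partial_homotopy n (H : T -> paths R Z) :=
  (forall S, closed S -> closed (Y n `&` H @^-1` S)) /\
  (forall x, Y n x -> [/\ continuous (H x : R -> Z), H x 0 = f x &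
    forall t, H x t = H x (Num.max t 0)]).

Definition cell_point n (x : T) :=
  exists p : (D n -> T) * D n,
    [/\ Psi n p.1, open_disk (\val p.2) & p.1 p.2 = x].

Definition extend_step n (H : T -> paths R Z) (x : T) : paths R Z :=
  if pselect (Y n x) is left _ then H x
  else if pselect (cell_point n x) is left e then
    let p := projT1 (cid e) in
    cylinder_fill (f \o p.1) (H \o p.1) p.2
  else H x.

Lemma extend_step_old n H x : Y n x -> extend_step n H x = H x.
Proof. by rewrite /extend_step; case: pselect. Qed.

Lemma extend_step_cell n H psi y : Psi n psi -> open_disk (\val y) ->
  extend_step n H (psi y) = cylinder_fill (f \o psi) (H \o psi) y.
Proof.
move=> Ppsi oy; rewrite /extend_step.
case: pselect => [/(cc_open cc Ppsi oy)//|_]; case: pselect => [e|]; last first.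
  by case; exists (psi, y).
case: (cid e) => -[psi' y'] /= [Ppsi' oy' E].
by have [-> ->] := cc_inj cc Ppsi' Ppsi oy' oy E.
Qed.

Section Step.
Context (n : nat) (H : T -> paths R Z).
Hypothesis partH : partial_homotopy n H.

Lemma cell_fill_continuous psi : Psi n psi ->
  continuous (fun z : D n * R => cylinder_fill (f \o psi) (H \o psi) z.1 z.2).
Proof.
move=> Ppsi; have cpsi := cc_continuous cc Ppsi.
have Ys (s : set_type (@sphere R n)) : Y n (psi (set_type_incl (@sphere_disk R n) s)).
  by apply: (cc_sphere cc Ppsi); exact: (set_mem (valP s)).
apply: cylinder_fill_continuous.
- exact: (continuous_post cf cpsi).
- apply/continuous_closedP => S cS.
  have := continuous_closed cpsi (partH.1 _ cS).
  have cincl : continuous (set_type_incl (@sphere_disk R n)).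
    by apply: set_type_continuous; exact: set_val_continuous.
  move=> /(continuous_closed cincl).
  congr closed; apply/seteqP; split=> s /=; first by case.
  by split=> //; exact: Ys.
- by move=> s; have [] := partH.2 _ (Ys s).
- by move=> s; have [] := partH.2 _ (Ys s).
Qed.

(** On the boundary of the cell the filling restricts to the old homotopy, so
    the formula holds on the closed cell. *)
Lemma extend_step_psi psi y : Psi n psi ->
  extend_step n H (psi y) = cylinder_fill (f \o psi) (H \o psi) y.
Proof.
move=> Ppsi; have [oy|sy] := disk_cases y; first exact: extend_step_cell.
have Yy := cc_sphere cc Ppsi sy.
rewrite extend_step_old //; apply/funext => t.
rewrite cylinder_fill_sphere //=; last first.
  move=> s /=; have [] // := partH.2 (psi (set_type_incl (@sphere_disk R n) s)).
  by apply: (cc_sphere cc Ppsi); exact: (set_mem (valP s)).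
by have [_ _ ->] := partH.2 _ Yy.
Qed.

Lemma extend_step_partial : partial_homotopy n.+1 (extend_step n H).
Proof.
split=> [S cS|x /(cc_step cc)[Yx|[psi [y [Ppsi oy <-]]]]].
- apply: (cc_weak cc (n := n)); first by move=> x [].
    have := partH.1 _ cS; congr closed; apply/seteqP; split=> x /=.
      move=> [Yx Hx]; split=> //; split; last by rewrite /preimage /= extend_step_old.
      by apply/(cc_step cc); left.
    by move=> [[_]] + Yx; rewrite /preimage /= extend_step_old.
  move=> psi Ppsi.
  have := continuous_closed (curry_paths (cell_fill_continuous Ppsi)) cS.
  congr closed; apply/seteqP; split=> y /=; rewrite /preimage /= extend_step_psi //.
    move=> Sy; split=> //; apply/(cc_step cc).
    have [oy|/(cc_sphere cc Ppsi)] := disk_cases y; last by left.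
    by right; exists psi, y.
  by case.
- by rewrite extend_step_old //; exact: partH.2.
- rewrite extend_step_psi //; split.
  + exact: (@curry_path R (D n) Z _ y (cell_fill_continuous Ppsi)).
  + by rewrite cylinder_fill0.
  + move=> t; rewrite /cylinder_fill /later.
    by rewrite [Num.max (Num.max t 0) 0]max_l // le_max lexx orbT.
Qed.
End Step.

(** The homotopies on the successive [Y n] agree where they overlap, so a point
    takes its value from any stage that contains it. *)
Lemma cell_complex_extension (h : T -> paths R Z) :
  partial_homotopy 0 h ->
  exists H : T -> paths R Z, [/\ continuous H,
    forall x, continuous (H x : R -> Z), forall x, H x 0 = f x &
    forall x, Y 0 x -> H x = h x].
Proof.
move=> h0.
pose Hs := fix Hs n := if n is m.+1 then extend_step m (Hs m) else h.
have part n : partial_homotopy n (Hs n).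
  by elim: n => //= n IH; exact: extend_step_partial.
have Hs_le m n x : (m <= n)%N -> Y m x -> Hs n x = Hs m x.
  move=> /subnK <-; elim: (n - m)%N => // k IH Ymx.
  rewrite addSn /= extend_step_old ?IH //.
  by apply: cell_complex_mono Ymx; exact: leq_addl.
have /choice[lev levP] := cc_exhaust cc.
pose H x := Hs (lev x) x.
have HE n x : Y n x -> H x = Hs n x.
  move=> Yx; rewrite /H; have [le|/ltnW le] := leqP (lev x) n.
    by rewrite (Hs_le _ _ _ le).
  by rewrite (Hs_le _ _ _ le).
exists H; split=> [|x|x|x Yx].
- apply/continuous_closedP => S cS; apply: (cc_colimit cc) => n.
  have := (part n).1 _ cS; congr closed; apply/seteqP; split=> x /=.
    by move=> [Yx]; rewrite /preimage /= -(HE n).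
  by move=> [+ Yx]; rewrite /preimage /= (HE n).
- by have [] := (part (lev x)).2 _ (levP x).
- by have [] := (part (lev x)).2 _ (levP x).
- by rewrite (HE 0%N).
Qed.
End Extension.

Lemma cell_complex_has_extension (A T : topologicalType) (b : A -> T)
    (Y : nat -> set T) (Psi : forall n, set (D n -> T)) :
  cell_complex Y Psi -> continuous b -> injective b ->
  (forall S, closed S -> closed (b @` S)) -> range b = Y 0%N ->
  has_extension (R := R) b.
Proof.
move=> cc cb injb clb rb Z f h cf ch h0.
have [a0|noA] := pselect (exists a : A, True); last first.
  exists (fun p => f p.1); split=> //; first exact: fst_comp_continuous.
  by move=> x; case: noA; exists x.
have [g gb] : exists g : T -> A, forall x, g (b x) = x.
  have [a _] := a0.
  exists (fun z => if pselect (exists x, b x = z) is left e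
                   then projT1 (cid e) else a) => x.
  case: pselect => [e|]; last by case; exists x.
  by case: (cid e) => y /= /injb.
pose h' : T * R -> Z := fun p => h (g p.1, Num.max p.2 0).
have ch' : continuous (fun p : A * R => h (p.1, Num.max p.2 0)).
  have c2 : continuous (fun p : A * R => (p.1, Num.max p.2 0) : A * R).
    apply: pair_continuous; first exact: fst_continuous.
    by apply: continuous_maxr; [exact: snd_continuous|exact: continuous_cst].
  exact: (continuous_post ch c2).
have [|H [cH cHx H0 Hb]] :=
    cell_complex_extension cc cf (h := fun z t => h' (z, t)).
  split=> [S cS|z].
    have := clb _ (continuous_closed (curry_paths ch') cS).
    congr closed; apply/seteqP; split=> z; rewrite -rb.
      by move=> [x Sx <-]; split; [exists x|rewrite /preimage /= /h' /= gb].
    move=> [[x _ <-]]; rewrite /preimage /= /h' /= gb => Sx.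
    by exists x.
  rewrite -rb => -[x _ <-]; split.
  - by rewrite /h' /= gb; exact: (curry_path (x := x) ch').
  - by rewrite /h' /= gb maxxx.
  - by move=> t; rewrite /h' /= [Num.max (Num.max t 0) 0]max_l // le_max lexx orbT.
exists (fun p => H p.1 (clamp p.2)); split=> [|z|x t].
- have := clamp_time_continuous (uncurry_paths cH cHx); exact.
- by rewrite clamp0.
- have Yx : Y 0%N (b x) by rewrite -rb; exists x.
  rewrite /= Hb // /h' /= gb max_l //.
  by have /andP[] := clamp_itv t.
Qed.
End CellComplex.

(** * Equivariant cell structures *)

Section DiskTopology.
Context {R : realType} {n : nat}.
Local Notation D := (set_type (@disk R n)).

Lemma ray_continuous (v : 'rV[R]_n) :
  continuous (fun t : R => to_disk (t *: v) : D).
Proof.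
apply: (continuous_post to_disk_continuous).
apply: continuous_scale; [exact: id_continuous|exact: continuous_cst].
Qed.

(** A boundary point is a limit of points on its ray. *)
Lemma open_disk_dense (U : set D) : closed U ->
  (forall y : D, open_disk (\val y) -> U y) -> forall y, U y.
Proof.
move=> cU oU y; have [/oU//|/sphereE y1] := disk_cases y.
pose V := (fun t : R => to_disk (Num.max 0 t *: \val y)) @^-1` U.
have cV : closed V.
  apply: continuous_closed cU.
  apply: (@continuous_post _ _ _ (fun t : R => to_disk (t *: \val y))).
    exact: ray_continuous.
  by apply: continuous_maxr; [exact: continuous_cst|exact: id_continuous].
suff : V 1 by rewrite /V /= /preimage /= max_r ?ler01 // scale1r to_diskK.
apply: cV; have : [set t : R | t <= 1] 1 by exact: lexx.
rewrite -closure_lt; apply: closure_subset => t /= t1.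
apply: oU; have n0 : 0 <= Num.max 0 t by rewrite le_max lexx.
have t1' : enorm (Num.max 0 t *: \val y) < 1.
  by rewrite enormZ // y1 mulr1 gt_max ltr01.
by rewrite to_diskE; [exact/open_diskE|apply/diskE; exact: ltW].
Qed.

(** The open disk is connected: it is a union of segments through the
    origin. *)
Lemma open_disk_clopen (U V : set D) : closed U -> closed V ->
  (forall y : D, open_disk (\val y) -> U y \/ V y) ->
  (forall y : D, open_disk (\val y) -> U y -> ~ V y) ->
  forall y y' : D, open_disk (\val y) -> open_disk (\val y') -> U y -> U y'.
Proof.
move=> cU cV UV nUV.
pose f (y : D) (t : R) : D := to_disk (clamp t *: \val y).
have cf y : continuous (f y).
  apply: (@continuous_post _ _ _ (fun t : R => to_disk (t *: \val y))).
    exact: ray_continuous.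
  exact: clamp_continuous.
have of_ y t : open_disk (\val y) -> open_disk (\val (f y t)).
  move=> /open_diskE y1; have /andP[t0 t1] := clamp_itv t.
  have fy1 : enorm (clamp t *: \val y) < 1.
    rewrite enormZ //; apply: le_lt_trans y1.
    by rewrite ler_piMl // enorm_ge0.
  by rewrite to_diskE; [exact/open_diskE|apply/diskE; exact: ltW].
have f0 y : f y 0 = to_disk 0 by rewrite /f clamp0 scale0r.
have f1 y : f y 1 = y by rewrite /f clamp1 scale1r to_diskK.
have cR : connected [set: R] by apply/connected_intervalP.
have const y s t : open_disk (\val y) -> U (f y s) -> U (f y t).
  move=> oy Us; suff : f y @^-1` U = [set: R].
    by move=> /seteqP[_ /(_ t I)].
  apply: cR; first by exists s.
    exists (~` (f y @^-1` V)).
      by apply: closed_openC; exact: (continuous_closed (cf y)).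
    rewrite setTI; apply/seteqP; split=> r /=; first exact/nUV/of_.
    by have [//|] := UV _ (of_ _ r oy).
  by exists (f y @^-1` U); rewrite ?setTI //; exact: (continuous_closed (cf y)).
move=> y y' oy oy' Uy; rewrite -(f1 y') ; apply: (const _ 0) => //.
by rewrite f0 -(f0 y); apply: (const _ 1) => //; rewrite f1.
Qed.
End DiskTopology.

Section GCells.
Context {R : realType} (G : groupType).
Local Notation D n := (set_type (@disk R n)).

(** A G-complex relative to [Y 0]: [Y n.+1] arises from [Y n] by attaching the
    cells G/K_j x D^n for j in [J n]. The characteristic map is given by its
    restriction [psi] to the coset of the unit, whose image is fixed by K_j. *)
Record gcells (X : gspace G) (Y : nat -> set X) (J : nat -> choiceType)
    (K : forall n, J n -> subgroup G) (psi : forall n, J n -> D n -> X) :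
    Prop := GCells {
  gc_continuous : forall n j, continuous (psi n j);
  gc_inv : forall n, ginvariant (Y n);
  gc_fix : forall n j g y, sg_set (K n j) g -> gact g (psi n j y) = psi n j y;
  gc_sphere : forall n j y, sphere (\val y) -> Y n (psi n j y);
  gc_open : forall n j y, open_disk (\val y) -> ~ Y n (psi n j y);
  gc_inj : forall n j j' g y y', open_disk (\val y) -> open_disk (\val y') ->
    gact g (psi n j y) = psi n j' y' -> [/\ j = j', sg_set (K n j) g & y = y'];
  gc_step : forall n x, Y n.+1 x <-> Y n x \/
    exists j g y, open_disk (\val y) /\ gact g (psi n j y) = x;
  gc_closed : forall n, closed (Y n);
  gc_weak : forall n (S : set X), S `<=` Y n.+1 -> closed (S `&` Y n) ->
    (forall j g, closed [set y | S (gact g (psi n j y))]) -> closed S;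
  gc_exhaust : forall x, exists n, Y n x;
  gc_colimit : forall S : set X, (forall n, closed (S `&` Y n)) -> closed S
}.

Lemma gactK (X : gspace G) (g : G) (x : X) : gact g^-1 (gact g x) = x.
Proof. by rewrite -gactM mulVg gact1. Qed.

Lemma ginvariantE (X : gspace G) (A : set X) g x :
  ginvariant A -> A (gact g x) <-> A x.
Proof. by move=> iA; split=> [/(iA g^-1%g)|/iA//]; rewrite gactK. Qed.

Section Theory.
Context (X : gspace G) (Y : nat -> set X) (J : nat -> choiceType).
Context (K : forall n, J n -> subgroup G) (psi : forall n, J n -> D n -> X).
Arguments K n _ : clear implicits.
Arguments psi n _ _ : clear implicits.
Hypothesis gc : gcells Y K psi.

Lemma gcells_image n j g y : Y n.+1 (gact g (psi n j y)).
Proof.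
apply/(gc_step gc); have [oy|sy] := disk_cases y; last first.
  by left; apply: (gc_inv gc); exact: (gc_sphere gc).
by right; exists j, g, y.
Qed.

Lemma gcell_continuous n j g : continuous (fun y => gact g (psi n j y)).
Proof.
apply: (@continuous_post _ _ _ (gact g) (psi n j)); first exact: gact_continuous.
exact: (gc_continuous gc).
Qed.

Section Fixed.
Context (H : subgroup G).
Local Notation W := (fixed_points X H).

Lemma fixed_gact g x :
  (forall h, sg_set H h -> gact (g^-1 * h * g)%g x = x) <-> W (gact g x).
Proof.
split=> [fx h Hh|fx h /fx]; last by rewrite !gactM => ->; rewrite gactK.
by rewrite -[in RHS](fx h Hh) -!gactM !mulgA mulgV mul1g.
Qed.

Lemma fixed_cell n j g y : open_disk (\val y) ->
  W (gact g (psi n j y)) <-> forall h, sg_set H h -> sg_set (K n j) (g^-1 * h * g)%g.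
Proof.
move=> oy; rewrite -fixed_gact; split=> fx h /fx => [/(gc_inj gc oy oy)[]//|].
exact: (gc_fix gc).
Qed.

(** The space is not known to be Hausdorff, so closedness is checked on cells:
    an open cell with one fixed point is fixed entirely. *)
Lemma closed_fixed_points : closed (W `&` Y 0%N) -> closed W.
Proof.
move=> cW; apply: (gc_colimit gc); elim=> // n IH.
apply: (gc_weak gc (n := n)); first by move=> x [].
  rewrite -setIA (_ : Y n.+1 `&` Y n = Y n) //.
  by apply: setIidr => x Yx; apply/(gc_step gc); left.
move=> j g.
have [fx|nfx] := pselect (forall h, sg_set H h -> sg_set (K n j) (g^-1 * h * g)%g).
  rewrite (_ : mkset _ = setT); first exact: closedT.
  apply/seteqP; split=> // y _; split; last exact: gcells_image.
  by apply/fixed_gact => h /fx; exact: (gc_fix gc).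
have := continuous_closed (@gcell_continuous n j g) IH; congr closed.
apply/seteqP; split=> y /= [Wy Yy]; split=> //.
  by apply/(gc_step gc); left.
have [oy|sy] := disk_cases y; first by case: nfx; exact/(fixed_cell _ _ oy).
by apply: (gc_inv gc); exact: (gc_sphere gc).
Qed.

(** The cells of the fixed point set are the translates g D^n of the cells with
    H contained in g K_j g^-1. *)
Definition fixed_cells n : set (D n -> set_type W) :=
  [set p | exists j g, (forall h, sg_set H h -> sg_set (K n j) (g^-1 * h * g)%g) /\
    forall y, \val (p y) = gact g (psi n j y)].

Lemma fixed_cell_complex : closed W ->
  cell_complex (fun n => (fun x : set_type W => \val x : X) @^-1` Y n)
    fixed_cells.
Proof.
move=> cW; have iY := gc_inv gc; split.
- move=> n p [j [g [_ pE]]]; apply: set_type_continuous.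
  by under eq_fun do rewrite pE; exact: gcell_continuous.
- move=> n p y [j [g [_ pE]]] sy; rewrite /preimage /= pE.
  by apply: iY; exact: (gc_sphere gc).
- move=> n p y [j [g [_ pE]]] oy; rewrite /preimage /= pE => /(ginvariantE _ _ (iY n)).
  exact: (gc_open gc).
- move=> n p p' y y' [j [g [_ pE]]] [j' [g' [_ pE']]] oy oy'.
  move=> /(congr1 (fun x => gact g'^-1%g (\val x))); rewrite pE pE' gactK -gactM.
  move=> /(gc_inj gc oy oy')[jj Kg ->]; split=> //; subst j'.
  apply/funext => z; apply: val_inj; rewrite pE pE'.
  by rewrite -[in RHS](gc_fix gc z Kg) -gactM mulgA mulgV mul1g.
- move=> n x; split=> [/(gc_step gc)[Yx|[j [g [y [oy E]]]]]|[Yx|]].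
  + by left.
  + right; have fx : forall h, sg_set H h -> sg_set (K n j) (g^-1 * h * g)%g.
      by apply/(fixed_cell _ _ oy); rewrite E; exact: (set_mem (valP x)).
    have Wp z : W (gact g (psi n j z)).
      by apply/fixed_gact => h /fx; exact: (gc_fix gc).
    exists (fun z => insub_set (Wp z)), y; split=> //; first by exists j, g.
    exact: val_inj.
  + by apply/(gc_step gc); left.
  + by move=> [p [y [[j [g [_ pE]]] oy <-]]]; rewrite /preimage /= pE;
      exact: gcells_image.
- by move=> n; apply: closed_val_preimage; exact: (gc_closed gc).
- move=> n S SY cS cp; apply/(closed_set_typeP _ cW).
  have cSY : closed ((fun x : set_type W => \val x : X) @` S `&` Y n).
    have := closed_val_image cW cS; congr closed; apply/seteqP; split=> x.
      by move=> [z [Sz Yz] <-]; split=> //; exists z.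
    by move=> [[z Sz <-] Yz]; exists z.
  apply: (gc_weak gc (n := n)) => //; first by move=> _ [x /SY Yx <-].
  move=> j g.
  have [fx|nfx] := pselect (forall h, sg_set H h -> sg_set (K n j) (g^-1 * h * g)%g).
    have Wp z : W (gact g (psi n j z)).
      by apply/fixed_gact => h /fx; exact: (gc_fix gc).
    have : fixed_cells (fun z => insub_set (Wp z)) by exists j, g.
    move=> /cp; congr closed; apply/seteqP; split=> y /=.
      by move=> Sy; exists (insub_set (Wp y)).
    move=> [z Sz zE]; rewrite /preimage /=.
    by rewrite (_ : insub_set _ = z) //; exact: val_inj.
  have := continuous_closed (@gcell_continuous n j g) cSY; congr closed.
  apply/seteqP; split=> y /=; first by case.
  move=> Sy; split=> //; have [oy|sy] := disk_cases y; last first.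
    by apply: iY; exact: (gc_sphere gc).
  case: nfx; apply/(fixed_cell _ _ oy); case: Sy => z _ <-.
  exact: (set_mem (valP z)).
- by move=> x; exact: (gc_exhaust gc (\val x)).
- move=> S cS; apply/(closed_set_typeP _ cW); apply: (gc_colimit gc) => n.
  have := closed_val_image cW (cS n); congr closed; apply/seteqP; split=> x.
    by move=> [z [Sz Yz] <-]; split=> //; exists z.
  by move=> [[z Sz <-] Yz]; exists z.
Qed.
End Fixed.

Section Relative.
Context (A : set X).
Hypotheses (cA : closed A) (iA : ginvariant A).
Hypothesis satA : forall n j,
  (forall y, open_disk (\val y) -> A (psi n j y)) \/
  (forall y, open_disk (\val y) -> ~ A (psi n j y)).

Definition outer_cells n : choiceType :=
  set_type [set j : J n | forall y, open_disk (\val y) -> ~ A (psi n j y)].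

(** A closed union of cells can be moved into the base: the closed set [A]
    contains the boundary of each open cell inside it, so only the remaining
    cells impose conditions. *)
Lemma gcells_relative :
  gcells (fun n => A `|` Y n) (fun n (j : outer_cells n) => K n (\val j))
    (fun n (j : outer_cells n) => psi n (\val j)).
Proof.
have inA n j g : ~ (forall y, open_disk (\val y) -> ~ A (psi n j y)) ->
    forall y, A (gact g (psi n j y)).
  move=> nj y; apply: iA; have [Aj|//] := satA j.
  have := open_disk_dense (continuous_closed (@gc_continuous _ _ _ _ _ gc n j) cA); exact.
split.
- by move=> n j; exact: (gc_continuous gc).
- by move=> n g x [Ax|Yx]; [left; exact: iA|right; exact: (gc_inv gc)].
- by move=> n j; exact: (gc_fix gc).
- by move=> n j y sy; right; exact: (gc_sphere gc).
- move=> n j y oy [|/(gc_open gc oy)//].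
  exact: (set_mem (valP j)).
- move=> n j j' g y y' oy oy' /(gc_inj gc oy oy')[jj Kg yy]; split=> //.
  exact: val_inj.
- move=> n x; split.
    move=> [Ax|/(gc_step gc)[Yx|[j [g [y [oy <-]]]]]]; [by left; left|by left; right|].
    have [oj|/inA Aj] := pselect (forall y, open_disk (\val y) -> ~ A (psi n j y)).
      by right; exists (insub_set (oj : mkset _ j)), g, y.
    by left; left.
  move=> [[Ax|Yx]|[j [g [y [oy <-]]]]]; [by left| |].
    by right; apply/(gc_step gc); left.
  by right; exact: gcells_image.
- by move=> n; apply: closedU => //; exact: (gc_closed gc).
- move=> n S SY cS cp.
  have cSA : closed (S `&` A).
    rewrite (_ : S `&` A = (S `&` (A `|` Y n)) `&` A); first exact: closedI.
    by apply/seteqP; split=> x /= [Sx Ax]; split=> //; [split=> //; left|case: Sx].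
  suff cSY : closed (S `&` Y n.+1).
    have := closedU cSA cSY; rewrite -setIUr; congr closed.
    exact: setIidl.
  apply: (gc_weak gc (n := n)); first by move=> x [].
    have := closedI cS (@gc_closed _ _ _ _ _ gc n); congr closed; apply/seteqP.
    split=> x /= [[Sx _] Yx]; do !split=> //; last by right.
    by apply/(gc_step gc); left.
  move=> j g.
  have [oj|/inA Aj] := pselect (forall y, open_disk (\val y) -> ~ A (psi n j y)).
    have := cp (insub_set (oj : mkset _ j)) g; congr closed.
    apply/seteqP; split=> y /=; last by case.
    by split=> //; exact: gcells_image.
  have := continuous_closed (@gcell_continuous n j g) cSA; congr closed.
  apply/seteqP; split=> y /= [Sy _]; split=> //.
  exact: gcells_image.
- by move=> x; have [n Yx] := gc_exhaust gc x; exists n; right.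
- move=> S cS; apply: (gc_colimit gc) => n.
  have := closedI (cS n) (@gc_closed _ _ _ _ _ gc n); congr closed; apply/seteqP.
  split=> x /=; first by case=> -[].
  by move=> [Sx Yx]; do !split=> //; right.
Qed.
End Relative.
End Theory.
End GCells.

(** * Gluing G-spaces along a closed embedding *)

Section Gluing.
Context {R : realType} (G : groupType).
Local Notation D n := (set_type (@disk R n)).

Definition closed_embedding (X Y : topologicalType) (b : X -> Y) : Prop :=
  [/\ continuous b, injective b & forall S, closed S -> closed (b @` S)].

(** What a pushout along a closed embedding [b] looks like: as a set it is [B]
    together with the complement of [range b] in [C]. *)
Record gluing (A B C P : topologicalType)
    (a : A -> B) (b : A -> C) (c : B -> P) (d : C -> P) : Prop := Gluing {
  gl_a : continuous a;
  gl_b : closed_embedding b;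
  gl_c : continuous c;
  gl_d : continuous d;
  gl_comm : forall x, c (a x) = d (b x);
  gl_surj : forall p, (exists y, c y = p) \/ (exists z, d z = p);
  gl_injl : injective c;
  gl_injr : forall z z', d z = d z' -> z = z' \/ range b z /\ range b z';
  gl_meet : forall y z, c y = d z -> range b z;
  gl_closed : forall S, closed (c @^-1` S) -> closed (d @^-1` S) -> closed S
}.

Lemma gluing_meet (A B C P : topologicalType)
    (a : A -> B) (b : A -> C) (c : B -> P) (d : C -> P) y z :
  gluing a b c d -> c y = d z -> exists2 x, a x = y & b x = z.
Proof.
move=> gl yz; have [x _ xz] := gl_meet gl yz; exists x => //.
by apply: (gl_injl gl); rewrite (gl_comm gl) xz.
Qed.

Lemma gluing_pushout (A B C P : topologicalType)
    (a : A -> B) (b : A -> C) (c : B -> P) (d : C -> P) :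
  gluing a b c d -> pushout a b c d.
Proof.
move=> gl; split;
  [exact: gl_c gl|exact: gl_d gl|exact: gl_comm gl|exact: gl_surj gl|].
move=> Z u v cu cv uv.
have uvE y z : c y = d z -> u y = v z.
  by move=> /(gluing_meet gl)[x <- <-].
have PE p : exists q : Z,
    (forall y, c y = p -> q = u y) /\ (forall z, d z = p -> q = v z).
  have [[y yp]|[z zp]] := gl_surj gl p.
    exists (u y); split=> [y' y'p|z zp]; last by apply: uvE; rewrite zp.
    by congr u; apply: (gl_injl gl); rewrite yp.
  exists (v z); split=> [y yp|z' z'p]; first by apply/esym/uvE; rewrite yp.
  have [->//|[[x _ xz] [x' _ xz']]] := gl_injr gl (etrans zp (esym z'p)).
  rewrite -xz -xz' -!uv; congr u; apply: (gl_injl gl).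
  by rewrite !(gl_comm gl) xz xz' zp.
have [w wP] := choice PE.
have wc y : w (c y) = u y by have [/(_ y)->] := wP (c y).
have wd z : w (d z) = v z by have [_ /(_ z)->] := wP (d z).
exists w; split=> //; apply/continuous_closedP => S cS.
apply: (gl_closed gl).
  have := continuous_closed cu cS; congr closed.
  by apply/seteqP; split=> y; rewrite /preimage /= wc.
have := continuous_closed cv cS; congr closed.
by apply/seteqP; split=> y; rewrite /preimage /= wd.
Qed.

Lemma gmap_fixed (X Y : gspace G) (f : X -> Y) (H : subgroup G) x :
  gmap f -> fixed_points X H x -> fixed_points Y H (f x).
Proof. by move=> [_ fE] fx h /fx {2}<-; rewrite fE. Qed.

Lemma gmap_inj_fixed (X Y : gspace G) (f : X -> Y) (H : subgroup G) x :
  gmap f -> injective f -> fixed_points Y H (f x) -> fixed_points X H x.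
Proof. by move=> [_ fE] injf fx h /fx; rewrite -fE => /injf. Qed.

Definition fixed_map (X Y : gspace G) (f : X -> Y) (gf : gmap f) (H : subgroup G)
    (x : set_type (fixed_points X H)) : set_type (fixed_points Y H) :=
  insub_set (gmap_fixed gf (set_mem (valP x))).

Lemma fixed_map_continuous (X Y : gspace G) (f : X -> Y) (gf : gmap f) H :
  continuous (fixed_map gf (H := H)).
Proof.
apply: set_type_continuous => /=.
exact: (continuous_post gf.1 (@set_val_continuous _ _)).
Qed.

Lemma fixed_closed_embedding (X Y : gspace G) (f : X -> Y) (gf : gmap f) H :
  closed_embedding f -> closed_embedding (fixed_map gf (H := H)).
Proof.
move=> [_ injf clf]; split; first exact: fixed_map_continuous.
  by move=> x x' /(congr1 \val) /= /injf xx; exact: val_inj.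
move=> S cS; have [U oU US] : open (~` S) by exact: closed_openC.
have := clf _ (open_closedC oU) => /(@closed_val_preimage _ (fixed_points Y H)).
congr closed; apply/seteqP; split=> z /=.
  move=> [x Ux xz].
  have fx : fixed_points X H x.
    by apply: (gmap_inj_fixed gf injf); rewrite xz; exact: (set_mem (valP z)).
  exists (insub_set fx); last exact: val_inj.
  apply: contrapT => nS; apply: Ux.
  by have : (~` S) (insub_set fx) by []; rewrite -US.
move=> [x Sx <-]; exists (\val x) => // Ux.
by have : (~` S) x by rewrite -US.
Qed.

Section Fixed.
Context (A B C P : gspace G) (a : A -> B) (b : A -> C) (c : B -> P) (d : C -> P).
Hypotheses (ga : gmap a) (gb : gmap b) (gc : gmap c) (gd : gmap d).
Hypothesis gl : gluing a b c d.
Context (H : subgroup G).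

Let injb : injective b. Proof. by case: (gl_b gl). Qed.
Let clb S : closed S -> closed (b @` S).
Proof. by case: (gl_b gl) => _ _; apply. Qed.

Lemma gluing_fixed_surj (p : P) : fixed_points P H p ->
  (exists2 y, fixed_points B H y & c y = p) \/
  (exists2 z, fixed_points C H z & d z = p).
Proof.
move=> fp; have fc := @gmap_inj_fixed _ _ c H _ gc (gl_injl gl).
have [[y yp]|[z zp]] := gl_surj gl p.
  by left; exists y => //; apply: fc; rewrite yp.
have [[x _ xz]|nz] := pselect (range b z).
  have xp : c (a x) = p by rewrite (gl_comm gl) xz.
  by left; exists (a x) => //; apply: fc; rewrite xp.
right; exists z => // h Hh; have := fp h Hh; rewrite -zp -gd.2.
by move=> /(gl_injr gl)[//|[_ /nz]].
Qed.

(** Gluing commutes with fixed points: a fixed point of [P] that does not come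
    from [B] has a unique, hence fixed, preimage in [C]. *)
Lemma gluing_fixed :
  closed (fixed_points B H) -> closed (fixed_points C H) ->
  gluing (fixed_map ga (H := H)) (fixed_map gb (H := H))
    (fixed_map gc (H := H)) (fixed_map gd (H := H)).
Proof.
move=> cB cC.
have fixA x z : fixed_points C H z -> b x = z -> fixed_points A H x.
  by move=> fz xz; apply: (gmap_inj_fixed gb injb); rewrite xz.
split; try exact: fixed_map_continuous.
- exact: fixed_closed_embedding (gl_b gl).
- by move=> x; apply: val_inj; exact: (gl_comm gl).
- move=> p; have [[y fy yp]|[z fz zp]] := gluing_fixed_surj (set_mem (valP p)).
    by left; exists (insub_set fy); exact: val_inj.
  by right; exists (insub_set fz); exact: val_inj.
- by move=> y y' /(congr1 \val) /= /(gl_injl gl) yy; exact: val_inj.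
- move=> z z' /(congr1 \val) /= /(gl_injr gl)[zz|[[x _ xz] [x' _ xz']]].
    by left; exact: val_inj.
  right; split.
    by exists (insub_set (fixA _ _ (set_mem (valP z)) xz)) => //; exact: val_inj.
  by exists (insub_set (fixA _ _ (set_mem (valP z')) xz')) => //; exact: val_inj.
- move=> y z /(congr1 \val) /= /(gl_meet gl)[x _ xz].
  by exists (insub_set (fixA _ _ (set_mem (valP z)) xz)) => //; exact: val_inj.
move=> S cSB cSC; pose T := (fun p : set_type (fixed_points P H) => \val p : P) @` S.
have -> : S = (fun p : set_type (fixed_points P H) => \val p : P) @^-1` T.
  by apply/seteqP; split=> [p Sp|p [q Sq /val_inj <-//]]; exists p.
apply: closed_val_preimage.
have cT : closed (c @^-1` T).
  have := closed_val_image cB cSB; congr closed; apply/seteqP; split=> y /=.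
    by move=> [y' Sy' <-]; exists (fixed_map gc y').
  move=> [p Sp /esym yp].
  have fy : fixed_points B H y.
    apply: (gmap_inj_fixed gc (gl_injl gl)); rewrite yp; exact: (set_mem (valP p)).
  exists (insub_set fy) => //; rewrite /preimage /=.
  by rewrite (_ : fixed_map _ _ = p) //; exact: val_inj.
apply: (gl_closed gl) => //.
have := closedU (closed_val_image cC cSC) (clb (continuous_closed ga.1 cT)).
congr closed; apply/seteqP; split=> z /=.
  move=> [[z' Sz' <-]|[x [p Sp xp] <-]]; first by exists (fixed_map gd z').
  by exists p => //; rewrite xp (gl_comm gl).
move=> [p Sp zp].
have [fz|nfz] := pselect (fixed_points C H z).
  left; exists (insub_set fz) => //; rewrite /preimage /=.
  by rewrite (_ : fixed_map _ _ = p) //; exact: val_inj.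
right; have [[y _ yp]|[z' fz' z'p]] := gluing_fixed_surj (set_mem (valP p)).
  have [x _ xz] := gl_meet gl (etrans yp zp).
  by exists x => //; exists p => //; rewrite (gl_comm gl) xz.
have [zz|[[x _ xz] _]] := gl_injr gl (etrans (esym zp) (esym z'p)).
  by case: nfz; rewrite zz.
by exists x => //; exists p => //; rewrite (gl_comm gl) xz.
Qed.
End Fixed.

(** The fixed points form a cell complex relative to those of [A]. *)
Lemma fixed_has_extension (A C : gspace G) (b : A -> C) (Y : nat -> set C)
    (J : nat -> choiceType) (K : forall n, J n -> subgroup G)
    (psi : forall n, J n -> D n -> C) (H : subgroup G) (gb : gmap b) :
  closed_embedding b -> gcells Y K psi -> Y 0%N = range b ->
  closed (fixed_points C H) ->
  has_extension (R := R) (fixed_map gb (H := H)).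
Proof.
move=> eb gc Y0 cW; have [cf injf clf] := fixed_closed_embedding gb H eb.
apply: (cell_complex_has_extension (fixed_cell_complex gc cW)) => //.
apply/seteqP; split=> z; rewrite /preimage /= Y0.
  by move=> [x _ <-]; exists (\val x).
move=> [x _ xz]; have fx : fixed_points A H x.
  have [_ injb _] := eb.
  by apply: (gmap_inj_fixed gb injb); rewrite xz; exact: (set_mem (valP z)).
by exists (insub_set fx) => //; exact: val_inj.
Qed.

Section Cells.
Context (A B C P : gspace G) (a : A -> B) (b : A -> C) (c : B -> P) (d : C -> P).
Hypotheses (gb : gmap b) (gmc : gmap c) (gmd : gmap d).
Hypothesis gl : gluing a b c d.
Context (YB : nat -> set B) (JB : nat -> choiceType).
Context (KB : forall n, JB n -> subgroup G) (psiB : forall n, JB n -> D n -> B).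
Context (YC : nat -> set C) (JC : nat -> choiceType).
Context (KC : forall n, JC n -> subgroup G) (psiC : forall n, JC n -> D n -> C).
Arguments KB n _ : clear implicits.
Arguments KC n _ : clear implicits.
Arguments psiB n _ _ : clear implicits.
Arguments psiC n _ _ : clear implicits.
Hypotheses (gB : gcells YB KB psiB) (gC : gcells YC KC psiC).
Hypothesis sat : forall n j,
  (forall y, open_disk (\val y) -> range b (psiC n j y)) \/
  (forall y, open_disk (\val y) -> ~ range b (psiC n j y)).
Hypothesis filt : forall n x, YC n (b x) -> YB n (a x).

Definition glued_cells n : choiceType :=
  (JB n + outer_cells psiC (range b) n)%type.

Definition glued_stabilizer n (j : glued_cells n) : subgroup G :=
  match j with inl j => KB n j | inr j => KC n (\val j) end.

Definition glued_char n (j : glued_cells n) : D n -> P :=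
  match j with inl j => c \o psiB n j | inr j => d \o psiC n (\val j) end.

Definition glued_filtration n : set P := c @` YB n `|` d @` YC n.

Let clb S : closed S -> closed (b @` S).
Proof. by case: (gl_b gl) => _ _; apply. Qed.

Lemma closed_range_gembedding : closed (range b).
Proof. by apply: clb; exact: closedT. Qed.

Lemma ginvariant_range : ginvariant (range b).
Proof. by move=> g _ [x _ <-]; exists (gact g x) => //; exact: gb.2. Qed.

Lemma glued_preimagel n y : glued_filtration n (c y) <-> YB n y.
Proof.
split=> [[[y' Yy' /(gl_injl gl) <-//]|[z Yz /esym zy]]|Yy]; last by left; exists y.
have [x _ xz] := gl_meet gl zy; move: zy Yz; rewrite -xz -(gl_comm gl).
by move=> /(gl_injl gl) ->; exact: filt.
Qed.

Lemma glued_preimager n z :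
  glued_filtration n (d z) <-> YC n z \/ exists2 x, YB n (a x) & b x = z.
Proof.
split=> [[[y Yy yz]|[z' Yz' zz]]|[Yz|[x Yx <-]]].
- have [x _ xz] := gl_meet gl yz; right; exists x => //.
  by move: yz; rewrite -xz -(gl_comm gl) => /(gl_injl gl) <-.
- have [<-|[[x' _ xz'] [x _ xz]]] := gl_injr gl zz; [by left|right; exists x => //].
  have := zz; rewrite -xz -xz' -!(gl_comm gl) => /(gl_injl gl) <-.
  by apply: filt; rewrite xz'.
- by right; exists z.
- by left; exists (a x) => //; exact: (gl_comm gl).
Qed.

Lemma closed_preimager S : closed (c @^-1` S) -> closed (b @` (a @^-1` (c @^-1` S))).
Proof. by move=> cS; apply: clb; exact: (continuous_closed (gl_a gl)). Qed.

(** The boundary of a cell of [C] outside [range b] may run into [range b]; there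
    [d] is given by [c] and [a], and [filt] keeps its image in the right stage of
    the filtration. *)
Lemma gcells_gluing : gcells glued_filtration glued_stabilizer glued_char.
Proof.
have gR := gcells_relative gC closed_range_gembedding ginvariant_range sat.
have iYB := gc_inv gB; have iYC := gc_inv gC.
have outer n (j : outer_cells psiC (range b) n) y :
  open_disk (\val y) -> ~ range b (psiC n (\val j) y).
  exact: (set_mem (valP j)).
have cE := gmc.2; have dE := gmd.2.
have gS : forall n x, YB n x -> YB n.+1 x by move=> n x Yx; apply/(gc_step gB); left.
have gSC : forall n x, YC n x -> YC n.+1 x by move=> n x Yx; apply/(gc_step gC); left.
split.
- move=> n [j|j].
    exact: (comp_continuous (@gc_continuous _ _ _ _ _ _ _ gB n j) (gl_c gl)).
  exact: (comp_continuous (@gc_continuous _ _ _ _ _ _ _ gC n (\val j)) (gl_d gl)).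
- move=> n g _ [[y Yy <-]|[z Yz <-]]; [left|right].
    by exists (gact g y); [exact: iYB|exact: cE].
  by exists (gact g z); [exact: iYC|exact: dE].
- move=> n [j|j] g y /= Kg; rewrite -?cE -?dE.
    by rewrite (gc_fix gB).
  by rewrite (gc_fix gC).
- move=> n [j|j] y sy /=; [left|right].
    by exists (psiB n j y) => //; exact: (gc_sphere gB).
  by exists (psiC n (\val j) y) => //; exact: (gc_sphere gC).
- move=> n [j|j] y oy /=; first by move=> /glued_preimagel; exact: (gc_open gB).
  move=> /glued_preimager[|[x _ xE]]; first exact: (gc_open gC).
  by apply: (outer _ j y oy); exists x.
- move=> n [j|j] [j'|j'] g y y' oy oy' /=; rewrite -?cE -?dE.
  + by move=> /(gl_injl gl) /(gc_inj gB oy oy')[-> ? ->].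
  + by move=> /(gl_meet gl) /(outer _ _ _ oy').
  + by move=> /esym /(gl_meet gl) /(ginvariantE _ _ ginvariant_range) /(outer _ _ _ oy).
  + move=> /(gl_injr gl)[/(gc_inj gR oy oy')[-> ? ->]//|[_ /(outer _ _ _ oy')//]].
- move=> n p; split.
    move=> [[y /(gc_step gB)[Yy|[j [g [y' [oy <-]]]]] <-]|[z]].
    + by left; left; exists y.
    + by right; exists (inl j), g, y'; rewrite /= -cE.
    have [[x _ <-] /filt/(gc_step gB)[Yx|[j [g [y' [oy yx]]]]] <-|nz Yz <-] :=
      pselect (range b z); rewrite -?(gl_comm gl).
    + by left; left; exists (a x).
    + by right; exists (inl j), g, y'; rewrite /= -cE yx.
    have : (range b `|` YC n.+1) z by right.
    move=> /(gc_step gR)[[//|Yz']|[j [g [y' [oy <-]]]]].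
      by left; right; exists z.
    by right; exists (inr j), g, y'; rewrite /= -dE.
  move=> [[[y Yy <-]|[z Yz <-]]|[[j|j] [g [y [oy <-]]]]] /=; rewrite -?cE -?dE.
  + by left; exists y => //; exact: gS.
  + by right; exists z => //; exact: gSC.
  + by left; exists (gact g (psiB n j y)) => //; exact: (gcells_image gB).
  + by right; exists (gact g (psiC n (\val j) y)) => //; exact: (gcells_image gC).
- move=> n; apply: (gl_closed gl).
    rewrite (_ : _ @^-1` _ = YB n); first exact: (gc_closed gB).
    by apply/seteqP; split=> y /glued_preimagel.
  have := closedU (@gc_closed _ _ _ _ _ _ _ gC n)
    (clb (continuous_closed (gl_a gl) (@gc_closed _ _ _ _ _ _ _ gB n))).
  by congr closed; apply/seteqP; split=> z /glued_preimager.
- move=> n S SY cS cp.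
  have cl : closed (c @^-1` S).
    apply: (gc_weak gB (n := n)).
    + by move=> y /SY /glued_preimagel.
    + have := continuous_closed (gl_c gl) cS; congr closed.
      by apply/seteqP; split=> y /= [Sy /glued_preimagel].
    + by move=> j g; have := cp (inl j) g; congr closed;
        apply/seteqP; split=> y /=; rewrite /preimage /= cE.
  apply: (gl_closed gl) => //; apply: (gc_weak gR (n := n)).
  + move=> z /SY /glued_preimager[|[x _ <-]]; [by right|by left; exists x].
  + have := closedU (closed_preimager cl)
      (closedI (continuous_closed (gl_d gl) cS) (@gc_closed _ _ _ _ _ _ _ gC n)).
    congr closed; apply/seteqP; split=> z /=.
      move=> [[x Sx <-]|[[Sz _] Yz]]; split=> //; rewrite /preimage /=; last by right.
        by rewrite -(gl_comm gl).
      by left; exists x.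
    move=> [Sz [[x _ xz]|Yz]]; [left|right].
      by exists x => //; rewrite /preimage /= (gl_comm gl) xz.
    by do !split=> //; right; exists z.
  + by move=> j g; have := cp (inr j) g; congr closed;
      apply/seteqP; split=> y /=; rewrite /preimage /= dE.
- move=> p; have [[y <-]|[z <-]] := gl_surj gl p.
    by have [n Yy] := gc_exhaust gB y; exists n; left; exists y.
  by have [n Yz] := gc_exhaust gC z; exists n; right; exists z.
- move=> S cS.
  have cl : closed (c @^-1` S).
    apply: (gc_colimit gB) => n; have := continuous_closed (gl_c gl) (cS n).
    by congr closed; apply/seteqP; split=> y /= [Sy /glued_preimagel].
  apply: (gl_closed gl) => //; apply: (gc_colimit gC) => n.
  have := closedI (continuous_closed (gl_d gl) (cS n)) (@gc_closed _ _ _ _ _ _ _ gC n).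
  congr closed; apply/seteqP; split=> z /=; first by case=> -[].
  by move=> [Sz Yz]; do !split=> //; right; exists z.
Qed.
End Cells.
End Gluing.

(** * Pushouts of G-spaces *)

Section Indiscrete.
Context (G : groupType) (T : choiceType) (act : G -> T -> T).
Hypothesis act1 : forall x, act 1%g x = x.
Hypothesis actM : forall g h x, act (g * h)%g x = act g (act h x).

Definition indiscrete : topologicalType := initial_topology (fun _ : T => true).

Lemma to_indiscrete_continuous (S : topologicalType) (f : S -> indiscrete) :
  continuous f.
Proof.
apply/continuousP => _ [U oU <-].
have [Ut|Ut] := pselect (U true).
  rewrite (_ : _ @^-1` _ = setT); first exact: openT.
  by apply/seteqP; split.
rewrite (_ : _ @^-1` _ = set0); first exact: open0.
by apply/seteqP; split.
Qed.

Definition indiscrete_gspace : gspace G :=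
  @GSpace G indiscrete act act1 actM 
    (fun g => @to_indiscrete_continuous indiscrete (act g)).
End Indiscrete.

(** A copy of [P] that carries the final topology of [c] and [d]. *)
Definition final_topology (B C P : topologicalType) (c : B -> P) (d : C -> P) :
  Type := P.

Section Final.
Context (B C P : topologicalType) (c : B -> P) (d : C -> P).
Local Notation F := (final_topology c d).

Definition final_open : set (set F) :=
  [set U | open (c @^-1` U) /\ open (d @^-1` U)].

Let final_openT : final_open setT.
Proof. by split; exact: openT. Qed.

Let final_openI : setI_closed final_open.
Proof. by move=> U V [cU dU] [cV dV]; split; exact: openI. Qed.

Let final_open_bigU (I : Type) (f : I -> set F) :
  (forall i, final_open (f i)) -> final_open (\bigcup_i f i).
Proof.
move=> fo; rewrite /final_open /= !preimage_bigcup.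
by split; apply: bigcup_open => i _; have [] := fo i.
Qed.

HB.instance Definition _ := Choice.on F.
HB.instance Definition _ :=
  isOpenTopological.Build F final_openT final_openI final_open_bigU.

Lemma final_closed (S : set F) :
  closed (c @^-1` S) -> closed (d @^-1` S) -> closed S.
Proof.
move=> cS dS; rewrite -openC; split; rewrite preimage_setC; exact: closed_openC.
Qed.

Lemma final_continuous (Z : topologicalType) (f : F -> Z) :
  continuous (fun y => f (c y)) -> continuous (fun z => f (d z)) -> continuous f.
Proof.
move=> cf df; apply/continuous_closedP => S cS.
by apply: final_closed; [exact: (continuous_closed cf)|exact: (continuous_closed df)].
Qed.

Lemma to_finall_continuous : continuous (c : B -> F).
Proof. by apply/continuousP => U [cU dU]. Qed.

Lemma to_finalr_continuous : continuous (d : C -> F).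
Proof. by apply/continuousP => U [cU dU]. Qed.
End Final.

Section GPushout.
Context (G : groupType) (A B C P : gspace G).
Context (a : A -> B) (b : A -> C) (c : B -> P) (d : C -> P).

Section Uniqueness.
Hypothesis po : gpushout a b c d.

Let gma : gmap a. Proof. by case: po => -[]. Qed.
Let gmb : gmap b. Proof. by case: po => -[]. Qed.
Let gmc : gmap c. Proof. by case: po => -[]. Qed.
Let gmd : gmap d. Proof. by case: po => -[]. Qed.
Let cd x : c (a x) = d (b x).
Proof. by case: po => _ /(congr1 (fun f => f x)). Qed.

(** In an indiscrete space with two points, the constant map and the indicator
    of the union of the images agree on [B] and [C], so they are equal. *)
Lemma gpushout_surj p : (exists y, c y = p) \/ (exists z, d z = p).
Proof.
pose Z := @indiscrete_gspace G bool (fun _ x => x) (fun _ => erefl) (fun _ _ _ => erefl).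
pose im p := (exists y, c y = p) \/ (exists z, d z = p).
have gim (X : gspace G) (f : X -> Z) : (forall g x, f (gact g x) = f x) -> gmap f.
  by move=> fE; split; [exact: to_indiscrete_continuous|exact: fE].
have [_ _ /(_ Z (fun=> true) (fun=> true))] := po.
move=> [||//|h [_ hu]]; [by apply: gim|by apply: gim|].
have h1 : h = fun=> true by apply: hu; split=> //; exact: gim.
have h2 : h = fun p => `[< im p >].
  apply: hu; split.
  - apply: gim => g x; apply: asbool_equiv_eq; split.
      move=> [[y yx]|[z zx]]; [left; exists (gact g^-1%g y)|right; exists (gact g^-1%g z)].
        by rewrite gmc.2 yx gactK.
      by rewrite gmd.2 zx gactK.
    move=> [[y yx]|[z zx]]; [left; exists (gact g y)|right; exists (gact g z)].
      by rewrite gmc.2 yx.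
    by rewrite gmd.2 zx.
  - by apply/funext => y /=; apply/asboolP; left; exists y.
  - by apply/funext => z /=; apply/asboolP; right; exists z.
by apply/asboolP; rewrite -[asbool _]/((fun p => `[< im p >]) p) -h2 h1.
Qed.

(** The maps to [P] with its final topology induce a continuous map on [P],
    which can only be the identity. *)
Lemma gpushout_closed S : closed (c @^-1` S) -> closed (d @^-1` S) -> closed S.
Proof.
move=> cS dS.
have ca g : continuous (@gact G P g : final_topology c d -> final_topology c d).
  apply: final_continuous.
    under eq_fun do rewrite -gmc.2.
    exact: (continuous_post (@to_finall_continuous _ _ _ c d) (@gact_continuous _ _ g)).
  under eq_fun do rewrite -gmd.2.
  exact: (continuous_post (@to_finalr_continuous _ _ _ c d) (@gact_continuous _ _ g)).
pose Z := @GSpace G (final_topology c d) (@gact G P) (@gact1 G P) (@gactM G P) ca.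
have [_ _ /(_ Z c d)[|||h [[[ch _] hc hd] _]]] := po.
- by split; [exact: to_finall_continuous|exact: gmc.2].
- by split; [exact: to_finalr_continuous|exact: gmd.2].
- by apply/funext.
have := continuous_closed ch (@final_closed _ _ _ c d S cS dS).
congr closed; apply/seteqP; split=> p; rewrite /preimage /=.
  have [[y <-]|[z <-]] := gpushout_surj p.
    by rewrite [h (c y)](congr1 (fun f => f y) hc).
  by rewrite [h (d z)](congr1 (fun f => f z) hd).
have [[y <-]|[z <-]] := gpushout_surj p.
  by rewrite [h (c y)](congr1 (fun f => f y) hc).
by rewrite [h (d z)](congr1 (fun f => f z) hd).
Qed.

(** Maps to the indiscrete disjoint union of [B] and [C], sending [range b] to
    [B], separate the points of [P]. *)
Lemma gpushout_gluing : closed_embedding b -> gluing a b c d.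
Proof.
move=> eb; have [_ injb _] := eb.
pose act (g : G) (s : B + C) : B + C :=
  match s with inl y => inl (gact g y) | inr z => inr (gact g z) end.
have act1 s : act 1%g s = s by case: s => x; rewrite /= gact1.
have actM g h s : act (g * h)%g s = act g (act h s) by case: s => x; rewrite /= gactM.
pose Z := @indiscrete_gspace G (B + C)%type act act1 actM.
pose v (z : C) : Z :=
  if pselect (exists x, b x = z) is left e then inl (a (projT1 (cid e))) else inr z.
have vb x : v (b x) = inl (a x).
  rewrite /v; case: pselect => [e|]; last by case; exists x.
  by case: (cid e) => x' /= /injb ->.
have vn z : ~ range b z -> v z = inr z.
  by rewrite /v => nz; case: pselect => // -[x xz]; case: nz; exists x.
have [_ _ /(_ Z (fun y => inl y) v)[|||h [[_ hc hd] _]]] := po.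
- by split; [exact: to_indiscrete_continuous|].
- split; first exact: to_indiscrete_continuous.
  move=> g z; have [[x _ <-]|nz] := pselect (range b z).
    by rewrite -gmb.2 !vb gma.2.
  rewrite !vn // => -[x _ xz]; apply: nz; exists (gact g^-1%g x) => //.
  by rewrite gmb.2 xz gactK.
- by apply/funext => x /=; rewrite vb.
have hcE y : h (c y) = inl y by exact: (congr1 (fun f => f y) hc).
have hdE z : h (d z) = v z by exact: (congr1 (fun f => f z) hd).
split=> //.
- exact: gma.1.
- exact: gmc.1.
- exact: gmd.1.
- exact: gpushout_surj.
- by move=> y y' /(congr1 h); rewrite !hcE => -[].
- move=> z z' /(congr1 h); rewrite !hdE.
  have [rz|nz] := pselect (range b z); have [rz'|nz'] := pselect (range b z').
  + by right.
  + by case: rz => x _ <-; rewrite vb vn.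
  + by case: rz' => x _ <-; rewrite vb vn.
  + by rewrite !vn // => -[]; left.
- move=> y z /(congr1 h); rewrite hcE hdE.
  by have [//|/vn ->] := pselect (range b z).
- exact: gpushout_closed.
Qed.
End Uniqueness.

Lemma gluing_gpushout : gmap a -> gmap b -> gmap c -> gmap d ->
  gluing a b c d -> gpushout a b c d.
Proof.
move=> gma gmb gmc gmd gl; split=> //; first by apply/funext; exact: (gl_comm gl).
move=> Z u v gu gv uv.
have [||x|h [ch hc hd]] := po_univ (gluing_pushout gl) (u := u) (v := v).
- exact: gu.1.
- exact: gv.1.
- exact: (congr1 (fun f => f x) uv).
exists h; split.
  split; [split=> // g p|exact/funext|exact/funext].
  have [[y <-]|[z <-]] := gl_surj gl p.
    by rewrite -gmc.2 !hc gu.2.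
  by rewrite -gmd.2 !hd gv.2.
move=> h' [_ h'c h'd]; apply/funext => p.
have [[y <-]|[z <-]] := gl_surj gl p.
  by rewrite hc -h'c.
by rewrite hd -h'd.
Qed.
End GPushout.

(** * Cell attachments *)

Section CellSpace.
Context (G : groupType) (I : choiceType) (K : I -> subgroup G) (T : topologicalType).

Definition cellspace : gspace G := gcoprod (fun i => orbit_times (K i) T).

Definition cell_at (i : I) (g : G) (t : T) : cellspace :=
  existT (fun i => orbit_times (K i) T : Type) i
    (\pi_({eq_quot coset_equiv (K i)})%qT g, t).

Lemma cell_at_surj u : exists i g t, u = cell_at i g t.
Proof.
case: u => i [k t]; exists i, (repr (k : {eq_quot coset_equiv (K i)})%qT), t.
by rewrite /cell_at reprK.
Qed.

Lemma cell_at_act h i g t : gact h (cell_at i g t) = cell_at i (h * g)%g t.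
Proof.
rewrite /cell_at /= /gcoprod_act /= /orbit_act /=.
by rewrite coset_act_pi.
Qed.

Lemma cell_at_eq i g g' t : sg_set (K i) (g^-1 * g')%g -> cell_at i g t = cell_at i g' t.
Proof.
move=> Kg; rewrite /cell_at.
suff -> : \pi_({eq_quot coset_equiv (K i)})%qT g =
  \pi_({eq_quot coset_equiv (K i)})%qT g' by [].
by apply/eqmodP/asboolP.
Qed.

Lemma cell_at_inj i g t i' g' t' : cell_at i g t = cell_at i' g' t' ->
  [/\ i = i', sg_set (K i) (g^-1 * g')%g & t = t'].
Proof.
move=> E; have ii : i = i' by exact: (congr1 (@projT1 _ _) E).
subst i'; have := projT2_eq E; rewrite (Prop_irrelevance (projT1_eq E) erefl) /=.
by move=> -[/eqmodP/asboolP Kg ->].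
Qed.

Lemma closed_cellspace (S : set cellspace) :
  closed S <-> forall i g, closed [set t | S (cell_at i g t)].
Proof.
split=> [cS i g|cS].
  apply: (@continuous_closed _ _ (cell_at i g)) cS.
  apply: (@comp_continuous _ _ _
    (fun t => (\pi_({eq_quot coset_equiv (K i)})%qT g, t) : orbit_times (K i) T)).
    by apply: pair_continuous; [exact: continuous_cst|exact: id_continuous].
  exact: (@existT_continuous I (fun i => orbit_times (K i) T) i).
rewrite -openC; apply/sigT_openP => i.
rewrite openE => -[k t] /= nS; rewrite /interior.
exists ([set k], ~` [set t | S (existT _ i (k, t))]) => /=.
  split; first exact: discrete_set1.
  apply: open_nbhs_nbhs; split=> //; apply: closed_openC.
  have := cS i (repr (k : {eq_quot coset_equiv (K i)})%qT).
  by rewrite /cell_at reprK.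
by move=> [k' t'] /= [-> nS'].
Qed.

Lemma cellspace_desc (X : gspace G) (f : I -> T -> X) :
  (forall i, continuous (f i)) ->
  (forall i h t, sg_set (K i) h -> gact h (f i t) = f i t) ->
  exists Q : cellspace -> X, gmap Q /\
    forall i g t, Q (cell_at i g t) = gact g (f i t).
Proof.
move=> cf fK.
have QP u : exists x, forall i g t, u = cell_at i g t -> x = gact g (f i t).
  have [i [g [t ->]]] := cell_at_surj u.
  exists (gact g (f i t)) => i' g' t' /cell_at_inj[<- Kg <-].
  by rewrite -[in LHS](fK _ _ t Kg) -gactM mulgA mulgV mul1g.
have [Q QE] := choice QP.
have QE' i g t : Q (cell_at i g t) = gact g (f i t) by exact: QE.
exists Q; split=> //; split=> [|g u].
  apply/continuous_closedP => S cS; apply/closed_cellspace => i g.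
  have cg : continuous (fun t => gact g (f i t)).
    by apply: (@continuous_post _ _ _ (gact g)) (cf i); exact: gact_continuous.
  have := continuous_closed cg cS; congr closed.
  by apply/seteqP; split=> t; rewrite /preimage /= QE'.
have [i [h [t ->]]] := cell_at_surj u.
by rewrite cell_at_act !QE' gactM.
Qed.
End CellSpace.
Arguments cell_at {G I K T} i g t.
Arguments cell_at_eq {G I K T i g g'} t.
Arguments cell_at_surj {G I K T} u.

Section Attachment.
Context {R : realType} (G : groupType).
Local Notation D n := (set_type (@disk R n)).
Local Notation S n := (set_type (@sphere R n)).
Local Notation incl n := (set_type_incl (@sphere_disk R n) : S n -> D n).

Lemma closed_sphere n : closed (@sphere R n).
Proof.
rewrite (_ : sphere (n := n) = enorm @^-1` [set x | x <= 1] `&` enorm @^-1` [set x | 1 <= x]).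
  apply: closedI.
    exact: (continuous_closed enorm_continuous (@closed_le R 1)).
  exact: (continuous_closed enorm_continuous (@closed_ge R 1)).
apply/seteqP; split=> v; rewrite /preimage /=.
  by move=> /sphereE ->; rewrite lexx.
by move=> [v1 v1']; apply/sphereE/eqP; rewrite eq_le v1.
Qed.

Lemma closed_disk_boundary n : closed [set y : D n | ~ open_disk (\val y)].
Proof.
have := closed_val_preimage (B := @disk R n)
  (continuous_closed enorm_continuous (@closed_ge R 1)).
congr closed; apply/seteqP; split=> y; rewrite /preimage /=.
  by move=> y1 /open_diskE; rewrite ltNge y1.
by move=> ny; rewrite leNgt; apply/negP => /open_diskE.
Qed.

Lemma sphere_incl_embedding n : closed_embedding (incl n).
Proof.
split.
- by apply: set_type_continuous; exact: set_val_continuous.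
- by move=> x y /(congr1 \val) /= xy; exact: val_inj.
- move=> U cU; have := closed_val_image (@closed_sphere n) cU.
  move=> /(@closed_val_preimage _ (@disk R n)); congr closed.
  apply/seteqP; split=> y /=.
    by move=> [s Us sy]; exists s => //; exact: val_inj.
  by move=> [s Us <-]; exists s.
Qed.

(** A closed subset of a coproduct of orbits of cells is closed cell by cell, so
    this reduces to the inclusion of the sphere in the disk. *)
Lemma sphere_cells_embedding n (I : choiceType) (K : I -> subgroup G) :
  gmap (@sphere_cells_incl R G n I K) /\
  closed_embedding (@sphere_cells_incl R G n I K).
Proof.
have [ci injci cli] := sphere_incl_embedding n.
have iE i g s : sphere_cells_incl (cell_at (K := K) i g s) = cell_at i g (incl n s) by [].
have cincl : continuous (@sphere_cells_incl R G n I K).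
  apply/continuous_closedP => U /(closed_cellspace (K := K)) cU.
  apply/(closed_cellspace (K := K)) => i g.
  exact: (continuous_closed ci (cU i g)).
split; first by split.
split=> // [u u'|U /(closed_cellspace (K := K)) cU].
  have [i [g [s ->]]] := cell_at_surj u; have [i' [g' [s' ->]]] := cell_at_surj u'.
  rewrite !iE => /cell_at_inj[ii Kg /injci <-]; subst i'.
  exact: cell_at_eq.
apply/(closed_cellspace (K := K)) => i g; have := cli _ (cU i g); congr closed.
apply/seteqP; split=> y /=.
  by move=> [s Us <-]; exists (cell_at i g s).
move=> [u]; have [i' [g' [s ->]]] := cell_at_surj u.
rewrite iE => Us /cell_at_inj[ii Kg <-]; subst i'; exists s => //=.
by rewrite -(cell_at_eq s Kg).
Qed.

Lemma range_sphere_cells n (I : choiceType) (K : I -> subgroup G) i g y :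
  range (@sphere_cells_incl R G n I K) (cell_at i g y) <-> sphere (\val y).
Proof.
split=> [[u _]|sy].
  have [i' [g' [s ->]]] := cell_at_surj u.
  move=> /(@cell_at_inj _ _ _ (D n))[_ _ <-]; exact: (set_mem (valP s)).
exists (cell_at i g (insub_set sy)) => //.
rewrite -[LHS]/(cell_at i g (incl n (insub_set sy))).
by congr cell_at; exact: val_inj.
Qed.

(** The conditions of [gcells] at a single stage. That skeleta are closed takes
    all stages together, so [at_weak] assumes it. *)
Record attaches (X : gspace G) n (Y0 Y1 : set X) (I : choiceType)
    (K : I -> subgroup G) (psi : I -> D n -> X) : Prop := Attaches {
  at_continuous : forall i, continuous (psi i);
  at_fix : forall i g y, sg_set (K i) g -> gact g (psi i y) = psi i y;
  at_sphere : forall i y, sphere (\val y) -> Y0 (psi i y);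
  at_open : forall i y, open_disk (\val y) -> ~ Y0 (psi i y);
  at_inj : forall i i' g y y', open_disk (\val y) -> open_disk (\val y') ->
    gact g (psi i y) = psi i' y' -> [/\ i = i', sg_set (K i) g & y = y'];
  at_step : forall x, Y1 x <-> Y0 x \/
    exists i g y, open_disk (\val y) /\ gact g (psi i y) = x;
  at_weak : closed Y1 -> forall S : set X, S `<=` Y1 -> closed (S `&` Y0) ->
    (forall i g, closed [set y | S (gact g (psi i y))]) -> closed S
}.

Definition base_char (X : filtered_gspace G) n (I : choiceType)
    (K : I -> subgroup G) (Q : disk_cells R n K -> skeleton X n) (i : I)
    (y : D n) : X :=
  \val (Q (cell_at i 1%g y)).

Lemma base_charE (X : filtered_gspace G) n (I : choiceType) (K : I -> subgroup G)
    (Q : disk_cells R n K -> skeleton X n) i g y :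
  gmap Q -> gact g (base_char Q i y) = \val (Q (cell_at i g y)).
Proof.
move=> [_ QE]; rewrite /base_char.
by have := QE g (cell_at i 1%g y); rewrite cell_at_act mulg1 => ->.
Qed.

Lemma attachment_gluing (X : filtered_gspace G) n (I : choiceType)
    (K : I -> subgroup G) q (Q : disk_cells R n K -> skeleton X n) :
  cell_attachment q Q ->
  gluing q (@sphere_cells_incl R G n I K) (skeleton_incl X n) Q.
Proof. by move=> att; exact: (gpushout_gluing att (sphere_cells_embedding n K).2). Qed.

Lemma attachment_attaches (X : filtered_gspace G) n (I : choiceType)
    (K : I -> subgroup G) q (Q : disk_cells R n K -> skeleton X n) :
  cell_attachment q Q -> attaches (skel_pred X n) (skel X n) K (base_char Q).
Proof.
move=> att; have gl := attachment_gluing att.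
have gQ : gmap Q by case: att => -[].
have QE i g y := base_charE i g y gQ.
have QS i g y : skel_pred X n (\val (Q (cell_at i g y))) <-> sphere (\val y).
  rewrite -(range_sphere_cells K i g); split=> [Yy|[u _ <-]].
    apply: (gl_meet gl (y := insub_set Yy)); exact: val_inj.
  by rewrite -(gl_comm gl); exact: (set_mem (valP (q u))).
split.
- move=> i.
  apply: (@continuous_post _ _ _ (fun x : skeleton X n => \val x)).
    exact: set_val_continuous.
  apply/continuous_closedP => U cU.
  by have /(closed_cellspace (K := K)) := continuous_closed (gl_d gl) cU; exact.
- move=> i g y Kg; rewrite QE /base_char; congr (\val (Q _)); apply: cell_at_eq.
  by rewrite mulg1; exact: sgV.
- by move=> i y sy; apply/QS.
- by move=> i y oy /QS; exact: open_disk_sphere.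
- move=> i i' g y y' oy oy'; rewrite QE => /val_inj /(gl_injr gl)[|].
    move=> /cell_at_inj[ii + yy]; rewrite mulg1 => /sgV; rewrite invgK.
    by [].
  by move=> [/range_sphere_cells/(open_disk_sphere oy)].
- move=> x; split=> [Yx|[|[i [g [y [_ <-]]]]]]; last 2 first.
  + exact: skel_pred_sub.
  + by rewrite QE; exact: (set_mem (valP (Q _))).
  have [[z zx]|[u ux]] := gl_surj gl (insub_set Yx).
    left; have /(congr1 \val) /= <- := zx; exact: (set_mem (valP z)).
  have [i [g [y uE]]] := cell_at_surj u; rewrite uE in ux.
  have [oy|sy] := disk_cases y; last first.
    by left; have /(congr1 \val) /= <- := ux; apply/QS.
  by right; exists i, g, y; split=> //; rewrite QE ux.
- move=> cY U UY cU cUQ.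
  pose V := (fun x : skeleton X n => \val x : X) @^-1` U.
  have -> : U = (fun x : skeleton X n => \val x : X) @` V.
    apply/seteqP; split=> [x Ux|x [z Vz <-]//].
    by exists (insub_set (UY _ Ux)).
  apply/(closed_set_typeP _ cY); apply: (gl_closed gl).
    have := @closed_val_preimage _ (skel_pred X n) _ cU; congr closed.
    apply/seteqP; split=> x /=; first by case.
    by move=> Ux; split=> //; exact: (set_mem (valP x)).
  apply/(closed_cellspace (K := K)) => i g; have := cUQ i g; congr closed.
  by apply/seteqP; split=> y /=; rewrite QE.
Qed.

Section Filtered.
Context (X : filtered_gspace G).

Lemma skel_mono m n : (m <= n)%N -> skel X m `<=` skel X n.
Proof.
move=> /subnK <-; elim: (n - m)%N => // k IH x /IH; rewrite addSn; exact: skelS.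
Qed.

Lemma skel_pred_mono m n : (m < n)%N -> skel X m `<=` skel_pred X n.
Proof. by case: n => // n; rewrite ltnS => /skel_mono. Qed.

(** In a cell of dimension above [m] the points of the m-skeleton lie on the
    boundary sphere, where they form a closed set by induction. *)
Lemma gcw_closed_skel m : gcw R X -> closed (skel X m).
Proof.
move=> [_ colim att]; apply: colim => n.
elim: n => [|n IH].
  rewrite (_ : _ @^-1` _ = setT); first exact: closedT.
  apply/seteqP; split=> // x _; apply: (skel_mono (leq0n m)); exact: (set_mem (valP x)).
have [le|lt] := leqP n.+1 m.
  rewrite (_ : _ @^-1` _ = setT); first exact: closedT.
  apply/seteqP; split=> // x _; apply: (skel_mono le); exact: (set_mem (valP x)).
have [I [K [q [Q at_]]]] := att n.+1.
have gl := attachment_gluing at_.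
have [_ _ cli] := gl_b gl.
apply: (gl_closed gl); first exact: IH.
have := cli _ (continuous_closed (gl_a gl) IH); congr closed.
apply/seteqP; split=> u /=.
  move=> [s ms <-]; rewrite /preimage /= -(gl_comm gl).
  exact: ms.
move=> mu.
have Yu : skel_pred X n.+1 (\val (Q u)) by apply: (@skel_pred_mono m n.+1) mu.
have [s _ su] : range (@sphere_cells_incl R G n.+1 I K) u.
  by apply: (gl_meet gl (y := insub_set Yu)); exact: val_inj.
exists s => //; rewrite /preimage /=.
have /(congr1 \val) /= -> := gl_comm gl s.
by rewrite su.
Qed.

Lemma gcw_closed_skel_pred n : gcw R X -> closed (skel_pred X n).
Proof. by case: n => [|n] cw; [exact: closed0|exact: gcw_closed_skel]. Qed.

Lemma gcw_gcells : gcw R X -> exists (J : nat -> choiceType)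
  (K : forall n, J n -> subgroup G) (psi : forall n, J n -> D n -> X),
  gcells (skel_pred X) K psi.
Proof.
move=> cw; have [exh colim att] := cw.
have lev n : exists p : {I : choiceType & ((I -> subgroup G) * (I -> D n -> X))%type},
    attaches (skel_pred X n) (skel X n) (projT2 p).1 (projT2 p).2.
  have [I [K [q [Q at_]]]] := att n.
  exists (existT _ I (K, base_char Q)); exact: attachment_attaches at_.
pose p n := projT1 (cid (lev n)).
have pP n : attaches (skel_pred X n) (skel X n) (projT2 (p n)).1 (projT2 (p n)).2.
  exact: (projT2 (cid (lev n))).
exists (fun n => projT1 (p n)), (fun n => (projT2 (p n)).1), (fun n => (projT2 (p n)).2).
split.
- by move=> n; exact: (at_continuous (pP n)).
- exact: skel_pred_inv.
- by move=> n; exact: (at_fix (pP n)).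
- by move=> n; exact: (at_sphere (pP n)).
- by move=> n; exact: (at_open (pP n)).
- by move=> n; exact: (at_inj (pP n)).
- by move=> n; exact: (at_step (pP n)).
- by move=> n; exact: gcw_closed_skel_pred.
- by move=> n; apply: (at_weak (pP n)); exact: gcw_closed_skel.
- by move=> x; have [n nx] := exh x; exists n.+1.
- move=> U cU; apply: colim => n; have := @closed_val_preimage _ (skel X n) _ (cU n.+1).
  congr closed; apply/seteqP; split=> x /=; first by case.
  by move=> Ux; split=> //; exact: (set_mem (valP x)).
Qed.

(** The cell structure that exhibits [C] may differ from the one at hand; these
    are the only properties of [C] that are needed to compare them. *)
Lemma open_cell_complement (C : set X) : gcw R X -> open_cell R C ->
  exists n, [/\ C `<=` skel X n, C `&` skel_pred X n = set0 &
    closed (skel X n `\` C)].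
Proof.
move=> cw [n [I [K [q [Q [att [i ->]]]]]]]; exists n.
have ac := attachment_attaches att.
have gQ : gmap Q by case: att => -[].
have CE x : open_cell_of Q i x <->
    exists g (y : D n), open_disk (\val y) /\ gact g (base_char Q i y) = x.
  split=> [[u [ui ou ux]]|[g [y [oy <-]]]].
    have [i' [g [y uE]]] := cell_at_surj u; move: ui ou ux; rewrite uE /= => <- oy <-.
    by exists g, y; rewrite base_charE.
  by exists (cell_at i g y); rewrite base_charE.
split.
- by move=> x /CE[g [y [oy <-]]]; apply/(at_step ac); right; exists i, g, y.
- apply/seteqP; split=> // x [/CE[g [y [oy <-]]]].
  by move=> /(ginvariantE _ _ (@skel_pred_inv _ X n)); exact: (at_open ac).
apply: (at_weak ac); first exact: gcw_closed_skel.
- by move=> x [].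
- have := @gcw_closed_skel_pred n cw; congr closed; apply/seteqP; split=> x /=.
    move=> Yx; split=> //; split; first exact: skel_pred_sub.
    move=> /CE[g [y [oy xE]]]; move: Yx; rewrite -xE.
    by move=> /(ginvariantE _ _ (@skel_pred_inv _ X n)); exact: (at_open ac).
  by case.
move=> i' g; have Yi y : skel X n (gact g (base_char Q i' y)).
  apply/(at_step ac); have [oy|sy] := disk_cases y.
    by right; exists i', g, y.
  by left; apply: skel_pred_inv; exact: (at_sphere ac).
have [ii|ne] := pselect (i' = i).
  subst i'; have := @closed_disk_boundary n; congr closed; apply/seteqP; split=> y /=.
    move=> ny; split=> // /CE[g' [y' [oy' E]]]; apply: ny.
    have [//|sy] := disk_cases y.
    have : skel_pred X n (gact g (base_char Q i y)).
      by apply: skel_pred_inv; exact: (at_sphere ac).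
    rewrite -E => /(ginvariantE _ _ (@skel_pred_inv _ X n)).
    by move=> /(at_open ac oy').
  by move=> [_ nC] oy; apply: nC; apply/CE; exists g, y.
rewrite (_ : mkset _ = setT); first exact: closedT.
apply/seteqP; split=> // y _; split=> // /CE[g' [y' [oy' E]]].
have [oy|sy] := disk_cases y; last first.
  have : skel_pred X n (gact g (base_char Q i' y)).
    by apply: skel_pred_inv; exact: (at_sphere ac).
  by rewrite -E => /(ginvariantE _ _ (@skel_pred_inv _ X n)) /(at_open ac oy').
have : gact (g^-1 * g')%g (base_char Q i y') = base_char Q i' y.
  by rewrite gactM E gactK.
by move=> /(at_inj ac oy' oy)[/esym].
Qed.

(** The part of a subcomplex inside an open cell is closed there, and it is open
    since each of its points lies in a cell of the subcomplex, so it is all or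
    nothing. *)
Lemma gsubcomplex_saturated (A : set X) (J : nat -> choiceType)
    (K : forall n, J n -> subgroup G) (psi : forall n, J n -> D n -> X) :
  gcw R X -> gcells (skel_pred X) K psi -> gsubcomplex R A ->
  forall n j, (forall y, open_disk (\val y) -> A (psi n j y)) \/
    (forall y, open_disk (\val y) -> ~ A (psi n j y)).
Proof.
move=> cw gc [cA cellA] n j.
have [[y0 [oy0 Ay0]]|none] :=
    pselect (exists y, open_disk (\val y) /\ A (psi n j y)); last first.
  by right=> y oy Ay; apply: none; exists y.
left=> y oy; pose U : set (D n) := psi n j @^-1` A.
pose cells : set (set X) := [set C | C `<=` A /\ closed (skel X n `\` C)].
pose V : set (D n) := psi n j @^-1` \bigcap_(C in cells) (skel X n `\` C).
have cj := @gc_continuous _ _ _ _ _ _ _ gc n j.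
have in_n z : skel X n (psi n j z).
  by have := @gcells_image _ _ _ _ _ _ _ gc n j 1%g z; rewrite gact1.
apply: (@open_disk_clopen _ _ U V _ _ _ _ y0 y) => //.
- exact: (continuous_closed cj).
- by apply: (continuous_closed cj); apply: closed_bigI => C [].
- move=> z oz; have [Az|nAz] := pselect (A (psi n j z)); first by left.
  by right=> C [CA _]; split=> // /CA.
- move=> z oz Az Vz; have [C [oC Cz CA]] := cellA _ Az.
  have [m [Cm Cm' clC]] := open_cell_complement cw oC.
  have nz : ~ skel_pred X n (psi n j z) by exact: (gc_open gc).
  have nz' : ~ skel_pred X m (psi n j z).
    by move=> Yz; have : (C `&` skel_pred X m) (psi n j z) by []; rewrite Cm'.
  have mn : m = n.
    have [lt|lt|//] := ltngtP m n.
      by case: nz; apply: (skel_pred_mono lt); exact: Cm.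
    by case: nz'; apply: (skel_pred_mono lt).
  by subst m; have [] := Vz C (conj CA clC).
Qed.

Lemma gcells_gcw (J : nat -> choiceType) (K : forall n, J n -> subgroup G)
    (psi : forall n, J n -> D n -> X) :
  gcells (skel_pred X) K psi -> gcw R X.
Proof.
move=> gc; have cY n : closed (skel X n) by exact: (@gc_closed _ _ _ _ _ _ _ gc n.+1).
split.
- move=> x; have [[|n] // nx] := gc_exhaust gc x; by exists n.
- move=> U cU; apply: (gc_colimit gc) => -[|n]; first by rewrite setI0; exact: closed0.
  have := closed_val_image (cY n) (cU n); congr closed; apply/seteqP; split=> x /=.
    by move=> [z Uz <-]; split=> //; exact: (set_mem (valP z)).
  by move=> [Ux Yx]; exists (insub_set Yx).
move=> n; have iX j y : skel X n (psi n j y).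
  by have := @gcells_image _ _ _ _ _ _ _ gc n j 1%g y; rewrite gact1.
have iS j (s : S n) : skel_pred X n (psi n j (incl n s)).
  by apply: (gc_sphere gc); exact: (set_mem (valP s)).
have cj j := @gc_continuous _ _ _ _ _ _ _ gc n j.
have [||Q [gQ QE]] := @cellspace_desc G (J n) (K n) (D n) (skeleton X n)
    (fun j y => insub_set (iX j y)).
- by move=> j; apply: set_type_continuous; exact: cj.
- by move=> j h y Kh; apply: val_inj; exact: (gc_fix gc).
have [||q [gq qE]] := @cellspace_desc G (J n) (K n) (S n) (skeleton_pred X n)
    (fun j s => insub_set (iS j s)).
- move=> j; apply: set_type_continuous; apply: (continuous_post (cj j)).
  by have [] := sphere_incl_embedding n.
- by move=> j h y Kh; apply: val_inj; exact: (gc_fix gc).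
have [ginc einc] := sphere_cells_embedding n (K n).
exists (J n), (K n), q, Q.
have gsk : gmap (skeleton_incl X n).
  split; first by apply: set_type_continuous; exact: set_val_continuous.
  by move=> g x; exact: val_inj.
have vQ j g y : \val (Q (cell_at j g y)) = gact g (psi n j y) by rewrite QE.
apply: gluing_gpushout => //; split=> //.
- exact: gq.1.
- exact: gsk.1.
- exact: gQ.1.
- move=> u; have [j [g [s ->]]] := cell_at_surj u; apply: val_inj.
  rewrite qE /=.
  by have -> := vQ j g (incl n s).
- move=> x; have /(gc_step gc)[Yx|[j [g [y [oy xE]]]]] : skel_pred X n.+1 (\val x).
    exact: (set_mem (valP x)).
    by left; exists (insub_set Yx); exact: val_inj.
  by right; exists (cell_at (T := D n) j g y); apply: val_inj; rewrite vQ.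
- by move=> x x' /(congr1 \val) xx; exact: val_inj.
- move=> u u' /(congr1 \val).
  have [j [g [y ->]]] := cell_at_surj u; have [j' [g' [y' ->]]] := cell_at_surj u'.
  rewrite !vQ => E; rewrite !range_sphere_cells.
  have E' : gact (g'^-1 * g)%g (psi n j y) = psi n j' y' by rewrite gactM E gactK.
  have iY := @skel_pred_inv _ X n.
  have [oy|sy] := disk_cases y; have [oy'|sy'] := disk_cases y'.
  + left; have [jj Kg yy] := gc_inj gc oy oy' E'; subst j' y'.
    by apply: cell_at_eq; have := sgV Kg; rewrite invgM invgK.
  + have := gc_sphere gc j' sy'; rewrite -E' => /(ginvariantE _ _ iY).
    by move=> /(gc_open gc oy).
  + have := iY (g'^-1 * g)%g _ (gc_sphere gc j sy); rewrite E'.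
    by move=> /(gc_open gc oy').
  + by right.
- move=> x u /(congr1 \val).
  have [j [g [y ->]]] := cell_at_surj u; rewrite vQ /= => E.
  apply/range_sphere_cells; have [oy|//] := disk_cases y.
  have : skel_pred X n (gact g (psi n j y)) by rewrite -E; exact: (set_mem (valP x)).
  by move=> /(ginvariantE _ _ (@skel_pred_inv _ X n)) /(gc_open gc oy).
- move=> U cU cUQ; apply/(closed_set_typeP _ (cY n)).
  apply: (gc_weak gc (n := n)).
  + by move=> _ [x _ <-]; exact: (set_mem (valP x)).
  + have := closed_val_image (@gc_closed _ _ _ _ _ _ _ gc n) cU; congr closed.
    apply/seteqP; split=> x /=.
      move=> [z Uz <-]; split; last exact: (set_mem (valP z)).
      by exists (skeleton_incl X n z).
    move=> [[z Uz <-] Yz]; exists (insub_set Yz) => //; rewrite /preimage /=.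
    by rewrite (_ : skeleton_incl X n _ = z) //; exact: val_inj.
  move=> j g; have /(closed_cellspace (K := K n))/(_ j g) := cUQ; congr closed.
  apply/seteqP; split=> y; rewrite /preimage /=.
    by move=> Uy; exists (Q (cell_at j g y)); rewrite ?vQ.
  move=> [z Uz zE].
  by rewrite (_ : Q _ = z) //; apply: val_inj; rewrite vQ -zE.
Qed.
End Filtered.
End Attachment.

(** * Coproducts of induced spaces *)

Lemma sg_val_inj (G : groupType) (N : subgroup G) : injective (@sg_val G N).
Proof. by move=> m n mn; apply: val_inj. Qed.

Section Induced.
Context {R : realType} (G : groupType) (I : choiceType) (N : I -> subgroup G).
Local Notation D n := (set_type (@disk R n)).

Section Space.
Context (X : forall i, gspace (subgroup_type (N i))).

Definition induced : gspace G := gcoprod (fun i => gind (X i)).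

Definition ind_at (i : I) (g : G) (x : X i) : induced :=
  existT (fun i => gind (X i) : Type) i (gind_pi g x).
Arguments ind_at i g x : clear implicits.

Lemma ind_at_surj u : exists i g x, u = ind_at i g x.
Proof.
case: u => i v; exists i, (gind_repr v).1, (gind_repr v).2.
by rewrite /ind_at gind_reprK.
Qed.

Lemma ind_at_act h i g x : gact h (ind_at i g x) = ind_at i (h * g)%g x.
Proof. by rewrite /ind_at /= /gcoprod_act /= gind_act_pi. Qed.

Lemma ind_at_index i g x i' g' x' : ind_at i g x = ind_at i' g' x' -> i = i'.
Proof. by move=> /(congr1 (@projT1 _ _)). Qed.

Lemma ind_atE i g x g' x' : ind_at i g x = ind_at i g' x' <->
  exists n : subgroup_type (N i), g = (g' * sg_val n)%g /\ x' = gact n x.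
Proof.
rewrite -gind_piE; split=> [E|E]; last by rewrite /ind_at E.
by have := projT2_eq E; rewrite (Prop_irrelevance (projT1_eq E) erefl).
Qed.

Lemma ind_at_val i g n x : ind_at i (g * sg_val n)%g x = ind_at i g (gact n x).
Proof. by apply/ind_atE; exists n. Qed.

Lemma ind_at_inj i g : injective (ind_at i g).
Proof.
move=> x x' /ind_atE[n [gn ->]].
have n1 : sg_val n = 1%g by apply: (mulgI g); rewrite mulg1.
have -> : n = 1%g by apply: sg_val_inj; rewrite sg_val1.
by rewrite gact1.
Qed.

Lemma closed_induced (S : set induced) :
  closed S <-> forall i g, closed [set x | S (ind_at i g x)].
Proof.
have pc i : continuous (\pi_(quotient_topology {eq_quot gind_equiv (X i)})%qT).
  exact: pi_continuous.
split=> [cS i g|cS].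
  apply: (@continuous_closed _ _ (ind_at i g)) cS.
  apply: (@comp_continuous _ _ _ (fun x => gind_pi g x : gind (X i))).
    apply: (@comp_continuous _ _ _ (fun x => (g, x) : discrete_topology G * X i)
      (\pi_(quotient_topology {eq_quot gind_equiv (X i)})%qT)); last exact: pc.
    by apply: pair_continuous; [exact: continuous_cst|exact: id_continuous].
  exact: (@existT_continuous I (fun i => gind (X i)) i).
rewrite -openC; apply/sigT_openP => i.
rewrite -[open _]/(open (\pi_(quotient_topology {eq_quot gind_equiv (X i)})%qT @^-1`
  (existT (fun i => gind (X i) : Type) i @^-1` ~` S))).
rewrite openE => -[g x] /= nS; rewrite /interior.
exists ([set g], ~` [set x | S (ind_at i g x)]) => /=.
  split; first exact: discrete_set1.
  by apply: open_nbhs_nbhs; split=> //; exact: closed_openC.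
by move=> [g' x'] /= [-> nS'].
Qed.

Lemma ind_at_continuous i g : continuous (ind_at i g).
Proof. by apply/continuous_closedP => S /closed_induced; exact. Qed.

(** An induced space is the disjoint union of the translates [g X_i] over the
    cosets [g N_i]; this is the index of the translate that contains [u]. *)
Definition part (u : induced) : {i : I & cosets (N i)} :=
  existT (fun i => cosets (N i) : Type) (projT1 u)
    (\pi_({eq_quot coset_equiv (N (projT1 u))})%qT (gind_repr (projT2 u)).1).

Lemma part_ind_at i g x : part (ind_at i g x) =
  existT (fun i => cosets (N i) : Type) i (\pi_({eq_quot coset_equiv (N i)})%qT g).
Proof.
rewrite /part /ind_at /=.
suff -> : \pi_({eq_quot coset_equiv (N i)})%qT (gind_repr (gind_pi g x)).1 =
  \pi_({eq_quot coset_equiv (N i)})%qT g by [].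
apply/eqmodP/asboolP.
have /gind_piE[n [-> _]] := gind_reprK (gind_pi g x).
by rewrite invgM mulgVK; apply: sgV; exact: sg_valP.
Qed.

Lemma part_eq i g x g' x' : sg_set (N i) (g^-1 * g')%g ->
  part (ind_at i g x) = part (ind_at i g' x').
Proof.
move=> Ng; rewrite !part_ind_at.
suff -> : \pi_({eq_quot coset_equiv (N i)})%qT g =
  \pi_({eq_quot coset_equiv (N i)})%qT g' by [].
by apply/eqmodP/asboolP.
Qed.

Lemma part_inj i g x i' g' x' :
  part (ind_at i g x) = part (ind_at i' g' x') ->
  i = i' /\ sg_set (N i) (g^-1 * g')%g.
Proof.
rewrite !part_ind_at => E; have ii : i = i' by exact: (congr1 (@projT1 _ _) E).
subst i'; split=> //.
have := projT2_eq E; rewrite (Prop_irrelevance (projT1_eq E) erefl) /=.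
by move=> /eqmodP/asboolP.
Qed.

Lemma part_locally_constant : locally_constant part.
Proof.
move=> U; apply/closed_induced => i g.
pose s := existT (fun i => cosets (N i) : Type) i (\pi_({eq_quot coset_equiv (N i)})%qT g).
have [Us|Us] := pselect (U s).
  rewrite (_ : mkset _ = setT); first exact: closedT.
  by apply/seteqP; split=> // x _; rewrite /preimage /= part_ind_at.
rewrite (_ : mkset _ = set0); first exact: closed0.
by apply/seteqP; split=> // x; rewrite /preimage /= part_ind_at.
Qed.

Section Cells.
Context (Y : forall i, nat -> set (X i)) (J : I -> nat -> choiceType).
Context (K : forall i n, J i n -> subgroup (subgroup_type (N i))).
Context (psi : forall i n, J i n -> D n -> X i).
Arguments Y : clear implicits.
Arguments K : clear implicits.
Arguments psi : clear implicits.
Hypothesis gc : forall i, gcells (Y i) (K i) (psi i).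

Definition induced_filtration n : set induced :=
  [set u | exists i g x, Y i n x /\ u = ind_at i g x].

Definition induced_cells n : choiceType := {i : I & J i n}.

Definition induced_stabilizer n (j : induced_cells n) : subgroup G :=
  ambient (K (projT1 j) n (projT2 j)).

Definition induced_char n (j : induced_cells n) (y : D n) : induced :=
  ind_at (projT1 j) 1%g (psi (projT1 j) n (projT2 j) y).

Lemma induced_filtrationE n i g x : induced_filtration n (ind_at i g x) <-> Y i n x.
Proof.
split=> [[i' [g' [x' [Yx E]]]]|Yx]; last by exists i, g, x.
have ii := ind_at_index E; subst i'; move: E => /ind_atE[m [_ xE]].
by move: Yx; rewrite xE => /(ginvariantE _ _ (gc_inv (gc i) (n := n))).
Qed.

(** A cell N_i/K x D^n of X_i induces the cell G/K x D^n. *)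
Lemma gcells_induced :
  gcells induced_filtration induced_stabilizer induced_char.
Proof.
split.
- move=> n [i j]; apply: (continuous_post (@ind_at_continuous i 1%g)).
  exact: (@gc_continuous _ _ _ _ _ _ _ (gc i) n j).
- move=> n g _ [i [h [x [Yx ->]]]]; rewrite ind_at_act.
  by apply/induced_filtrationE.
- move=> n [i j] _ y [k Kk <-]; rewrite /induced_char ind_at_act /= mulg1.
  by rewrite -[sg_val k]mul1g ind_at_val (gc_fix (gc i)).
- by move=> n [i j] y sy; apply/induced_filtrationE; exact: (gc_sphere (gc i)).
- by move=> n [i j] y oy /induced_filtrationE; exact: (gc_open (gc i)).
- move=> n [i j] [i' j'] g y y' oy oy'; rewrite /induced_char ind_at_act /= => E.
  have ii := ind_at_index E; subst i'; move: E => /ind_atE[m [gm xE]].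
  have [jj Km yy] := gc_inj (gc i) oy oy' (esym xE); subst j'; split=> //.
  by exists m => //; move: gm; rewrite mulg1 mul1g.
- move=> n u; split.
    move=> [i [g [x [/(gc_step (gc i))[Yx|[j [m [y [oy <-]]]]] ->]]]].
      by left; exists i, g, x.
    right; exists (existT (fun i => J i n : Type) i j), (g * sg_val m)%g, y.
    by split=> //; rewrite /induced_char ind_at_act /= mulg1 ind_at_val.
  move=> [[i [g [x [Yx ->]]]]|[[i j] [g [y [oy <-]]]]].
    by apply/induced_filtrationE/(gc_step (gc i)); left.
  rewrite /induced_char ind_at_act /=; apply/induced_filtrationE.
  by have := gcells_image (gc i) j 1%g y; rewrite gact1.
- move=> n; apply/closed_induced => i g.
  rewrite (_ : mkset _ = Y i n); first exact: (gc_closed (gc i)).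
  by apply/seteqP; split=> x /(induced_filtrationE n g x).
- move=> n S SY cS cp; apply/closed_induced => i g.
  apply: (gc_weak (gc i) (n := n)).
  + by move=> x /SY /induced_filtrationE.
  + move: cS => /closed_induced/(_ i g); congr closed.
    by apply/seteqP; split=> x /= [Sx /induced_filtrationE].
  + move=> j m; have := cp (existT (fun i => J i n : Type) i j) (g * sg_val m)%g.
    congr closed; apply/seteqP; split=> y;
      by rewrite /mkset /induced_char ind_at_act /= mulg1 ind_at_val.
- move=> u; have [i [g [x ->]]] := ind_at_surj u.
  by have [n Yx] := gc_exhaust (gc i) x; exists n; apply/induced_filtrationE.
- move=> S cS; apply/closed_induced => i g; apply: (gc_colimit (gc i)) => n.
  move: (cS n) => /closed_induced/(_ i g); congr closed.
  by apply/seteqP; split=> x /= [Sx /induced_filtrationE].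
Qed.
End Cells.

(** ** Fixed points of induced spaces *)

Section Pullback.
Context (i : I) (g : G) (H : subgroup G).
Let L : set (subgroup_type (N i)) := [set n | sg_set H (g * sg_val n * g^-1)%g].

Lemma pullback1 : L 1%g.
Proof. by rewrite /L /= sg_val1 mulg1 mulgV; exact: sg1. Qed.

Lemma pullbackM m n : L m -> L n -> L (m * n)%g.
Proof.
by rewrite /L /= => Lm Ln; have := sgM Lm Ln; rewrite sg_valM !mulgA mulgVK.
Qed.

Lemma pullbackV n : L n -> L n^-1%g.
Proof. by rewrite /L /= => Ln; have := sgV Ln; rewrite sg_valV !invgM invgK mulgA. Qed.

(** The intersection of N_i with g^-1 H g. *)
Definition pullback : subgroup (subgroup_type (N i)) :=
  @Subgroup _ [set n | sg_set H (g * sg_val n * g^-1)%g] pullback1 pullbackM pullbackV.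

Definition conj_in := forall h, sg_set H h -> sg_set (N i) (g^-1 * h * g)%g.

Lemma ambient_pullback : conj_in -> ambient pullback = conj_subgroup g^-1 H.
Proof.
move=> HN; apply: subgroupP; apply/seteqP; split=> x.
  by move=> [n Ln <-]; apply/conj_subgroupE; rewrite invgK.
move=> /conj_subgroupE; rewrite invgK => Hx.
have Nx : sg_set (N i) x.
  by have := HN _ Hx; rewrite !mulgA mulVg mul1g mulgVK.
exists (insub_set Nx) => //.
Qed.

(** An element h of H fixes the point of the summand g X_i given by x exactly
    when g^-1 h g lies in N_i and fixes x. *)
Lemma fixed_ind_at x : fixed_points induced H (ind_at i g x) <->
  conj_in /\ fixed_points (X i) pullback x.
Proof.
have conjK (h : G) : (g * (g^-1 * h * g))%g = (h * g)%g.
  by rewrite !mulgA mulgV mul1g.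
split=> [fx|[HN fx] h Hh].
  have fxn h : sg_set H h -> exists n : subgroup_type (N i),
      (g^-1 * h * g)%g = sg_val n /\ gact n x = x.
    move=> /fx; rewrite ind_at_act => /ind_atE[n [E xE]]; exists n; split=> //.
    by rewrite -mulgA E mulgA mulVg mul1g.
  split=> [h /fxn[n [-> _]]|n Ln]; first exact: sg_valP.
  have [m [E mx]] := fxn _ Ln.
  suff -> : n = m by [].
  apply: sg_val_inj; rewrite -E.
  by rewrite !mulgA mulgVK mulVg mul1g.
pose n : subgroup_type (N i) := insub_set (HN h Hh).
have nE : sg_val n = (g^-1 * h * g)%g by [].
rewrite ind_at_act -conjK -nE ind_at_val fx //.
by rewrite /= nE conjK mulgK.
Qed.
End Pullback.

Section FixedFibres.
Context (H : subgroup G).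
Local Notation W := (fixed_points induced H).
Local Notation V i g := (fixed_points (X i) (pullback i g H)).
Hypothesis cX : forall i g, closed (V i g).
Hypothesis contr : forall i g,
  fibrewise_contractible (R := R) (fun _ : set_type (V i g) => tt).

Definition fixed_part (u : set_type W) := part (\val u).

Lemma fixed_part_locally_constant : locally_constant fixed_part.
Proof.
move=> U; have := @closed_val_preimage _ W _ (@part_locally_constant U); exact.
Qed.

(** Each summand of the fixed point set is a copy of the fixed points of some
    X_i, reached through a chosen representative of the coset. *)
Lemma induced_fibrewise_contractible : fibrewise_contractible (R := R) fixed_part.
Proof.
pose th i g := projT1 (cid (contr i g)).
have thP i g : [/\ continuous (th i g), forall x, th i g (x, 0) = x &
    forall x y, th i g (x, 1) = th i g (y, 1)].
  by have [ct t0 t1 _] := projT2 (cid (contr i g)); split=> // x y; exact: t1.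
(* The summands are indexed by cosets; computations use the representative
   [can i g] of the coset of [g]. *)
pose can i g : G := repr (\pi_({eq_quot coset_equiv (N i)})%qT g).
have canP i g : exists n : subgroup_type (N i), g = (can i g * sg_val n)%g.
  have /eqmodP/asboolP Ng := reprK (\pi_({eq_quot coset_equiv (N i)})%qT g).
  exists (insub_set Ng); rewrite -[sg_val _]/(_^-1 * g)%g.
  by rewrite mulgA mulgV mul1g.
have canK i g (n : subgroup_type (N i)) : can i (g * sg_val n)%g = can i g.
  rewrite /can; congr repr; apply/eqmodP/asboolP.
  by rewrite invgM mulgVK; apply: sgV; exact: sg_valP.
have iotaP i g (HN : conj_in i g H) (x : set_type (V i g)) : W (ind_at i g (\val x)).
  by apply/fixed_ind_at; split=> //; exact: (set_mem (valP x)).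
pose iota i g HN x : set_type W := insub_set (@iotaP i g HN x).
have ciota i g HN : continuous (@iota i g HN).
  apply: set_type_continuous.
  exact: (continuous_post (@ind_at_continuous i g) (@set_val_continuous _ (V i g))).
have surj (u : set_type W) : exists i g (HN : conj_in i g H) x,
    can i g = g /\ u = iota i g HN x.
  have [i [g [x ux]]] := ind_at_surj (\val u).
  have [n gn] := canP i g; move: ux; rewrite gn ind_at_val => ux.
  have Wu : W (ind_at i (can i g) (gact n x)) by rewrite -ux; exact: (set_mem (valP u)).
  have [HN fx] := (fixed_ind_at (can i g) H (gact n x)).1 Wu.
  exists i, (can i g), HN, (insub_set fx); split; last exact: val_inj.
  by rewrite [in RHS](_ : g = can i g * sg_val n)%g // canK.
have inj i g HN x i' g' HN' x' : can i g = g -> can i' g' = g' ->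
    iota i g HN x = iota i' g' HN' x' -> forall t,
    iota i g HN (th i g (x, t)) = iota i' g' HN' (th i' g' (x', t)).
  move=> cg cg' /(congr1 \val) /= E t; have ii := ind_at_index E; subst i'.
  have gg : g = g'.
    by move: (E) => /ind_atE[n [gn _]]; rewrite -cg gn canK.
  subst g'; move: E => /ind_at_inj xx; have -> : x = x' by exact: val_inj.
  by rewrite (Prop_irrelevance HN HN').
have closed_pieces (S : set (set_type W)) :
    (forall i g (HN : conj_in i g H), can i g = g -> closed (iota i g HN @^-1` S)) ->
    closed S.
  move=> cS.
  suff cT : closed ((fun u : set_type W => \val u : induced) @` S).
    have := @closed_val_preimage _ W _ cT; congr closed.
    by apply/seteqP; split=> [u [v Sv /val_inj <-//]|u Su]; exists u.
  apply/closed_induced => i g; have [n gn] := canP i g.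
  have [HN|nHN] := pselect (conj_in i (can i g) H); last first.
    rewrite (_ : mkset _ = set0); first exact: closed0.
    apply/seteqP; split=> // x [u _ uE]; case: nHN.
    have : W (ind_at i (can i g) (gact n x)).
      by rewrite -ind_at_val -gn -uE; exact: (set_mem (valP u)).
    by move=> /fixed_ind_at[].
  have cc : can i (can i g) = can i g by rewrite -(canK i (can i g) n) -gn.
  have := continuous_closed (@gact_continuous _ (X i) n)
    (closed_val_image (@cX i (can i g)) (cS i (can i g) HN cc)).
  congr closed; apply/seteqP; split=> x; rewrite /preimage /=.
    move=> [z Sz zE]; exists (iota i (can i g) HN z) => //=.
    by rewrite zE -ind_at_val -gn.
  move=> [u Su]; rewrite [X in ind_at i X x]gn ind_at_val => uE.
  have fx : V i (can i g) (gact n x).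
    have : W (ind_at i (can i g) (gact n x)) by rewrite -uE; exact: (set_mem (valP u)).
    by move=> /fixed_ind_at[].
  exists (insub_set fx) => //; rewrite /preimage /=.
  by rewrite (_ : iota i (can i g) HN _ = u) //; exact: val_inj.
have hE u : exists h : paths R (set_type W), forall i g HN x, can i g = g ->
    u = iota i g HN x -> h = fun t => iota i g HN (th i g (x, t)).
  have [i [g [HN [x [cg uE]]]]] := surj u.
  exists (fun t => iota i g HN (th i g (x, t))) => i' g' HN' x' cg' uE'.
  by apply/funext => t; apply: inj => //; rewrite -uE.
have [h hP] := choice hE.
have hI i g HN x t : can i g = g -> h (iota i g HN x) t = iota i g HN (th i g (x, t)).
  by move=> cg; rewrite (hP _ i g HN x cg erefl).
exists (fun p => h p.1 p.2); split=> /= [|u|u v|u t].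
- apply: (@uncurry_paths R (set_type W) (set_type W) h) => [|u].
    apply/continuous_closedP => S cS; apply: closed_pieces => i g HN cg.
    have cth : continuous (fun p => iota i g HN (th i g p)).
      by apply: (continuous_post (ciota i g HN)); have [] := thP i g.
    have := continuous_closed (curry_paths cth) cS; congr closed.
    by apply/seteqP; split=> x; rewrite /preimage /= (hP _ i g HN x cg erefl).
  have [i [g [HN [x [cg ->]]]]] := surj u; rewrite (hP _ i g HN x cg erefl).
  have cth : continuous (fun p => iota i g HN (th i g p)).
    by apply: (continuous_post (ciota i g HN)); have [] := thP i g.
  exact: (@curry_path R _ _ _ x cth).
- have [i [g [HN [x [cg ->]]]]] := surj u; rewrite hI //.
  by have [_ -> _] := thP i g.
- have [i [g [HN [x [cg ->]]]]] := surj u.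
  have [i' [g' [HN' [x' [cg' ->]]]]] := surj v.
  move=> E; have [ii Ng] := part_inj E; subst i'.
  have gg : g = g'.
    rewrite -cg -cg' (_ : g' = g * sg_val (insub_set Ng : subgroup_type (N i)))%g.
      by rewrite canK.
    by rewrite -[sg_val _]/(g^-1 * g')%g mulgA mulgV mul1g.
  subst g'; rewrite !hI // (Prop_irrelevance HN' HN).
  by have [_ _ t1] := thP i g; rewrite (t1 x x').
- have [i [g [HN [x [cg ->]]]]] := surj u; rewrite hI //.
  by apply: part_eq; rewrite mulVg; exact: sg1.
Qed.
End FixedFibres.
End Space.
Arguments ind_at {X} i g x.

Section Map.
Context (X Z : forall i, filtered_gspace (subgroup_type (N i))).
Context (f : forall i, X i -> Z i).
Arguments f : clear implicits.
Hypothesis gf : forall i, gmap (f i).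
Local Notation F := (gcoprod_ind_map f : induced X -> induced Z).

Lemma gcoprod_ind_mapE i g x :
  F (ind_at (X := X) i g x) = ind_at (X := Z) i g (f i x).
Proof. by rewrite /gcoprod_ind_map /gcoprod_map /= gind_map_pi. Qed.

Lemma part_gcoprod_ind_map u : part (F u) = part u.
Proof.
have [i [g [x ->]]] := ind_at_surj u.
by rewrite gcoprod_ind_mapE !part_ind_at.
Qed.

Lemma range_gcoprod_ind_map i g x :
  range F (ind_at (X := Z) i g x) <-> range (f i) x.
Proof.
split=> [[u _]|[y _ <-]]; last first.
  by exists (ind_at (X := X) i g y) => //; exact: gcoprod_ind_mapE.
have [i' [g' [y ->]]] := ind_at_surj u; rewrite gcoprod_ind_mapE => E.
have ii := ind_at_index E; subst i'; move: E => /ind_atE[n [_ ->]].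
by exists (gact n y) => //; exact: (gf i).2.
Qed.

Lemma gcoprod_ind_map_embedding :
  (forall i, closed_embedding (f i)) -> closed_embedding F.
Proof.
move=> ef; split=> [|u u'|S cS].
- apply/continuous_closedP => S /closed_induced cS; apply/closed_induced => i g.
  have := continuous_closed (gf i).1 (cS i g); congr closed.
  by apply/seteqP; split=> x; rewrite /preimage /= -gcoprod_ind_mapE.
- have [i [g [x ->]]] := ind_at_surj u; have [i' [g' [x' ->]]] := ind_at_surj u'.
  rewrite !gcoprod_ind_mapE => E; have ii := ind_at_index E; subst i'.
  move: E => /ind_atE[n [-> xE]]; apply/ind_atE; exists n; split=> //.
  by have [_ injf _] := ef i; apply: injf; rewrite xE (gf i).2.
- apply/closed_induced => i g; have [_ injf clf] := ef i.
  move: cS => /closed_induced/(_ i g)/clf; congr closed.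
  apply/seteqP; split=> x /=.
    by move=> [y Sy <-]; exists (ind_at (X := X) i g y) => //; exact: gcoprod_ind_mapE.
  move=> [u]; have [i' [g' [y ->]]] := ind_at_surj u; rewrite gcoprod_ind_mapE => Sy E.
  have ii := ind_at_index E; subst i'; move: E => /ind_atE[n [gn ->]].
  exists (gact n y); last exact: (gf i).2.
  by rewrite -ind_at_val -gn.
Qed.
End Map.

Section Filtered.
Context (X : forall i, filtered_gspace (subgroup_type (N i))).

Lemma skel_induced n i g x :
  skel (filtered_gcoprod_ind X) n (ind_at (X := X) i g x) <-> skel (X i) n x.
Proof.
split=> [[h [y [Xy]]]|Xx]; last by exists g, x.
move=> /gind_piE[m [_ yE]]; move: Xy; rewrite yE.
by move=> /(ginvariantE _ _ (@skel_inv _ (X i) n)).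
Qed.

Lemma gcells_filtered_induced (J : I -> nat -> choiceType)
    (K : forall i n, J i n -> subgroup (subgroup_type (N i)))
    (psi : forall i n, J i n -> D n -> X i) :
  (forall i, gcells (skel_pred (X i)) (K i) (psi i)) ->
  gcells (skel_pred (filtered_gcoprod_ind X)) (induced_stabilizer K)
    (induced_char (X := X) psi).
Proof.
move=> gc; have := gcells_induced gc.
rewrite (_ : induced_filtration _ = skel_pred (filtered_gcoprod_ind X)) //.
apply/funext => -[|n].
  by apply/seteqP; split=> // u [i [g [x []]]].
apply/seteqP; split=> u; have [i [g [x ->]]] := ind_at_surj u.
  by move=> /(induced_filtrationE gc n.+1 g x) Yx; apply/skel_induced.
by move=> /skel_induced Yx; apply/(induced_filtrationE gc n.+1 g x).
Qed.
End Filtered.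
End Induced.

(** * The theorem *)

Section Models.
Context {R : realType}.
Local Notation D n := (set_type (@disk R n)).

Lemma gcw_closed_fixed (G : groupType) (X : filtered_gspace G) (H : subgroup G) :
  gcw R X -> closed (fixed_points X H).
Proof.
move=> /gcw_gcells[J [K [psi gc]]]; apply: (closed_fixed_points gc).
by rewrite setI0; exact: closed0.
Qed.

Lemma contractible_fibrewise (T : topologicalType) :
  contractible R T -> fibrewise_contractible (R := R) (fun _ : T => tt).
Proof.
move=> /contractibleP[x0 [h [ch h0 h1 _]]]; exists h; split=> // x y _.
by rewrite !h1.
Qed.

Lemma empty_fibrewise (T : topologicalType) :
  (T -> False) -> fibrewise_contractible (R := R) (fun _ : T => tt).
Proof. by move=> nT; exists fst; split=> //; exact: fst_continuous. Qed.

Lemma model_fibrewise (G : groupType) (F : subgroup_family G)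
    (X : filtered_gspace G) (H : subgroup G) : classifying_model R F X ->
  fibrewise_contractible (R := R) (fun _ : set_type (fixed_points X H) => tt).
Proof.
move=> [_ /(_ H)[cH eH]]; have [FH|nFH] := pselect (fam_set F H).
  exact/contractible_fibrewise/cH.
by apply: empty_fibrewise => x; have /seteqP[/(_ _ (set_mem (valP x)))] := eH nFH.
Qed.

Lemma model_point (G : groupType) (F : subgroup_family G)
    (X : filtered_gspace G) (H : subgroup G) :
  classifying_model R F X -> fam_set F H -> exists x, fixed_points X H x.
Proof.
move=> [_ /(_ H)[cH _]] /cH[x _]; exists (\val x); exact: (set_mem (valP x)).
Qed.

Lemma model_family (G : groupType) (F : subgroup_family G)
    (X : filtered_gspace G) (H : subgroup G) x :
  classifying_model R F X -> fixed_points X H x -> fam_set F H.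
Proof.
move=> [_ /(_ H)[_ eH]] fx; apply: contrapT => /eH e.
by move: fx; rewrite e.
Qed.

Lemma fibrewise_connected (T : topologicalType) (S : Type) (p : T -> S) (x0 : T) :
  fibrewise_contractible (R := R) p -> (forall x, p x = p x0) ->
  exists x1, homotopic_rel R set0 (@id T) (fun=> x1).
Proof.
move=> [h [ch h0 h1 _]] px; exists (h (x0, 1)), h; split=> // x.
by apply: h1; exact: px.
Qed.

Lemma pushout_sym (A B C P : topologicalType)
    (a : A -> B) (b : A -> C) (c : B -> P) (d : C -> P) :
  pushout a b c d -> pushout b a d c.
Proof.
move=> [cc cd com surj univ]; split=> // [p|Z u v cu cv uv].
- by have [] := surj p; [right|left].
- by have [||x|w [cw wc wd]] := univ Z v u; rewrite ?uv //; exists w.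
Qed.

Lemma pushout_contractiblel (A B C P : topologicalType)
    (a : A -> B) (b : A -> C) (c : B -> P) (d : C -> P) y0 :
  pushout a b c d -> (C -> False) -> homotopic_rel R set0 (@id B) (fun=> y0) ->
  homotopic_rel R set0 (@id P) (fun=> c y0).
Proof.
move=> po nC [h [ch h0 h1 _]].
have [||x|w [cw wc wd]] := po_univ po (u := @id B) (v := fun z => False_rect B (nC z)).
- exact: id_continuous.
- by move=> z; case: (nC z).
- by case: (nC (b x)).
exists (fun p => c (h (w p.1, p.2))); split=> // [|p|p].
- exact: (continuous_post (po_contl po) (first_comp_continuous cw ch)).
- have [[y <-]|[z _]] := po_surj po p; last by case: (nC z).
  by rewrite h0 wc.
- by rewrite h1.
Qed.

Lemma gpushout_sym (G : groupType) (A B C P : gspace G)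
    (a : A -> B) (b : A -> C) (c : B -> P) (d : C -> P) :
  gpushout a b c d -> gpushout b a d c.
Proof.
move=> [[ga gb gc gd] com univ]; split=> // Z u v gu gv uv.
have [h [[gh hc hd] hu]] := univ Z v u gv gu (esym uv).
by exists h; split=> // h' [gh' h'c h'd]; apply: hu.
Qed.

Lemma gcw_inclusion_embedding (G : groupType) (X Y : filtered_gspace G) (f : X -> Y) :
  gcw_inclusion R f -> closed_embedding f.
Proof. by move=> [[cf _] injf clf _ _]. Qed.

Lemma gcw_inclusion_skel_pred (G : groupType) (X Y : filtered_gspace G) (f : X -> Y)
    n x : gcw_inclusion R f -> skel_pred Y n (f x) -> skel_pred X n x.
Proof. by move=> [_ _ _ fs _]; case: n => //= n; rewrite -fs. Qed.

Lemma skel_pred_pushout (G : groupType) (A : gspace G) (B C : filtered_gspace G)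
    (P : gspace G) (a : A -> B) (b : A -> C) (c : B -> P) (d : C -> P)
    (po : gpushout a b c d) n :
  skel_pred (filtered_gpushout po) n = c @` skel_pred B n `|` d @` skel_pred C n.
Proof. by case: n => //=; rewrite !image_set0 setU0. Qed.

Section GluingModels.
Context (G : groupType) (A : gspace G) (B C P : filtered_gspace G).
Context (a : A -> B) (b : A -> C) (c : B -> P) (d : C -> P).
Context (J : nat -> choiceType) (K : forall n, J n -> subgroup G).
Context (psi : forall n, J n -> D n -> C).
Arguments psi n _ _ : clear implicits.
Hypotheses (po : gpushout a b c d) (eb : closed_embedding b).
Hypotheses (cB : gcw R B) (gC : gcells (skel_pred C) K psi).
Hypothesis sat : forall n j,
  (forall y, open_disk (\val y) -> range b (psi n j y)) \/
  (forall y, open_disk (\val y) -> ~ range b (psi n j y)).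

Let ga : gmap a. Proof. by case: po => -[]. Qed.
Let gb : gmap b. Proof. by case: po => -[]. Qed.
Let gc : gmap c. Proof. by case: po => -[]. Qed.
Let gd : gmap d. Proof. by case: po => -[]. Qed.
Let gl : gluing a b c d. Proof. exact: gpushout_gluing. Qed.

Lemma gcw_gluing :
  (forall n x, skel_pred C n (b x) -> skel_pred B n (a x)) ->
  (forall n, skel_pred P n = c @` skel_pred B n `|` d @` skel_pred C n) ->
  gcw R P.
Proof.
move=> filt skP; have [JB [KB [psiB gB]]] := gcw_gcells cB.
have := gcells_gluing gb gc gd gl gB gC sat filt.
rewrite (_ : glued_filtration _ _ _ _ = skel_pred P); first exact: gcells_gcw.
by apply/funext => n; rewrite skP.
Qed.

Context (H : subgroup G).

Lemma gluing_fixed_pushout :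
  pushout (fixed_map ga (H := H)) (fixed_map gb (H := H))
    (fixed_map gc (H := H)) (fixed_map gd (H := H)).
Proof.
apply/gluing_pushout/gluing_fixed => //; apply: gcw_closed_fixed => //.
exact: gcells_gcw gC.
Qed.

Lemma gluing_fixed_extension : has_extension (R := R) (fixed_map gb (H := H)).
Proof.
have [_ _ clb] := eb.
have gR := gcells_relative gC (clb _ closedT) (ginvariant_range gb) sat.
have cH : closed (fixed_points C H).
  by apply: gcw_closed_fixed; exact: gcells_gcw gC.
exact: (@fixed_has_extension R G A C b _ _ _ _ H gb eb gR (setU0 _) cH).
Qed.
End GluingModels.
End Models.

Section Orbits.
Context (R : realType) (G : groupType) (F Gf : subgroup_family G).
Hypothesis FG : fam_set F `<=` fam_set Gf.
Context (sim : fam_diff F Gf -> fam_diff F Gf -> Prop).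
Hypothesis adm : admissible sim.
Context (I : set (fam_diff F Gf)).
Hypothesis Irep : orbit_representatives sim I.
Local Notation N i := (class_normalizer adm (rep_val i)).
Context (EFN EGN : forall i : set_type I, filtered_gspace (subgroup_type (N i))).
Arguments EFN i : clear implicits.
Arguments EGN i : clear implicits.
Hypothesis EFN_model : forall i : set_type I,
  classifying_model R (fam_restrict F (N i)) (EFN i).
Hypothesis EGN_model : forall i : set_type I,
  classifying_model R (class_family adm (rep_val i)) (EGN i).
Local Notation U := (induced (fun i : set_type I => EFN i : gspace _)).
Local Notation V := (induced (fun i : set_type I => EGN i : gspace _)).
Local Notation atU i g x :=
  (@ind_at _ _ _ (fun r : set_type I => EFN r : gspace _) i g x).
Local Notation atV i g x :=
  (@ind_at _ _ _ (fun r : set_type I => EGN r : gspace _) i g x).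
Implicit Types (i : set_type I) (g : G) (H : subgroup G).

Lemma fam_conjE (Fm : subgroup_family G) g H :
  fam_set Fm (conj_subgroup g H) <-> fam_set Fm H.
Proof.
split=> [/(fam_conj g^-1%g)|]; last exact: fam_conj.
by rewrite conj_subgroup_comp mulVg conj_subgroup_id.
Qed.

(** The isotropy of a fixed point lies in the family of the model, and this
    says that H is in F or that its class is that of the representative. *)
Lemma fixedV H i g x : fixed_points V H (atV i g x) ->
  conj_in (fun i : set_type I => N i) i g H /\
  (fam_set F H \/ exists2 d : fam_diff F Gf, fd_val d = H &
     sim (fd_conj g^-1 d) (rep_val i)).
Proof.
move=> /fixed_ind_at[HN fx]; split=> //.
have := model_family (EGN_model i) fx.
move=> [[K KE /(sim_classE adm) Ki]|]; last first.
  move=> FL; left; have : fam_set F (ambient (pullback (fun i => N i) i g H)) := FL.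
  by rewrite (ambient_pullback HN) fam_conjE.
rewrite (ambient_pullback HN) in KE; right; exists (fd_conj g K).
  by rewrite -[LHS]/(conj_subgroup g (fd_val K)) KE conj_subgroup_comp mulgV conj_subgroup_id.
by rewrite fd_conjM mulVg fd_conj1.
Qed.

Lemma fixedV_family H u : fixed_points V H u -> fam_set Gf H.
Proof.
have [i [g [x ->]]] := ind_at_surj u.
move=> /fixedV[_ [/FG//|[d <- _]]]; exact: (fd_valP d).1.
Qed.

(** For H in F the subgroup g^-1 H g of N_i lies in both families, so both
    induced spaces have fixed points in the same summands. *)
Lemma fixedV_fibre H u : fam_set F H -> fixed_points V H u ->
  exists2 w : U, fixed_points U H w & part w = part u.
Proof.
have [i [g [x ->]]] := ind_at_surj u; move=> FH /fixed_ind_at[HN _].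
have [|y fy] := model_point (EFN_model i) (H := pullback (fun i => N i) i g H).
  by rewrite /= (ambient_pullback HN); exact: fam_conj.
exists (atU i g y); first by apply/fixed_ind_at.
by rewrite !part_ind_at.
Qed.

(** The class of H is conjugate by some g to that of a representative r, and
    then g^-1 H g normalizes the class of r because H normalizes itself. *)
Lemma fixedV_nonempty H : fam_set Gf H -> ~ fam_set F H ->
  exists u, fixed_points V H u.
Proof.
move=> GH FH; pose d : fam_diff F Gf := fd_mk GH FH.
have [r [[Ir [g /(sim_classE adm) gr]] _]] := Irep d.
pose i : set_type I := insub_set Ir.
have gd : sim (fd_conj g^-1 d) r.
  have := (adm_conj adm g^-1%g _ _).1 gr; rewrite fd_conjM mulVg fd_conj1.
  exact: (adm_sym adm).
have HN : conj_in (fun i : set_type I => N i) i g H.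
  move=> h Hh; rewrite /= (sim_classE adm).
  have hd : fd_conj h^-1 d = d.
    apply: fd_val_inj; apply: subgroupP; apply/seteqP; split=> x /=.
      move=> [k Hk <-]; apply: sgM; last by rewrite invgK.
      by apply: sgM => //; exact: sgV.
    move=> Hx; exists (h * x * h^-1)%g.
      by apply: sgM; [exact: sgM|exact: sgV].
    by rewrite invgK !mulgA mulVg mul1g mulgVK.
  have := (adm_conj adm h^-1%g _ _).1 gr; rewrite hd fd_conjM.
  move=> /(adm_conj adm g^-1%g); rewrite fd_conjM => rd.
  rewrite !invgM invgK mulgA in rd *.
  exact: (adm_trans adm) rd gd.
have [|x fx] := model_point (EGN_model i) (H := pullback (fun i => N i) i g H).
  left; exists (fd_conj g^-1 d); last exact/(sim_classE adm).
  by rewrite /= (ambient_pullback HN).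
by exists (atV i g x); apply/fixed_ind_at.
Qed.

(** The class of H determines its representative in [I], and it determines g
    modulo the normalizer of that representative. *)
Lemma fixedV_part H u v : ~ fam_set F H ->
  fixed_points V H u -> fixed_points V H v -> part u = part v.
Proof.
have [i [g [x ->]]] := ind_at_surj u; have [i' [g' [x' ->]]] := ind_at_surj v.
move=> FH /fixedV[_ [//|[d dH di]]] /fixedV[_ [//|[d' dH' di']]].
have dd : d' = d by apply: fd_val_inj; rewrite dH.
subst d'.
have up g0 (r : fam_diff F Gf) : sim (fd_conj g0^-1 d) r -> sim (fd_conj g0 r) d.
  move=> /(adm_conj adm g0); rewrite fd_conjM mulgV fd_conj1.
  exact: (adm_sym adm).
have [r [_ ru]] := Irep d.
have ri : r = rep_val i.
  apply: ru; split; first exact: (set_mem (valP i)).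
  by exists g; apply/(sim_classE adm)/up.
have ri' : r = rep_val i'.
  apply: ru; split; first exact: (set_mem (valP i')).
  by exists g'; apply/(sim_classE adm)/up.
have ii : i = i' by apply: val_inj; exact: etrans (esym ri) ri'.
subst i'; apply: part_eq; rewrite /= (sim_classE adm) invgM invgK -fd_conjM.
apply: (adm_trans adm) di'; apply: (iffLR (adm_conj adm _ _ _)).
exact: up.
Qed.

Lemma fixedU_fibrewise H :
  fibrewise_contractible (R := R) (fixed_part (X := fun i => EFN i : gspace _) (H := H)).
Proof.
apply: induced_fibrewise_contractible => i g.
  by apply: gcw_closed_fixed; exact: (EFN_model i).1.
exact: model_fibrewise (EFN_model i).
Qed.

Lemma fixedV_fibrewise H :
  fibrewise_contractible (R := R) (fixed_part (X := fun i => EGN i : gspace _) (H := H)).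
Proof.
apply: induced_fibrewise_contractible => i g.
  by apply: gcw_closed_fixed; exact: (EGN_model i).1.
exact: model_fibrewise (EGN_model i).
Qed.

Lemma induced_gcells (E : forall i : set_type I, filtered_gspace (subgroup_type (N i))) :
  (forall i, gcw R (E i)) ->
  exists (J : forall i, nat -> choiceType)
    (K : forall i n, J i n -> subgroup (subgroup_type (N i)))
    (psi : forall i n, J i n -> set_type (@disk R n) -> E i),
    forall i, gcells (skel_pred (E i)) (K i) (psi i).
Proof.
move=> cE.
pose T i := {J : nat -> choiceType & ((forall n, J n -> subgroup (subgroup_type (N i))) *
  (forall n, J n -> set_type (@disk R n) -> E i))%type}.
have ex i : exists t : T i, gcells (skel_pred (E i)) (projT2 t).1 (projT2 t).2.
  by have [J [K [psi gc]]] := gcw_gcells (cE i); exists (existT _ J (K, psi)).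
exists (fun i => projT1 (projT1 (cid (ex i)))),
  (fun i => (projT2 (projT1 (cid (ex i)))).1),
  (fun i => (projT2 (projT1 (cid (ex i)))).2).
by move=> i; exact: (projT2 (cid (ex i))).
Qed.

Section Glued.
Context (EF P : filtered_gspace G) (EF_model : classifying_model R F EF).
Context (H : subgroup G).
Context (aH : set_type (fixed_points U H) -> set_type (fixed_points EF H)).
Context (fH : set_type (fixed_points U H) -> set_type (fixed_points V H)).
Context (jH : set_type (fixed_points EF H) -> set_type (fixed_points P H)).
Context (kH : set_type (fixed_points V H) -> set_type (fixed_points P H)).
Hypothesis po : pushout aH fH jH kH.

Lemma glued_fixed_empty : ~ fam_set Gf H -> fixed_points P H = set0.
Proof.
move=> nG; apply/seteqP; split=> // p fp; apply: nG.
have [[y _]|[z _]] := po_surj po (insub_set fp).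
  exact: FG (model_family EF_model (set_mem (valP y))).
exact: fixedV_family (set_mem (valP z)).
Qed.

(** Outside F the corner [EF] has no fixed points, and the induced spaces
    contribute a single contractible summand. *)
Lemma glued_fixed_contractible : fam_set Gf H -> ~ fam_set F H ->
  contractible R (set_type (fixed_points P H)).
Proof.
move=> GH FH; apply/contractibleP; have [u fu] := fixedV_nonempty GH FH.
have [v|x1 hx1] := fibrewise_connected (x0 := insub_set fu) (fixedV_fibrewise H).
  by apply: (fixedV_part FH) fu; exact: (set_mem (valP v)).
exists (kH x1); apply: pushout_contractiblel (pushout_sym po) _ hx1 => y.
by apply: FH; exact: model_family EF_model (set_mem (valP y)).
Qed.
End Glued.

Context (f : forall i : set_type I, EFN i -> EGN i).
Arguments f i _ : clear implicits.
Hypothesis gf : forall i, gmap (f i).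
Local Notation fF := (gcoprod_ind_map f : U -> V).

Lemma fixed_part_map H (gF : gmap fF) u :
  fixed_part (fixed_map gF (H := H) u) = fixed_part u.
Proof. exact: part_gcoprod_ind_map. Qed.

Lemma fixed_part_surj H (v : set_type (fixed_points V H)) : fam_set F H ->
  exists u : set_type (fixed_points U H), fixed_part u = fixed_part v.
Proof.
move=> FH; have [w fw wv] := fixedV_fibre FH (set_mem (valP v)).
by exists (insub_set fw).
Qed.
End Orbits.

Theorem theorem2p3 (R : realType) (G : groupType) (F Gf : subgroup_family G)
    (FG : fam_set F `<=` fam_set Gf)
    (sim : fam_diff F Gf -> fam_diff F Gf -> Prop) (adm : admissible sim)
    (I : set (fam_diff F Gf)) (Irep : orbit_representatives sim I)
    (EFN EGN : forall H : set_type I,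
       filtered_gspace (subgroup_type (class_normalizer adm (rep_val H))))
    (EFN_model : forall H : set_type I,
       classifying_model R (fam_restrict F (class_normalizer adm (rep_val H)))
         (EFN H))
    (EGN_model : forall H : set_type I,
       classifying_model R (class_family adm (rep_val H)) (EGN H))
    (EF : filtered_gspace G) (EF_model : classifying_model R F EF)
    (f : forall H : set_type I, EFN H -> EGN H)
    (i : filtered_gcoprod_ind EFN -> EF)
    (X : gspace G) (j : EF -> X) (k : filtered_gcoprod_ind EGN -> X)
    (po : gpushout i (gcoprod_ind_map f) j k)
    (cell :
       ((forall H : set_type I, cellular_gmap (f H)) /\ gcw_inclusion R i) \/
       ((forall H : set_type I, gcw_inclusion R (f H)) /\ cellular_gmap i)) :
  classifying_model R Gf (filtered_gpushout po).
Proof.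
have gf H : gmap (f H) by case: cell => [[/(_ H)[]]|[/(_ H)[]]].
have [J' [K' [psi' gc']]] := induced_gcells (fun H => (EGN_model H).1).
have gV := gcells_filtered_induced gc'.
have cV : gcw R (filtered_gcoprod_ind EGN) by exact: gcells_gcw gV.
have cF := EF_model.1.
have skP n : skel_pred (filtered_gpushout po) n = j @` skel_pred EF n `|`
    k @` skel_pred (filtered_gcoprod_ind EGN) n.
  exact: skel_pred_pushout.
have EFH H : fam_set F H ->
    exists x0, homotopic_rel R set0 (@id (set_type (fixed_points EF H))) (fun=> x0).
  by move=> FH; apply/contractibleP; exact: (EF_model.2 H).1.
(* The embedded leg of the pushout is [i] in the first case and the map of
   induced spaces in the second. *)
case: cell => [[cf ii]|[fi ci]].
- have po' : gpushout (gcoprod_ind_map f) i k j := gpushout_sym po.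
  have [J [K [psi gF]]] := gcw_gcells cF.
  have [_ _ _ _ subc] := ii; have ei := gcw_inclusion_embedding ii.
  have sat := gsubcomplex_saturated cF gF subc.
  split.
    apply: (gcw_gluing (P := filtered_gpushout po) po' ei cV gF sat) => [n u|n]; last by rewrite setUC skP.
    move=> /(gcw_inclusion_skel_pred ii); have [r [g [x ->]]] := ind_at_surj u.
    case: n => // n /skel_induced Xx; rewrite gcoprod_ind_mapE //.
    by apply/skel_induced; exact: (cf r).2.
  move=> H; have poH := gluing_fixed_pushout (P := filtered_gpushout po) po' ei cV gF H.
  have ext := gluing_fixed_extension (P := filtered_gpushout po) (po := po') (H := H) ei gF sat.
  split; last exact: (glued_fixed_empty FG EGN_model EF_model (pushout_sym poH)).
  move=> GH; have [FH|nFH] := pselect (fam_set F H); last first.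
    exact: (glued_fixed_contractible Irep EGN_model EF_model (pushout_sym poH)).
  have [x0 hx0] := EFH H FH; apply/contractibleP.
  apply: (glue_to_contractible poH ext _ _ hx0 (fixedU_fibrewise EFN_model H)
    (fixedV_fibrewise EGN_model H)).
  + exact: fixed_map_continuous.
  + exact: fixed_map_continuous.
  + exact: fixed_part_locally_constant.
  + by move=> u; exact: fixed_part_map.
  + by move=> v; exact: fixed_part_surj.
have ef H : closed_embedding (f H) by exact: gcw_inclusion_embedding (fi H).
have eF := gcoprod_ind_map_embedding gf ef.
have sat n (q : induced_cells J' n) :
    (forall y, open_disk (\val y) ->
       range (gcoprod_ind_map f) (induced_char psi' q y)) \/
    (forall y, open_disk (\val y) ->
       ~ range (gcoprod_ind_map f) (induced_char psi' q y)).
  case: q => r q; have [_ _ _ _ subc] := fi r.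
  have [A|nA] := gsubcomplex_saturated (EGN_model r).1 (gc' r) subc q; [left|right].
    by move=> y oy; apply/range_gcoprod_ind_map => //; exact: A.
  by move=> y oy /(range_gcoprod_ind_map gf); exact: nA.
split.
  apply: (gcw_gluing (P := filtered_gpushout po) po eF cF gV sat) => // n u.
  have [r [g [x ->]]] := ind_at_surj u; rewrite gcoprod_ind_mapE //.
  case: n => // n /skel_induced Xx; apply: (ci.2 n); apply/skel_induced.
  have [_ _ _ fs _] := fi r; by rewrite -fs.
move=> H; have poH := gluing_fixed_pushout (P := filtered_gpushout po) po eF cF gV H.
have ext := gluing_fixed_extension (P := filtered_gpushout po) (po := po) (H := H) eF gV sat.
split; last exact: (glued_fixed_empty FG EGN_model EF_model poH).
move=> GH; have [FH|nFH] := pselect (fam_set F H); last first.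
  exact: (glued_fixed_contractible Irep EGN_model EF_model poH).
have [x0 hx0] := EFH H FH; apply/contractibleP.
apply: (glue_along_contractible poH ext _ _ hx0 (fixedU_fibrewise EFN_model H)
  (fixedV_fibrewise EGN_model H)).
- exact: fixed_map_continuous.
- exact: fixed_map_continuous.
- exact: fixed_part_locally_constant.
- by move=> u; exact: fixed_part_map.
- by move=> v; exact: fixed_part_surj.
Qed.
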